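(* Let $K$ be a field, let $n\ge 1$, let $Q$ be a quiver of type $\mathbb{A}_n$, and let $\Lambda=KQ$ be its path algebra. Put $p=|\{i\mid i \text{ is a source in } Q \text{ with } 2\le i\le n-1\}|$. Then the number of minimal right determiners of all irreducible morphisms between indecomposable modules in $\mathrm{mod}\,\Lambda$ is $$|\mathrm{Det}(\Lambda)|=\begin{cases}2n-2, & \text{if } p=0;\\ 2n-p-1, & \text{if } p\ge 1.\end{cases}$$
   Context: A quiver $Q$ is of type $\mathbb{A}_n$ if its underlying unoriented graph is the Dynkin diagram $1 - 2 - \cdots - n$ (vertices numbered consecutively; arrow $\alpha_i$ joins $i$ and $i+1$, with arbitrary orientation). $\mathrm{mod}\,\Lambda$ is the category of finitely generated left $\Lambda$-modules; paths are composed from right to left, so left $\Lambda$-modules are representations of $Q$. Minimal right determiner: an indecomposable projective module $P$ almost factors through $f:M\to N$ if there are morphisms $u:\mathrm{rad}\,P\to M$ and $h:P\to N$ with $h\iota=fu$, where $\iota:\mathrm{rad}\,P\to P$ is the inclusion, such that $\mathrm{Im}\,h\not\subseteq \mathrm{Im}\,f$. If $f:B\to C$ with $B=B_1\oplus B_2$, $B_1\subseteq\mathrm{Ker}\,f$ and $f|_{B_2}$ right minimal, then $\mathrm{Ker}\,f|_{B_2}$ is the intrinsic kernel of $f$ (for an irreducible morphism it equals $\mathrm{Ker}\,f$). The minimal right determiner $C(f)$ of $f$ is the direct sum, one from each isomorphism class, of the indecomposable modules $\tau^{-1}X$ with $X$ an indecomposable direct summand of the intrinsic kernel of $f$ ($\tau$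 the Auslander–Reiten translation) and of the indecomposable projective modules which almost factor through $f$. $\mathrm{Det}(\Lambda)$ is the set of (isomorphism classes of) modules $C(f)$, where $f$ runs over all irreducible morphisms between indecomposable modules in $\mathrm{mod}\,\Lambda$. *)

(* Defs.v *)
From HB Require Import structures.
From mathcomp Require Import all_boot all_algebra.

Set Implicit Arguments.
Unset Strict Implicit.
Unset Printing Implicit Defensive.

Import GRing.Theory.
Local Open Scope ring_scope.

Record quiver := Quiver {
  vert : finType;
  arr : finType;
  src : arr -> vert;
  tgt : arr -> vert }.

Definition opq (Q : quiver) : quiver := Quiver (@tgt Q) (@src Q).

Definition is_source (Q : quiver) (i : vert Q) : bool :=
  [forall a : arr Q, tgt a != i].

Lemma ord_pred_ltS (n : nat) (a : 'I_n.-1) : (a.+1 < n)%N.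
Proof. by rewrite -ltn_predRL. Qed.

(* The vertices 1, ..., n of the Dynkin diagram are 0, ..., n.-1 here. The arrow
   number a goes from a to a.+1 if o a holds and from a.+1 to a otherwise. *)
Definition quiverA (n : nat) (o : 'I_n.-1 -> bool) : quiver :=
  let lo (a : 'I_n.-1) : 'I_n := widen_ord (leq_pred n) a in
  let hi (a : 'I_n.-1) : 'I_n := Ordinal (ord_pred_ltS a) in
  @Quiver 'I_n 'I_n.-1 (fun a => if o a then lo a else hi a)
                       (fun a => if o a then hi a else lo a).

(* Finite-dimensional representations of Q over K, that is, finitely generated
   left KQ-modules. *)
Record qrep (K : fieldType) (Q : quiver) := QRep {
  qsp :> vert Q -> vectType K;
  qmap : forall a : arr Q, 'Hom(qsp (src a), qsp (tgt a)) }.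

Record qhom (K : fieldType) (Q : quiver) (M N : qrep K Q) := QHom {
  hmap :> forall i : vert Q, 'Hom(M i, N i);
  hmapP : forall a : arr Q,
    (qmap N a \o hmap (src a))%VF = (hmap (tgt a) \o qmap M a)%VF }.

Section Representations.
Variables (K : fieldType) (Q : quiver).
Implicit Types (M N X Y Z : qrep K Q).

Definition qinj M N (f : qhom M N) : Prop := forall i, lker (f i) = 0%VS.
Definition qsurj M N (f : qhom M N) : Prop := forall i, limg (f i) = fullv.

Lemma hcomp_subproof M N X (g : qhom N X) (f : qhom M N) (a : arr Q) :
  (qmap X a \o (g (src a) \o f (src a)))%VF =
  ((g (tgt a) \o f (tgt a)) \o qmap M a)%VF.
Proof. by rewrite comp_lfunA hmapP -!comp_lfunA hmapP. Qed.

Definition hcomp M N X (g : qhom N X) (f : qhom M N) : qhom M X :=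
  @QHom K Q M X (fun i => (g i \o f i)%VF) (hcomp_subproof g f).

Lemma hid_subproof M (a : arr Q) :
  (qmap M a \o \1)%VF = (\1 \o qmap M a)%VF.
Proof. by rewrite comp_lfun1r comp_lfun1l. Qed.

Definition hid M : qhom M M :=
  @QHom K Q M M (fun i => \1%VF) (@hid_subproof M).

(* Equality of morphisms is componentwise, as qhom carries a proof. *)
Definition heq M N (f g : qhom M N) : Prop := forall i, f i = g i.

Definition split_mono M N (f : qhom M N) : Prop :=
  exists g : qhom N M, heq (hcomp g f) (hid M).
Definition split_epi M N (f : qhom M N) : Prop :=
  exists g : qhom N M, heq (hcomp f g) (hid N).
Definition is_iso M N (f : qhom M N) : Prop :=
  exists g : qhom N M, heq (hcomp g f) (hid M) /\ heq (hcomp f g) (hid N).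
Definition isomorphic M N : Prop := exists f : qhom M N, is_iso f.

Definition is_zero M : Prop := forall i, fullv = 0%VS :> {vspace M i}.

Definition zero_rep : qrep K Q :=
  @QRep K Q (fun _ => 'rV[K]_0) (fun _ => 0).

Definition pair_map (V V' W W' : vectType K) (f : 'Hom(V, V')) (g : 'Hom(W, W'))
  (p : (V * W)%type) : (V' * W')%type := (f p.1, g p.2).

Lemma pair_map_is_linear (V V' W W' : vectType K) (f : 'Hom(V, V')) (g : 'Hom(W, W')) :
  linear (pair_map f g).
Proof. by move=> c p q; rewrite /pair_map !linearP. Qed.

HB.instance Definition _ (V V' W W' : vectType K) (f : 'Hom(V, V')) (g : 'Hom(W, W')) :=
  GRing.isLinear.Build K (V * W)%type (V' * W')%type _ (pair_map f g)
    (pair_map_is_linear f g).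

Definition dsum M N : qrep K Q :=
  @QRep K Q (fun i => (M i * N i)%type)
    (fun a => linfun (pair_map (qmap M a) (qmap N a))).

Definition big_dsum (Ms : seq (qrep K Q)) : qrep K Q := foldr dsum zero_rep Ms.

Definition direct_summand X M : Prop := exists Y, isomorphic M (dsum X Y).

Definition indecomposable M : Prop :=
  ~ is_zero M /\
  forall X Y, isomorphic M (dsum X Y) -> is_zero X \/ is_zero Y.

Definition irreducible M N (f : qhom M N) : Prop :=
  [/\ ~ split_mono f, ~ split_epi f &
      forall X (h : qhom M X) (g : qhom X N),
        heq f (hcomp g h) -> split_mono h \/ split_epi g].

Definition projective P : Prop :=
  forall M N (g : qhom M N) (h : qhom P N), qsurj g ->
    exists h' : qhom P M, heq (hcomp g h') h.

Definition subrep M (U : forall i, {vspace M i}) : Prop :=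
  forall a : arr Q, (qmap M a @: U (src a) <= U (tgt a))%VS.

Definition maximal_subrep M (U : forall i, {vspace M i}) : Prop :=
  [/\ subrep U,
      ~ (forall i, U i = fullv) &
      forall W : forall i, {vspace M i},
        subrep W -> (forall i, (U i <= W i)%VS) ->
        (forall i, W i = U i) \/ (forall i, W i = fullv)].

(* iota : R -> M is the inclusion of rad M, the intersection of the maximal
   subrepresentations of M. *)
Definition is_radical R M (iota : qhom R M) : Prop :=
  qinj iota /\
  forall i (v : M i),
    v \in limg (iota i) <->
    forall U : forall j, {vspace M j}, maximal_subrep U -> v \in U i.

Definition almost_factors P M N (f : qhom M N) : Prop :=
  exists R (iota : qhom R P) (u : qhom R M) (h : qhom P N),
    [/\ is_radical iota, heq (hcomp h iota) (hcomp f u) &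
        ~ (forall i, (limg (h i) <= limg (f i))%VS)].

Definition right_minimal M N (f : qhom M N) : Prop :=
  forall h : qhom M M, heq (hcomp f h) f -> is_iso h.

Definition is_kernel L M N (k : qhom L M) (f : qhom M N) : Prop :=
  qinj k /\ forall i, limg (k i) = lker (f i).

(* phi identifies B with B1 (+) B2; the equation says that f vanishes on B1 and
   restricts to f2 on B2. *)
Definition intrinsic_kernel B C (f : qhom B C) L : Prop :=
  exists B1 B2 (phi : qhom (dsum B1 B2) B) (f2 : qhom B2 C) (k : qhom L B2),
    [/\ is_iso phi,
        (forall i (v : B1 i) (w : B2 i), f i (phi i (v, w)) = f2 i w),
        right_minimal f2 &
        is_kernel k f2].

(* Ms lists the isomorphism classes of S: one representative for each. *)
Definition lists_iso_classes (S : qrep K Q -> Prop) (Ms : seq (qrep K Q)) : Prop :=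
  [/\ (forall k, (k < size Ms)%N -> S (nth zero_rep Ms k)),
      (forall k l, (k < size Ms)%N -> (l < size Ms)%N ->
         isomorphic (nth zero_rep Ms k) (nth zero_rep Ms l) -> k = l) &
      (forall M, S M ->
         exists2 k, (k < size Ms)%N & isomorphic M (nth zero_rep Ms k))].

Definition superfluous M (U : forall i, {vspace M i}) : Prop :=
  forall L : forall i, {vspace M i}, subrep L ->
    (forall i, (L i + U i)%VS = fullv) -> forall i, L i = fullv.

(* P1 --d1--> P0 --d0--> M --> 0; both P0 -> M and P1 -> Ker d0 are projective
   covers, the kernel of the latter being Ker d1. *)
Definition minimal_projective_presentation P1 P0 M
    (d1 : qhom P1 P0) (d0 : qhom P0 M) : Prop :=
  [/\ projective P1 /\ projective P0,
      qsurj d0,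
      forall i, limg (d1 i) = lker (d0 i),
      superfluous (fun i => lker (d0 i)) &
      superfluous (fun i => lker (d1 i))].

End Representations.

(* s lists the arrows of a path from i to j, in the order of traversal. *)
Fixpoint is_path (Q : quiver) (i j : vert Q) (s : seq (arr Q)) : bool :=
  if s is a :: s' then (src a == i) && is_path (tgt a) j s' else i == j.

Lemma is_path_rcons (Q : quiver) (i : vert Q) (b : arr Q) (s : seq (arr Q)) :
  is_path i (src b) s -> is_path i (tgt b) (rcons s b).
Proof.
elim: s i => [i /eqP -> /=|c s IHs i /= /andP[-> /IHs //]].
by rewrite !eqxx.
Qed.

(* In a quiver without oriented cycles a path never repeats an arrow, so the
   bound on the length excludes nothing. *)
Definition qpath (Q : quiver) (i j : vert Q) :=
  {s : {bseq #|arr Q| of arr Q} | is_path i j s}.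

Section PathAlgebra.
Variables (K : fieldType) (Q : quiver).

Definition path_space (i j : vert Q) : vectType K := {ffun qpath i j -> K^o}.

(* Multiplication by a on the paths from i to src a; the sum has at most one
   term, indexed by the p with q = a p. *)
Definition post_arrow (i : vert Q) (a : arr Q) (f : path_space i (src a)) :
    path_space i (tgt a) :=
  [ffun q : qpath i (tgt a) =>
     \sum_(p : qpath i (src a) | rcons (val p) a == val q :> seq _) f p].

(* Multiplication by a on the paths from tgt a to j, precomposing with a. *)
Definition pre_arrow (a : arr Q) (j : vert Q) (f : path_space (tgt a) j) :
    path_space (src a) j :=
  [ffun q : qpath (src a) j =>
     \sum_(p : qpath (tgt a) j | a :: val p == val q :> seq _) f p].

Lemma post_arrow_is_linear i a : linear (@post_arrow i a).
Proof.
move=> c f g; apply/ffunP=> q; rewrite !ffunE /= scaler_sumr -big_split.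
by apply: eq_bigr => p _; rewrite !ffunE.
Qed.

HB.instance Definition _ i a :=
  GRing.isLinear.Build K (path_space i (src a)) (path_space i (tgt a)) _
    (@post_arrow i a) (@post_arrow_is_linear i a).

Lemma pre_arrow_is_linear a j : linear (@pre_arrow a j).
Proof.
move=> c f g; apply/ffunP=> q; rewrite !ffunE /= scaler_sumr -big_split.
by apply: eq_bigr => p _; rewrite !ffunE.
Qed.

HB.instance Definition _ a j :=
  GRing.isLinear.Build K (path_space (tgt a) j) (path_space (src a) j) _
    (@pre_arrow a j) (@pre_arrow_is_linear a j).

(* The left ideal of KQ spanned by the paths starting at i; KQ is the direct sum
   of these. *)
Definition proj_at (i : vert Q) : qrep K Q :=
  @QRep K Q (path_space i) (fun a => linfun (@post_arrow i a)).

Lemma pre_post_arrow (a b : arr Q) (f : path_space (tgt a) (src b)) :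
  post_arrow (pre_arrow f) = pre_arrow (post_arrow f).
Proof.
apply/ffunP=> q; rewrite !ffunE.
under eq_bigr do rewrite ffunE.
under [RHS]eq_bigr do rewrite ffunE.
rewrite (exchange_big_dep xpredT) //=.
rewrite [RHS](exchange_big_dep xpredT) //=.
apply: eq_bigr => r _; have rP := valP r.
case: (eqVneq (a :: rcons (val r) b) (val q)) => [eq_q | neq_q]; last first.
  by rewrite !big_pred0 // => p; apply/negP => /andP [/eqP /= e1 /eqP /= e2];
    case/eqP: neq_q; rewrite /= -e1 -e2.
have sz_q := size_bseq (val q); rewrite -eq_q /= size_rcons in sz_q.
have sz1 : (size (a :: val r) <= #|arr Q|)%N by apply: leq_trans sz_q => /=.
have sz2 : (size (rcons (val r) b) <= #|arr Q|)%N.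
  by rewrite size_rcons; apply: leq_trans sz_q.
have p1P : is_path (src a) (src b) (Bseq sz1) by rewrite /= eqxx.
have p2P : is_path (tgt a) (tgt b) (Bseq sz2) by apply: is_path_rcons.
rewrite (big_pred1 (exist _ (Bseq sz1) p1P : qpath _ _)); last first.
  move=> p; rewrite /= -val_eqE -[in RHS]val_eqE /= -eq_q -rcons_cons.
  by rewrite [a :: _ == _]eq_sym eqseq_rcons eqxx andbT /= andbb.
rewrite (big_pred1 (exist _ (Bseq sz2) p2P : qpath _ _)) // => p.
rewrite /= -val_eqE -[in RHS]val_eqE /= -eq_q.
by rewrite eqseq_cons eqxx /= [rcons _ _ == _]eq_sym andbb.
Qed.

Lemma proj_map_subproof (a b : arr Q) :
  (qmap (proj_at (src a)) b \o linfun (@pre_arrow a (src b)))%VF =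
  (linfun (@pre_arrow a (tgt b)) \o qmap (proj_at (tgt a)) b)%VF.
Proof.
by apply/lfunP=> f; rewrite !comp_lfunE !lfunE /= pre_post_arrow.
Qed.

Definition proj_map (a : arr Q) : qhom (proj_at (tgt a)) (proj_at (src a)) :=
  @QHom K Q (proj_at (tgt a)) (proj_at (src a))
    (fun j => linfun (@pre_arrow a j)) (proj_map_subproof a).

End PathAlgebra.

Section Transpose.
Variables (K : fieldType) (Q : quiver).

(* D = Hom_K(-, K), from left KQ-modules to right KQ-modules, the latter being
   the representations of the opposite quiver. *)
Definition dual_map (V W : vectType K) (f : 'Hom(V, W)) (g : 'Hom(W, K^o)) :
  'Hom(V, K^o) := (g \o f)%VF.

Lemma dual_map_is_linear (V W : vectType K) (f : 'Hom(V, W)) : linear (dual_map f).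
Proof. by move=> c g h; rewrite /dual_map comp_lfunDl comp_lfunZl. Qed.

HB.instance Definition _ (V W : vectType K) (f : 'Hom(V, W)) :=
  GRing.isLinear.Build K 'Hom(W, K^o) 'Hom(V, K^o) _ (dual_map f)
    (dual_map_is_linear f).

Definition dual_rep (X : qrep K Q) : qrep K (opq Q) :=
  @QRep K (opq Q) (fun i => 'Hom(X i, K^o) : vectType K)
    (fun a : arr (opq Q) => linfun (dual_map (qmap X a))).

(* Y = Tr N, the cokernel of Hom(d1, KQ) : Hom(P0, KQ) -> Hom(P1, KQ) for a
   minimal projective presentation of the right module N. At the vertex i, Hom(P, KQ)
   is Hom(P, P(i)) with P(i) the right ideal spanned by the paths ending at i, and
   an arrow acts through left multiplication on KQ; pr i is the projection
   onto the cokernel. *)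
Definition is_transpose (N : qrep K (opq Q)) (Y : qrep K Q) : Prop :=
  exists (P1 P0 : qrep K (opq Q)) (d1 : qhom P1 P0) (d0 : qhom P0 N),
  minimal_projective_presentation d1 d0 /\
  exists pr : forall i : vert Q, qhom P1 (proj_at K (Q := opq Q) i) -> Y i,
  [/\ (forall i (c : K) (g1 g2 g : qhom P1 (proj_at K (Q := opq Q) i)),
         (forall j, g j = c *: g1 j + g2 j) -> pr i g = c *: pr i g1 + pr i g2),
      (forall i (y : Y i), exists g, pr i g = y),
      (forall i (g : qhom P1 (proj_at K (Q := opq Q) i)),
         pr i g = 0 <->
         exists g0 : qhom P0 (proj_at K (Q := opq Q) i), heq g (hcomp g0 d1)) &
      (forall (a : arr Q) (g : qhom P1 (proj_at K (Q := opq Q) (src a))),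
         qmap Y a (pr (src a) g) =
         pr (tgt a) (hcomp (proj_map K (Q := opq Q) a) g))].

(* Y = tau^{-1} X = Tr D X, determined up to isomorphism. *)
Definition is_tau_inv (X Y : qrep K Q) : Prop := is_transpose (dual_rep X) Y.

Definition determiner_summand (B C : qrep K Q) (f : qhom B C) (Z : qrep K Q) : Prop :=
  indecomposable Z /\
  ((exists L X, [/\ intrinsic_kernel f L, indecomposable X,
                    direct_summand X L & is_tau_inv X Z]) \/
   (projective Z /\ almost_factors Z f)).

Definition is_minimal_right_determiner (B C : qrep K Q) (f : qhom B C)
    (D : qrep K Q) : Prop :=
  exists2 Zs, lists_iso_classes (determiner_summand f) Zs &
              isomorphic D (big_dsum Zs).

Definition Det (D : qrep K Q) : Prop :=
  exists B C (f : qhom B C),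
    [/\ indecomposable B, indecomposable C, irreducible f &
        is_minimal_right_determiner f D].

End Transpose.

(* Main.v *)
(* For a set [I] of vertices let T(I) be the thin representation supported on [I],
   with identity maps. Over a quiver of type A_n every indecomposable representation
   is T(I) for an interval [I], because it has a direct summand of this form.
   Morphisms between such representations are multiples of the canonical one, and
   the order in which an end of the interval can be moved is total and independent
   of the other end; hence an irreducible morphism moves one end to an adjacent
   position. It follows that there is an arrow a : x -> y such that the morphism is
   either an epimorphism with kernel T(X a) or a monomorphism with cokernel T(Z a),
   where T(Z a) = P(x)/P(y) and T(X a) is the kernel of I(y) -> I(x).
   The resolution of D T(X a) by the right modules P(x) -> P(y) gives
   tau^{-1} T(X a) = T(Z a), the determiner of the epimorphism; the determiner of the
   monomorphism is P(c), where c is the socle of T(Z a). The inclusion P(y) -> P(x)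
   and the projection I(y) -> I(x) are irreducible, so Det consists of the n - 1
   modules T(Z a) and of the P(c) with c the socle of some T(Z a), that is, with c
   neither a source distinct from 1 and n nor a vertex towards which all arrows
   point. *)

From HB Require Import structures.
Require Import Defs.
From mathcomp Require Import all_boot all_algebra zify.

Set Implicit Arguments.
Unset Strict Implicit.
Unset Printing Implicit Defensive.

Import GRing.Theory.
Local Open Scope ring_scope.

(** * Linear algebra and representations *)

(** The numbers arise as follows. Different arrows give different supports of [T(Z a)], and none of
    these is the support of a [P(c)], so the count is n - 1 plus the number of admissible [c]. A
    vertex towards which all arrows point exists exactly when p = 0, and is then unique. Hence n - 1
    vertices are admissible for p = 0 and n - p otherwise. Two difficulties shape the development.
    The inverse translate is a relation that allows any minimal projective presentation, so
    computing one instance says nothing yet about the others; an isomorphism has to be lifted to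
    presentations before the determiner of an epimorphism is known. And projectives, injectives and
    right modules all call for the same tree arguments, over a quiver or over its opposite. These
    are therefore proved for abstract families [R] and [R'] of reachable sets that are trees; the
    shape of the line enters only when such families are produced and when intervals are
    compared. *)

Section LinearAlgebra.
Variable K : fieldType.
Implicit Types U V W : vectType K.

Lemma linear_lfun U V (f : U -> V) :
  linear f -> {g : 'Hom(U, V) | forall x, g x = f x}.
Proof.
move=> fL; pose F : {linear U -> V} := HB.pack f (GRing.isLinear.Build K U V *:%R f fL).
by exists (linfun F) => x; rewrite lfunE.
Qed.

Definition outer_fun U V (phi : 'Hom(U, K^o)) (w : V) (x : U) : V := (phi x : K) *: w.

Fact outer_is_linear U V (phi : 'Hom(U, K^o)) (w : V) : linear (outer_fun phi w).
Proof. by move=> c x y; rewrite /outer_fun linearP scalerDl scalerA. Qed.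

HB.instance Definition _ U V (phi : 'Hom(U, K^o)) (w : V) :=
  GRing.isLinear.Build K U V _ (outer_fun phi w) (outer_is_linear phi w).

Definition outer U V (phi : 'Hom(U, K^o)) (w : V) : 'Hom(U, V) :=
  linfun (outer_fun phi w).

Lemma outerE U V (phi : 'Hom(U, K^o)) (w : V) x : outer phi w x = (phi x : K) *: w.
Proof. by rewrite lfunE. Qed.

(** The map [\1 - projv U] vanishes on [U] but not at [v]; a coordinate that is nonzero at its value
    there, rescaled, is the functional. *)
Lemma separation V (U : {vspace V}) (v : V) : v \notin U ->
  exists phi : 'Hom(V, K^o), phi v = 1 /\ (forall u, u \in U -> phi u = 0).
Proof.
move=> vNU; pose g := (\1 - projv U)%VF.
have gE x : g x = x - projv U x by rewrite !lfun_simp.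
have gv : g v != 0.
  apply: contra vNU; rewrite gE subr_eq0 => /eqP ->; exact: memv_proj.
have [k gvk] : exists k, coord (vbasis fullv) k (g v) != 0.
  apply/existsP; rewrite -negb_forall; apply: contra gv => /forallP g0.
  rewrite (coord_vbasis (memvf (g v))) big1 // => k _.
  by rewrite (eqP (g0 k)) scale0r.
have fL : linear (fun x => coord (vbasis fullv) k (g x) / coord (vbasis fullv) k (g v) : K^o).
  by move=> c x y; rewrite !linearP /= mulrDl -mulrA.
have [phi phiE] := linear_lfun fL; exists phi; split=> [|u uU].
  by rewrite phiE divff.
by rewrite phiE gE projv_id // subrr linear0 mul0r.
Qed.

(* The hyperplane [ker phi'] is carried off [q v'], so the functional can be
   prescribed on [q v'] and on [q (ker phi') + B] independently. *)
Lemma extend_functional V W (q : 'Hom(V, W)) (B : {vspace W})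
    (phi' : 'Hom(V, K^o)) (v' : V) :
  phi' v' = 1 -> (forall x, q x \in B -> phi' x = 0) ->
  exists phi : 'Hom(W, K^o),
    (forall x, phi (q x) = phi' x) /\ (forall b, b \in B -> phi b = 0).
Proof.
move=> phi1 phiB.
have : q v' \notin (q @: lker phi' + B)%VS.
  apply/negP=> /memv_addP[_ /memv_imgP[h hk ->] [b bB e]].
  have /phiB : q (v' - h) \in B by rewrite linearB /= e addrAC subrr add0r.
  rewrite linearB /= phi1; move: hk; rewrite memv_ker => /eqP ->.
  by move/eqP; rewrite subr0 oner_eq0.
move=> /separation[phi [phiv phi0]]; exists phi; split=> [x|b bB]; last first.
  by apply: phi0; rewrite -[b]add0r memv_add ?mem0v.
have /phi0 : q (x - (phi' x : K) *: v') \in (q @: lker phi' + B)%VS.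
  rewrite -[q _]addr0 memv_add ?mem0v // memv_img // memv_ker.
  by rewrite linearB linearZ /= phi1 [_ *: _]mulr1 subrr.
have -> : phi (q (x - (phi' x : K) *: v')) = phi (q x) - (phi' x : K) *: (phi (q v') : K^o).
  by rewrite !(linearB, linearZ).
by rewrite phiv [_ *: _]mulr1 => /eqP; rewrite subr_eq0 => /eqP.
Qed.

Lemma limg_fullP U V (f : 'Hom(U, V)) :
  limg f = fullv -> forall y, exists x, f x = y.
Proof.
move=> ff y; have : y \in limg f by rewrite ff memvf.
by case/memv_imgP=> x _ ->; exists x.
Qed.

Lemma limg_fullI U V (f : 'Hom(U, V)) :
  (forall y, exists x, f x = y) -> limg f = fullv.
Proof.
move=> fS; apply/eqP; rewrite eqEsubv subvf /=; apply/subvP=> y _.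
by have [x <-] := fS y; rewrite memv_img ?memvf.
Qed.

Lemma lker0_inj U V (f : 'Hom(U, V)) : lker f = 0%VS -> injective f.
Proof. by move=> /eqP/lker0P. Qed.

Lemma inj_lker0 U V (f : 'Hom(U, V)) : (forall x, f x = 0 -> x = 0) -> lker f = 0%VS.
Proof.
move=> f0; apply/eqP; rewrite -subv0; apply/subvP=> x.
by rewrite memv_ker => /eqP/f0 ->; rewrite mem0v.
Qed.

Lemma limg_mem U V (f : 'Hom(U, V)) x : f x \in limg f.
Proof. by rewrite memv_img ?memvf. Qed.

Lemma surj_dim U V (f : 'Hom(U, V)) : limg f = fullv ->
  (\dim (fullv : {vspace V}) <= \dim (fullv : {vspace U}))%N.
Proof. by move=> <-; rewrite -(limg_ker_dim f fullv) leq_addl. Qed.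

Lemma surj_eqdim_inj U V (f : 'Hom(U, V)) : limg f = fullv ->
  (\dim (fullv : {vspace U}) <= \dim (fullv : {vspace V}))%N -> lker f = 0%VS.
Proof.
move=> ff; rewrite -(limg_ker_dim f fullv) ff capfv -[X in (_ <= X)%N]add0n leq_add2r.
by rewrite leqn0 dimv_eq0 => /eqP.
Qed.

End LinearAlgebra.

Section Reps.
Variables (K : fieldType) (Q : quiver).
Implicit Types (M N X Y Z P : qrep K Q).

Definition mkhom M N (f : forall i, 'Hom(M i, N i))
    (H : forall a x, qmap N a (f (src a) x) = f (tgt a) (qmap M a x)) : qhom M N.
Proof.
by exists f => a; apply/lfunP=> x; rewrite !comp_lfunE H.
Defined.

Lemma qhom_nat M N (f : qhom M N) a x :
  qmap N a (f (src a) x) = f (tgt a) (qmap M a x).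
Proof. by have /lfunP/(_ x) := hmapP f a; rewrite !comp_lfunE. Qed.

Lemma hcompE M N X (g : qhom N X) (f : qhom M N) i x : hcomp g f i x = g i (f i x).
Proof. by rewrite /hcomp /= comp_lfunE. Qed.

Lemma hidE M i x : hid M i x = x.
Proof. by rewrite /hid /= id_lfunE. Qed.

Lemma heqP M N (f g : qhom M N) : heq f g <-> forall i x, f i x = g i x.
Proof. by split=> [e i x|e i]; [rewrite e | apply/lfunP]. Qed.

Definition hzero M N : qhom M N.
Proof. by apply: (@mkhom M N (fun=> 0)) => a x; rewrite !lfunE /= linear0. Defined.

Lemma hzeroE M N i x : hzero M N i x = 0.
Proof. by rewrite lfunE. Qed.

(** One operation serves for differences, as [hlin (-1)], and for scalar multiples, with [hzero] as
    second summand. *)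
Definition hlin M N (c : K) (f g : qhom M N) : qhom M N.
Proof.
apply: (@mkhom M N (fun i => c *: f i + g i)) => a x.
by rewrite !lfun_simp linearP /= !qhom_nat.
Defined.

Lemma hlinE M N c (f g : qhom M N) i x : hlin c f g i x = c *: f i x + g i x.
Proof. by rewrite /= !lfun_simp. Qed.

Lemma bij_is_iso M N (f : qhom M N) : qinj f -> qsurj f -> is_iso f.
Proof.
move=> fI fS.
have K1 i : cancel (f i) (f i)^-1%VF by apply: lker0_lfunK; rewrite fI.
have K2 i : cancel (f i)^-1%VF (f i) by move=> y; rewrite limg_lfunVK // fS memvf.
unshelve eexists (@mkhom N M (fun i => (f i)^-1%VF) _).
  by move=> a x; apply: (can_inj (K1 _)); rewrite -qhom_nat !K2.
by split; apply/heqP => i x; rewrite hcompE hidE /= ?K1 ?K2.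
Qed.

Lemma is_iso_bij M N (f : qhom M N) : is_iso f -> qinj f /\ qsurj f.
Proof.
case=> g [/heqP e1 /heqP e2]; split=> i.
  by apply: inj_lker0 => x f0; have := e1 i x; rewrite hcompE hidE f0 linear0.
by apply: limg_fullI => y; exists (g i y); have := e2 i y; rewrite hcompE hidE.
Qed.

Lemma qinjP M N (f : qhom M N) : qinj f -> forall i, injective (f i).
Proof. by move=> fI i; apply: lker0_inj. Qed.

Lemma qsurjP M N (f : qhom M N) : qsurj f -> forall i y, exists x, f i x = y.
Proof. by move=> fS i; apply: limg_fullP. Qed.

Lemma hid_iso M : is_iso (hid M).
Proof. by exists (hid M); split; apply/heqP=> i x; rewrite hcompE !hidE. Qed.

Lemma isomorphic_refl M : isomorphic M M.
Proof. by exists (hid M); apply: hid_iso. Qed.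

Lemma isomorphic_sym M N : isomorphic M N -> isomorphic N M.
Proof. by case=> f [g [e1 e2]]; exists g, f. Qed.

Lemma is_iso_comp M N X (g : qhom N X) (f : qhom M N) :
  is_iso g -> is_iso f -> is_iso (hcomp g f).
Proof.
move=> /is_iso_bij[gI gS] /is_iso_bij[fI fS]; apply: bij_is_iso => i.
  apply: inj_lker0 => x; rewrite hcompE => e; apply: (qinjP fI).
  by apply: (qinjP gI); rewrite e !linear0.
apply: limg_fullI => y; have [z <-] := qsurjP gS y.
by have [x <-] := qsurjP fS z; exists x; rewrite hcompE.
Qed.

Lemma isomorphic_trans M N X : isomorphic M N -> isomorphic N X -> isomorphic M X.
Proof. by case=> f fi [g gi]; exists (hcomp g f); apply: is_iso_comp. Qed.

Lemma is_zeroP M : is_zero M <-> forall i (x : M i), x = 0.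
Proof.
split=> [M0 i x|M0 i].
  by apply/eqP; rewrite -memv0 -M0 memvf.
by apply/eqP; rewrite -subv0; apply/subvP=> x _; rewrite (M0 i x) mem0v.
Qed.

Lemma is_zero_inj M N (f : qhom M N) : qinj f -> is_zero N -> is_zero M.
Proof.
move=> fI /is_zeroP N0; apply/is_zeroP=> i x; apply: (qinjP fI).
by rewrite (N0 _ (f i x)) linear0.
Qed.

Lemma is_zero_iso M N : isomorphic M N -> is_zero N -> is_zero M.
Proof. by case=> f /is_iso_bij[fI _]; apply: is_zero_inj fI. Qed.

Lemma indecomposable_iso M N : isomorphic M N -> indecomposable M -> indecomposable N.
Proof.
move=> MN [M0 MI]; split=> [N0|X Y NXY]; first exact/M0/(is_zero_iso MN).
exact/MI/(isomorphic_trans MN).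
Qed.

Lemma lift_mono M B C (f : qhom B C) (g : qhom M C) : qinj f ->
  (forall i, (limg (g i) <= limg (f i))%VS) -> exists u, heq (hcomp f u) g.
Proof.
move=> fI gf.
have fK i x : f i ((f i)^-1%VF (g i x)) = g i x.
  by rewrite limg_lfunVK //; apply: (subvP (gf i)); apply: limg_mem.
unshelve eexists (@mkhom M B (fun i => ((f i)^-1 \o g i)%VF) _).
  move=> a x; apply: (qinjP fI).
  by rewrite -qhom_nat !comp_lfunE !fK qhom_nat.
by apply/heqP=> i x; rewrite hcompE /= comp_lfunE fK.
Qed.

Lemma kernel_unique L L' M (k : qhom L M) (k' : qhom L' M) : qinj k -> qinj k' ->
  (forall i, limg (k i) = limg (k' i)) -> isomorphic L L'.
Proof.
move=> kI k'I kk'.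
have [u /heqP uE] : exists u, heq (hcomp k' u) k by apply: lift_mono => // i; rewrite kk'.
exists u; apply: bij_is_iso => i.
  apply: inj_lker0 => x ux; apply: (qinjP kI).
  by have := uE i x; rewrite hcompE ux linear0 linear0.
apply: limg_fullI => y; have : k' i y \in limg (k i) by rewrite kk' limg_mem.
case/memv_imgP=> x _ e; exists x; apply: (qinjP k'I).
by have := uE i x; rewrite hcompE => ->.
Qed.

Section SubRep.
Variables (M : qrep K Q) (U : forall i, {vspace M i}) (HU : subrep U).

Definition sub_rep : qrep K Q :=
  @QRep K Q (fun i => subvs_of (U i))
    (fun a => (linfun (vsproj (U (tgt a))) \o (qmap M a \o linfun (@vsval _ _ (U (src a)))))%VF).

Lemma sub_rep_mapE a x : vsval (qmap sub_rep a x) = qmap M a (vsval x).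
Proof.
rewrite /= !comp_lfunE !lfunE /= vsprojK //.
by apply: (subvP (HU a)); rewrite memv_img ?subvsP.
Qed.

Definition sub_incl : qhom sub_rep M.
Proof.
apply: (@mkhom sub_rep M (fun i => linfun (@vsval _ _ (U i)))) => a x.
have E i y : linfun (@vsval _ _ (U i)) y = vsval y by rewrite lfunE.
rewrite !E; exact/esym/sub_rep_mapE.
Defined.

Lemma sub_inclE i x : sub_incl i x = vsval x.
Proof. by rewrite lfunE. Qed.

Lemma sub_incl_inj : qinj sub_incl.
Proof. by move=> i; apply: inj_lker0 => x; rewrite sub_inclE => e; apply: val_inj. Qed.

Lemma limg_sub_incl i : limg (sub_incl i) = U i.
Proof.
apply/vspaceP=> v; apply/memv_imgP/idP=> [[x _ ->]|vU].
  by rewrite sub_inclE subvsP.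
by exists (vsproj (U i) v); rewrite ?memvf // sub_inclE vsprojK.
Qed.
End SubRep.

Lemma limg_subrep M N (f : qhom M N) : subrep (fun i => limg (f i)).
Proof.
move=> a; apply/subvP=> _ /memv_imgP[_ /memv_imgP[x _ ->] ->].
by rewrite qhom_nat limg_mem.
Qed.

Lemma lker_subrep M N (f : qhom M N) : subrep (fun i => lker (f i)).
Proof.
move=> a; apply/subvP=> _ /memv_imgP[x xk ->].
by move: xk; rewrite !memv_ker -qhom_nat => /eqP ->; rewrite linear0.
Qed.

(** Projectivity is stated for epimorphisms only; corestricting both [g] and [h] to the image of [g]
    turns [g] into one. *)
Lemma projective_lift P M N (g : qhom M N) (h : qhom P N) : projective P ->
  (forall i, (limg (h i) <= limg (g i))%VS) -> exists h', heq (hcomp g h') h.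
Proof.
move=> PP hg; have S := limg_subrep g.
have iI := sub_incl_inj S; have iE := limg_sub_incl S.
have [g' /heqP g'E] : exists g', heq (hcomp (sub_incl S) g') g.
  by apply: lift_mono => // i; rewrite iE.
have [h1 /heqP h1E] : exists h1, heq (hcomp (sub_incl S) h1) h.
  by apply: lift_mono => // i; rewrite iE.
have g'S : qsurj g'.
  move=> i; apply: limg_fullI => y.
  have : sub_incl S i y \in limg (g i) by rewrite -(iE i) limg_mem.
  case/memv_imgP=> x _ e; exists x; apply: (qinjP iI).
  by have := g'E i x; rewrite hcompE => ->.
have [h' /heqP h'E] := PP _ _ g' h1 g'S; exists h'; apply/heqP=> i x.
by rewrite hcompE -g'E hcompE -h1E hcompE -h'E hcompE.
Qed.

Lemma projective_iso M N : isomorphic M N -> projective M -> projective N.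
Proof.
case=> f [f' [_ /heqP ff']] PM A B g h gS.
have [h' /heqP h'E] := PM _ _ g (hcomp h f) gS.
exists (hcomp h' f'); apply/heqP=> i x; have := h'E i (f' i x).
by rewrite !hcompE => ->; have := ff' i x; rewrite hcompE hidE => ->.
Qed.

Lemma dsumE M N a x : qmap (dsum M N) a x = (qmap M a x.1, qmap N a x.2).
Proof. by rewrite /= lfunE. Qed.

Definition dsum_fst M N : qhom (dsum M N) M.
Proof.
apply: (@mkhom (dsum M N) M (fun i => linfun (fst : (M i * N i)%type -> M i))) => a x.
by rewrite dsumE !lfunE.
Defined.

Definition dsum_snd M N : qhom (dsum M N) N.
Proof.
apply: (@mkhom (dsum M N) N (fun i => linfun (snd : (M i * N i)%type -> N i))) => a x.
by rewrite dsumE !lfunE.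
Defined.

Lemma dsum_fstE M N i x : dsum_fst M N i x = x.1.
Proof. by rewrite lfunE. Qed.
Lemma dsum_sndE M N i x : dsum_snd M N i x = x.2.
Proof. by rewrite lfunE. Qed.

Fact pair_is_linear X M N (f : qhom X M) (g : qhom X N) i :
  linear (fun x => (f i x, g i x) : (M i * N i)%type).
Proof. by move=> c x y; rewrite !linearP. Qed.

Definition dsum_pair X M N (f : qhom X M) (g : qhom X N) : qhom X (dsum M N).
Proof.
refine (@mkhom X (dsum M N) (fun i => sval (linear_lfun (@pair_is_linear X M N f g i))) _) => a x.
by rewrite !(svalP (linear_lfun _)) dsumE /= !qhom_nat.
Defined.

Lemma dsum_pairE X M N (f : qhom X M) (g : qhom X N) i x :
  dsum_pair f g i x = (f i x, g i x).
Proof. exact: (svalP (linear_lfun _)). Qed.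

Lemma isomorphic_dsum0 M Z : is_zero Z -> isomorphic M (dsum M Z).
Proof.
move=> /is_zeroP Z0; exists (dsum_pair (hid M) (hzero M Z)).
exists (dsum_fst M Z); split; apply/heqP=> i x;
  rewrite hcompE hidE dsum_pairE ?dsum_fstE hidE //.
by case: x => x y /=; rewrite lfunE (Z0 _ y).
Qed.

Lemma zero_rep_is_zero : is_zero (zero_rep K Q).
Proof. by apply/is_zeroP=> i x; apply/matrixP=> ? []. Qed.

Lemma split_epi_dsum M N (g : qhom M N) (s : qhom N M) : heq (hcomp g s) (hid N) ->
  isomorphic M (dsum N (sub_rep (fun i => lker (g i)))).
Proof.
move=> /heqP gs; have S := lker_subrep g.
have gsE i x : g i (s i x) = x by have := gs i x; rewrite hcompE hidE.
(* The morphism on the right is the identity minus [s g], which takes its values in the kernel of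
   [g]. *)
have [p /heqP pE] : exists p, heq (hcomp (sub_incl S) p) (hlin (-1) (hcomp s g) (hid M)).
  apply: lift_mono (sub_incl_inj S) _ => i; rewrite (limg_sub_incl S).
  apply/subvP=> _ /memv_imgP[x _ ->]; rewrite memv_ker hlinE hcompE hidE.
  by rewrite linearP /= gsE scaleN1r addNr.
exists (dsum_pair g p); apply: bij_is_iso => i.
  apply: inj_lker0 => x; rewrite dsum_pairE => -[gx px]; have := pE i x.
  by rewrite hcompE px linear0 hlinE hcompE hidE gx !linear0 add0r.
apply: limg_fullI => -[y z]; exists (s i y + sub_incl S i z); rewrite dsum_pairE.
have gz : g i (sub_incl S i z) = 0.
  by apply/eqP; rewrite -memv_ker -(limg_sub_incl S) limg_mem.
have e : g i (s i y + sub_incl S i z) = y by rewrite linearD /= gsE gz addr0.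
rewrite e; congr (_, _); apply: (qinjP (sub_incl_inj S)).
have := pE i (s i y + sub_incl S i z).
by rewrite hcompE hlinE hcompE hidE e scaleN1r addKr.
Qed.

Lemma indecomposable_split M N (g : qhom M N) (s : qhom N M) : indecomposable M ->
  ~ is_zero N -> heq (hcomp g s) (hid N) -> isomorphic M N.
Proof.
move=> [_ MI] N0 /split_epi_dsum e; case: (MI _ _ e) => // Z0.
exact/(isomorphic_trans e)/isomorphic_sym/isomorphic_dsum0.
Qed.

Lemma indecomposable_summand X L M : indecomposable M -> isomorphic L M ->
  indecomposable X -> direct_summand X L -> isomorphic X M.
Proof.
move=> [_ MI] LM [X0 _] [Y LXY].
have MXY := isomorphic_trans (isomorphic_sym LM) LXY.
case: (MI _ _ MXY) => // Y0.
exact/isomorphic_sym/(isomorphic_trans MXY)/isomorphic_sym/isomorphic_dsum0.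
Qed.

Lemma split_mono_inj M N (f : qhom M N) : split_mono f -> qinj f.
Proof.
case=> g /heqP e i; apply: inj_lker0 => x fx.
by have := e i x; rewrite hcompE hidE fx linear0.
Qed.

Lemma split_epi_surj M N (f : qhom M N) : split_epi f -> qsurj f.
Proof.
case=> g /heqP e i; apply: limg_fullI => y; exists (g i y).
by have := e i y; rewrite hcompE hidE.
Qed.

End Reps.

Arguments qhom_nat {K Q M N} f a x.

(** * Thin representations *)

Section Sets.
Variable Q : quiver.
Implicit Types I J L : {set vert Q}.

Definition closed_set I := forall a : arr Q, src a \in I -> tgt a \in I.

(** No set [A] separates [I] unless some arrow inside [I] crosses its boundary. The empty set counts
    as connected, which matters for intersections of supports. *)
Definition connected I := forall A : {set vert Q},
  (forall a : arr Q, src a \in I -> tgt a \in I -> (src a \in A) = (tgt a \in A)) ->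
  {in I &, forall i j, (i \in A) = (j \in A)}.

(* The condition for the identity on [I :&: J] to define a morphism from the
   thin representation on I to the one on J. *)
Definition compat I J := forall a : arr Q,
  src a \in I -> tgt a \in J -> (src a \in J) = (tgt a \in I).

(* [I] is the vertex set of a full subquiver which is a tree with all arrows
   pointing away from the root [c]. *)
Inductive rooted (c : vert Q) : {set vert Q} -> Prop :=
| Rooted1 : (forall a : arr Q, src a = c -> tgt a <> c) -> rooted c [set c]
| RootedU I (a : arr Q) : rooted c I -> src a \in I -> tgt a \notin I ->
    (forall b : arr Q, src b \in I -> tgt b = tgt a -> b = a) ->
    (forall b : arr Q, src b = tgt a -> tgt b <> tgt a) ->
    (forall b : arr Q, src b = tgt a -> tgt b \notin I) ->
    rooted c (tgt a |: I).

Lemma rooted_root c I : rooted c I -> c \in I.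
Proof. by elim=> [_|J a _ cJ _ _ _ _ _]; rewrite !inE ?eqxx // cJ orbT. Qed.

Lemma rooted_into_root c I (a : arr Q) : rooted c I -> src a \in I -> tgt a <> c.
Proof.
move=> cI; elim: cI a => [H a|J b cJ IH sb tb u l nb a]; first by rewrite inE => /eqP/H.
rewrite !inE => /orP[/eqP sa ta|/IH //].
by have := nb _ sa; rewrite ta (rooted_root cJ).
Qed.

Lemma rooted_uniq c I (a b : arr Q) : rooted c I ->
  src a \in I -> src b \in I -> tgt a \in I -> tgt a = tgt b -> a = b.
Proof.
move=> cI; elim: cI a b => [H a b|J d cJ IH sd td u l nb a b].
  by rewrite !inE => /eqP/H ta _ /eqP.
have inJ e : src e \in tgt d |: J -> tgt e = tgt d -> src e \in J.
  by rewrite !inE => /orP[/eqP /l|].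
have inJ2 e : src e \in tgt d |: J -> tgt e \in J -> src e \in J.
  by rewrite !inE => /orP[/eqP /nb/negbTE ->|].
move=> sa sb; have [ta _ tab|ta] := eqVneq (tgt a) (tgt d).
  by rewrite (u a) ?inJ // (u b) ?inJ // -tab.
rewrite !inE (negPf ta) /= => taJ tab.
by apply: IH; rewrite ?inJ2 // -tab.
Qed.

Lemma rooted_ind_set c I (U : {set vert Q}) : rooted c I -> c \in U ->
  (forall a : arr Q, src a \in I -> tgt a \in I -> src a \in U -> tgt a \in U) ->
  I \subset U.
Proof.
move=> cI cU; elim: cI => [_ _|J a cJ IH sa ta _ _ _ HU].
  by rewrite sub1set.
have JU : J \subset U.
  by apply: IH => b sb tb; apply: HU; rewrite !inE ?sb ?tb orbT.
rewrite subUset sub1set JU andbT; apply: HU; last exact: (subsetP JU).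
  by rewrite !inE sa orbT.
by rewrite !inE eqxx.
Qed.

Lemma rooted_connected c I : rooted c I -> connected I.
Proof.
move=> cI A HA; have E i : i \in I -> (i \in A) = (c \in A).
  pose U := [set i | (i \in A) == (c \in A)].
  suff /subsetP H : I \subset U by move=> /H; rewrite inE => /eqP.
  apply: (rooted_ind_set cI); rewrite ?inE // => a sa ta.
  by rewrite !inE HA.
by move=> i j iI jI; rewrite !E.
Qed.

Lemma connectedP (T : eqType) I (f : vert Q -> T) : connected I ->
  (forall a : arr Q, src a \in I -> tgt a \in I -> f (src a) = f (tgt a)) ->
  {in I &, forall i j, f i = f j}.
Proof.
move=> cI H i j iI jI.
have /(cI [set k | f k == f i])/(_ i j iI jI) : forall a : arr Q, src a \in I ->
    tgt a \in I -> (src a \in [set k | f k == f i]) = (tgt a \in [set k | f k == f i]).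
  by move=> a sa ta; rewrite !inE H.
by rewrite !inE eqxx => /esym/eqP.
Qed.

End Sets.

Section Thin.
Variables (K : fieldType) (Q : quiver).
Implicit Types (I J L : {set vert Q}) (M N : qrep K Q).

(** The Boolean is read as the dimension, 0 or 1. *)
Definition tsp I i : vectType K := 'rV[K]_(i \in I).

Definition te I i : tsp I i := const_mx 1.

(** The coordinate with respect to [te]: the sum has one term on [I] and none off [I]. *)
Definition tv_fun I i (x : tsp I i) : K^o := \sum_j x 0 j.

Fact tv_is_linear I i : linear (@tv_fun I i).
Proof.
move=> c x y; rewrite /tv_fun scaler_sumr -big_split.
by apply: eq_bigr => j _; rewrite !mxE.
Qed.

HB.instance Definition _ I i :=
  GRing.isLinear.Build K (tsp I i) K^o _ (@tv_fun I i) (@tv_is_linear I i).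

Definition tv I i : 'Hom(tsp I i, K^o) := linfun (@tv_fun I i).

Lemma tv_te I i : tv I i (te I i) = (i \in I)%:R.
Proof.
rewrite lfunE /= /tv_fun (eq_bigr (fun=> 1)) => [|j _]; last by rewrite mxE.
by rewrite sumr_const card_ord.
Qed.

Lemma thin_eta I i (x : tsp I i) : x = (tv I i x : K) *: te I i.
Proof.
rewrite lfunE /= /tv_fun /te; move: x; rewrite /tsp; case: (i \in I) => x.
  by apply/rowP=> j; rewrite !mxE mulr1 big_ord1 (ord1 j).
by apply/rowP=> -[].
Qed.

Lemma thin_out I i (x : tsp I i) : i \notin I -> x = 0.
Proof.
by move=> /negbTE iI; apply/rowP=> -[j jI]; exfalso; move: jI; rewrite iI.
Qed.

Lemma te_eq0 I i : (te I i == 0) = (i \notin I).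
Proof.
apply/eqP/idP=> [e|iI]; last exact: thin_out.
apply/negP=> iI; have := tv_te I i; rewrite e linear0 iI => /esym/eqP.
by rewrite oner_eq0.
Qed.

(** Off [I] both [tv] and [te] vanish, so this one formula gives the identity along arrows inside
    [I] and zero along all others. *)
Definition thin I : qrep K Q :=
  @QRep K Q (tsp I) (fun a => outer (tv I (src a)) (te I (tgt a))).

Lemma thin_mapE I a x : qmap (thin I) a x = (tv I (src a) x : K) *: te I (tgt a).
Proof. exact: outerE. Qed.

Lemma thin_map_te I a : src a \in I -> qmap (thin I) a (te I (src a)) = te I (tgt a).
Proof. by move=> sa; rewrite thin_mapE tv_te sa scale1r. Qed.

Lemma thin_zeroE I i : i \in I -> ~ is_zero (thin I).
Proof. by move=> iI /is_zeroP/(_ i (te I i))/eqP; rewrite te_eq0 iI. Qed.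

Section FromThin.
Variables (I : {set vert Q}) (M : qrep K Q) (v : forall i, M i).
Hypothesis H : forall a, src a \in I ->
  qmap M a (v (src a)) = if tgt a \in I then v (tgt a) else 0.

Definition thin_hom : qhom (thin I) M.
Proof.
refine (@mkhom _ _ (thin I) M (fun i => outer (tv I i) (v i)) _) => a x.
rewrite !outerE linearZ /=.
have [sa|sa] := orP (orbN (src a \in I)); last first.
  by rewrite (thin_out x sa) !linear0 !scale0r linear0 scale0r.
rewrite H // linearZ /= tv_te.
by case: ifP => _; rewrite [_ *: _%:R]mulr_natr ?mulr1n ?mulr0n ?scaler0 ?scale0r.
Defined.

Lemma thin_homE i : i \in I -> thin_hom i (te I i) = v i.
Proof. by move=> iI; rewrite /= outerE tv_te iI scale1r. Qed.
End FromThin.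

Section ToThin.
Variables (I : {set vert Q}) (M : qrep K Q) (phi : forall i, 'Hom(M i, K^o)).
Hypothesis H : forall a, tgt a \in I -> forall x,
  phi (tgt a) (qmap M a x) = if src a \in I then phi (src a) x else 0.

Definition hom_thin : qhom M (thin I).
Proof.
refine (@mkhom _ _ M (thin I) (fun i => outer (phi i) (te I i)) _) => a x.
rewrite !outerE linearZ /= tv_te [_ *: _%:R]mulr_natr.
have [ta|ta] := orP (orbN (tgt a \in I)); last by rewrite [te I (tgt a)]thin_out // !scaler0.
by rewrite H //; case: ifP => _; rewrite ?mulr1n ?mulr0n.
Defined.

Lemma hom_thinE i x : hom_thin i x = (phi i x : K) *: te I i.
Proof. exact: outerE. Qed.
End ToThin.

Lemma thin_homP I M (h : qhom (thin I) M) i x : h i x = (tv I i x : K) *: h i (te I i).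
Proof. by rewrite {1}(thin_eta x) linearZ. Qed.

Lemma thin_heq I M (g h : qhom (thin I) M) :
  (forall i, i \in I -> g i (te I i) = h i (te I i)) -> heq g h.
Proof.
move=> gh; apply/heqP=> i x; rewrite [g i x]thin_homP [h i x]thin_homP.
have [iI|iI] := orP (orbN (i \in I)); first by rewrite gh.
by rewrite (thin_out x iI) linear0 !scale0r.
Qed.

Fact canon_subproof I J : compat I J -> forall a, src a \in I ->
  qmap (thin J) a (te J (src a)) = if tgt a \in I then te J (tgt a) else 0.
Proof.
move=> IJ a sa; rewrite thin_mapE tv_te.
have [ta|ta] := orP (orbN (tgt a \in J)); first by rewrite IJ //; case: ifP; rewrite ?scale1r ?scale0r.
by rewrite [te J (tgt a)]thin_out // scaler0 if_same.
Qed.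

Definition canon I J (IJ : compat I J) : qhom (thin I) (thin J) := thin_hom (canon_subproof IJ).

Lemma canonE I J (IJ : compat I J) i : i \in I -> canon IJ i (te I i) = te J i.
Proof. exact: thin_homE. Qed.

Lemma canon_inj I J (IJ : compat I J) : I \subset J -> qinj (canon IJ).
Proof.
move=> /subsetP sIJ i; apply: inj_lker0 => x.
have [iI|iI _] := orP (orbN (i \in I)); last exact: thin_out.
rewrite thin_homP canonE // => /eqP; rewrite scaler_eq0 te_eq0 sIJ // orbF => /eqP e.
by rewrite (thin_eta x) e scale0r.
Qed.

Lemma canon_surj I J (IJ : compat I J) : J \subset I -> qsurj (canon IJ).
Proof.
move=> /subsetP sJI i; apply: limg_fullI => y.
have [iJ|iJ] := orP (orbN (i \in J)); last by exists 0; rewrite linear0 [RHS]thin_out.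
by exists ((tv J i y : K) *: te I i); rewrite linearZ /= canonE ?sJI // -thin_eta.
Qed.

(** Naturality at an arrow inside [I :&: J] makes the scalars at its two ends agree; connectedness
    spreads this over the intersection, and off [J] the target is zero. *)
Lemma thin_hom_scalar I J (h : qhom (thin I) (thin J)) : connected (I :&: J) ->
  exists c : K, forall i, i \in I -> h i (te I i) = c *: te J i.
Proof.
move=> cIJ; pose f i : K := tv J i (h i (te I i)).
have hE i : h i (te I i) = f i *: te J i by apply: thin_eta.
have [IJ0|[i0 i0IJ]] := set_0Vmem (I :&: J).
  exists 0 => i iI; have iJ : i \notin J by apply/negP=> iJ; have := in_set0 i; rewrite -IJ0 inE iI iJ.
  by rewrite [LHS]thin_out // [RHS]thin_out.
exists (f i0) => i iI; rewrite hE.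
have [iJ|iJ] := orP (orbN (i \in J)); last by rewrite [te J i]thin_out // !scaler0.
have iIJ : i \in I :&: J by rewrite inE iI.
congr (_ *: _); apply: (connectedP cIJ) iIJ i0IJ => a.
rewrite !inE => /andP[sI sJ] /andP[tI tJ].
have := qhom_nat h a (te I (src a)); rewrite (thin_map_te sI) !hE linearZ /= thin_map_te //.
move=> /eqP; rewrite -subr_eq0 -scalerBl scaler_eq0 te_eq0 tJ orbF subr_eq0.
by move/eqP.
Qed.

(** At an arrow from [I] to [J] the two sides of the naturality square are [c] times the two
    membership bits, and [c] is invertible. *)
Lemma thin_hom_compat I J (h : qhom (thin I) (thin J)) : connected (I :&: J) ->
  (exists i, i \in I /\ h i (te I i) <> 0) ->
  compat I J /\ exists2 c : K, c != 0 & forall i, i \in I -> h i (te I i) = c *: te J i.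
Proof.
move=> cIJ [i0 [i0I h0]]; have [c hE] := thin_hom_scalar h cIJ.
have c0 : c != 0 by apply/eqP=> c0; apply: h0; rewrite hE // c0 scale0r.
split; last by exists c.
move=> a sI tJ; have := qhom_nat h a (te I (src a)).
rewrite hE // thin_map_te // linearZ /= thin_mapE tv_te.
have -> : h (tgt a) (te I (tgt a)) = (c * (tgt a \in I)%:R) *: te J (tgt a).
  have [tI|tI] := orP (orbN (tgt a \in I)); first by rewrite hE // tI mulr1.
  by rewrite [te I _]thin_out // linear0 (negPf tI) mulr0 scale0r.
rewrite scalerA => /eqP; rewrite -subr_eq0 -scalerBl scaler_eq0 te_eq0 tJ orbF -mulrBr.
rewrite mulf_eq0 (negPf c0) subr_eq0.
by case: (src a \in J); case: (tgt a \in I) => //; rewrite ?(eq_sym 0) oner_eq0.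
Qed.

Lemma thin_end_scalar I (h : qhom (thin I) (thin I)) : connected I ->
  exists c : K, forall i x, h i x = c *: x.
Proof.
move=> cI; have [|c hE] := @thin_hom_scalar I I h; first by rewrite setIid.
exists c => i x; rewrite thin_homP [in RHS](thin_eta x).
have [iI|iI] := orP (orbN (i \in I)); first by rewrite hE // scalerA mulrC -scalerA.
by rewrite (thin_out x iI) linear0 !scale0r scaler0.
Qed.

(** The projection onto [X] is an endomorphism, hence a scalar [c]: if [c] is zero then [X]
    vanishes, and otherwise [Y] does. *)
Lemma thin_indecomposable I i : connected I -> i \in I -> indecomposable (thin I).
Proof.
move=> cI iI; split; first exact: thin_zeroE iI.
move=> X Y [f [g [/heqP gf /heqP fg]]].
have fgE j x : f j (g j x) = x by have := fg j x; rewrite hcompE hidE.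
have gfE j x : g j (f j x) = x by have := gf j x; rewrite hcompE hidE.
have pE : exists h : qhom (thin I) (thin I), forall j x, h j x = g j ((f j x).1, 0).
  exists (hcomp g (hcomp (dsum_pair (hid X) (hzero X Y)) (hcomp (dsum_fst X Y) f))) => j x.
  by rewrite !hcompE dsum_fstE dsum_pairE hidE lfunE.
have {pE} [h hE] := pE; have [c hc] := thin_end_scalar h cI.
have hg j x y : h j (g j (x, y)) = g j (x, 0) by rewrite hE fgE.
have [c0|c0] := eqVneq c 0; [left|right]; apply/is_zeroP=> j x.
  have := hg j x 0; rewrite hc c0 scale0r => /esym e.
  by have := fgE j (x, 0); rewrite e linear0 => -[].
have := hg j 0 x; rewrite hc => e.
have : f j (g j (0, x)) = 0.
  have : c *: g j (0, x) = 0 by rewrite e; exact: linear0.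
  by move/eqP; rewrite scaler_eq0 (negPf c0) /= => /eqP ->; rewrite linear0.
by rewrite fgE => -[].
Qed.

Lemma thin_iso_inj I J : isomorphic (thin I) (thin J) -> I = J.
Proof.
case=> f /is_iso_bij[fI fS]; apply/setP=> i; apply/idP/idP=> iI; apply/negPn/negP=> iJ.
  have : te I i = 0 by apply: (qinjP fI); rewrite [LHS]thin_out // [RHS]thin_out.
  by move/eqP; rewrite te_eq0 iI.
have [x e] := qsurjP fS (te J i); have := te_eq0 J i.
by rewrite -e (thin_out x iJ) linear0 eqxx iI.
Qed.

Section Rooted.
Variables (c : vert Q) (I : {set vert Q}) (cI : rooted c I) (clI : closed_set I).

(** The tree is built one arrow at a time, and the value at a new vertex is the image of the value
    at its parent; no other arrow of the tree meets the new vertex. *)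
Lemma rooted_transport M (m : M c) : exists v : forall i, M i,
  v c = m /\ forall a, src a \in I -> tgt a \in I -> qmap M a (v (src a)) = v (tgt a).
Proof.
elim: cI => [H|J a cJ [v [vc vE]] sa ta u l nb].
  exists (dfwith (fun i => 0 : M i) m); split; first by rewrite dfwith_in.
  by move=> a; rewrite !inE => /eqP/H ta /eqP.
exists (dfwith v (qmap M a (v (src a)))).
have vJ i : i \in J -> dfwith v (qmap M a (v (src a))) i = v i.
  by move=> iJ; rewrite dfwith_out //; apply: contraNneq ta => ->.
split=> [|b]; first by rewrite vJ // (rooted_root cJ).
rewrite !inE => /orP[/eqP sb|sb] /orP[/eqP tb|tb].
- by case: (l _ sb).
- by rewrite (negPf (nb _ sb)) in tb.
- by rewrite (u _ sb tb) dfwith_in vJ.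
- by rewrite !vJ // vE.
Qed.

(** The surjective half of the identification of [Hom(P(c), M)] with [M c]; [rooted_heq] is the
    injective half. *)
Lemma rooted_hom M (m : M c) : exists h : qhom (thin I) M, h c (te I c) = m.
Proof.
have [v [vc vE]] := rooted_transport m.
have H a : src a \in I -> qmap M a (v (src a)) = if tgt a \in I then v (tgt a) else 0.
  by move=> sa; rewrite clI // vE // clI.
by exists (thin_hom H); rewrite thin_homE ?(rooted_root cI).
Qed.

Lemma rooted_mem (U : forall i, {vspace thin I i}) : subrep U -> te I c \in U c ->
  forall i, te I i \in U i.
Proof.
move=> US Uc i; have [iI|iI] := orP (orbN (i \in I)); last by rewrite [te I i]thin_out // mem0v.
have /subsetP/(_ i iI) : I \subset [set i | te I i \in U i].
  apply: (rooted_ind_set cI); rewrite ?inE // => a sa ta; rewrite !inE => e.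
  by rewrite -thin_map_te //; apply: (subvP (US a)); rewrite memv_img.
by rewrite inE.
Qed.

Lemma rooted_full (U : forall i, {vspace thin I i}) : subrep U -> te I c \in U c ->
  forall i, U i = fullv.
Proof.
move=> US Uc i; apply/eqP; rewrite eqEsubv subvf /=; apply/subvP=> x _.
by rewrite (thin_eta x) memvZ // rooted_mem.
Qed.

(** The kernel of the difference is a subrepresentation that contains the generator, hence it is
    everything. *)
Lemma rooted_heq M (g h : qhom (thin I) M) : g c (te I c) = h c (te I c) -> heq g h.
Proof.
move=> gh; apply/heqP => i x.
have kc : te I c \in lker (hlin (-1) g h c).
  have E := hlinE (-1) g h (te I c).
  by rewrite memv_ker E gh scaleN1r addNr.
have kF := rooted_full (lker_subrep (hlin (-1) g h)) kc.
have : x \in lker (hlin (-1) g h i) by rewrite kF memvf.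
by rewrite memv_ker hlinE scaleN1r addrC subr_eq0 => /eqP.
Qed.

Lemma rooted_projective : projective (thin I).
Proof.
move=> M N g h gS; have [m gm] := qsurjP gS (h c (te I c)).
have [h' h'c] := rooted_hom m; exists h'.
by apply: rooted_heq; rewrite hcompE h'c.
Qed.
End Rooted.

End Thin.

(** * Trees and the inverse translate *)

Section Paths.
Variables (K : fieldType) (Q : quiver) (R : vert Q -> {set vert Q}).
Hypothesis Rroot : forall c, rooted c (R c).
Hypothesis Rclosed : forall c, closed_set (R c).

Lemma rooted_pred c (I : {set vert Q}) i : rooted c I -> i \in I -> i != c ->
  exists2 d : arr Q, src d \in I & tgt d = i.
Proof.
elim=> [_|J a cJ IH sa _ _ _ _]; first by rewrite inE => ->.
rewrite !inE => /orP[/eqP -> _|iJ ic]; first by exists a; rewrite ?inE ?sa ?orbT.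
by have [d sd td] := IH iJ ic; exists d; rewrite ?inE ?sd ?orbT.
Qed.

Lemma mem_R c : c \in R c.
Proof. exact: rooted_root (Rroot c). Qed.

Lemma R_trans i j : j \in R i -> R j \subset R i.
Proof.
move=> ji; apply: (rooted_ind_set (Rroot j)) => // a _ _; exact: Rclosed.
Qed.

Lemma R_arrow (a : arr Q) : R (tgt a) \subset R (src a).
Proof. by apply: R_trans; apply: Rclosed; apply: mem_R. Qed.

Lemma R_antisym (a : arr Q) : src a \notin R (tgt a).
Proof. by apply/negP=> sa; apply: (rooted_into_root (Rroot (tgt a)) sa). Qed.

Lemma is_path_rconsE i j (s : seq (arr Q)) b :
  is_path i j (rcons s b) = is_path i (src b) s && (tgt b == j).
Proof.
elim: s i => [|a s IH] i /=; first by rewrite [src b == i]eq_sym.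
by rewrite IH andbA.
Qed.

Lemma rooted_path c (I : {set vert Q}) j : rooted c I -> j \in I ->
  exists s : seq (arr Q), is_path c j s /\ (size s < #|I|)%N.
Proof.
move=> cI; elim: cI j => [_ j|J a cJ IH sa ta _ _ _ j].
  by rewrite inE => /eqP ->; exists [::]; rewrite /= eqxx cards1.
rewrite cardsU1 ta => /setU1P[->|/IH[s [ps ss]]].
  by have [s [ps ss]] := IH _ sa; exists (rcons s a); rewrite is_path_rconsE ps eqxx size_rcons.
by exists s; split=> //; apply: leq_trans ss (leq_addl _ _).
Qed.

Lemma path_mem i j (s : seq (arr Q)) : is_path i j s -> j \in R i.
Proof.
suff H k : k \in R i -> is_path k j s -> j \in R i by apply: H; apply: mem_R.
elim: s k => [|a s IH] k ki /= => [/eqP <- //|/andP[/eqP sa]].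
by apply: IH; apply: Rclosed; rewrite sa.
Qed.

Lemma path_uniq i j (s s' : seq (arr Q)) : is_path i j s -> is_path i j s' -> s = s'.
Proof.
elim/last_ind: s j s' => [|s b IH] j s'; elim/last_ind: s' => [|s' b' _] //=.
- move=> /eqP <-; rewrite is_path_rconsE => /andP[/path_mem sb /eqP].
  by case/(rooted_into_root (Rroot i) sb).
- rewrite is_path_rconsE => /andP[/path_mem sb /eqP tb] /eqP ij.
  by case: (rooted_into_root (Rroot i) sb); rewrite tb.
- rewrite !is_path_rconsE => /andP[ps /eqP tb] /andP[ps' /eqP tb'].
  have bb' : b = b'.
    apply: (rooted_uniq (Rroot i)); rewrite ?tb ?tb' ?(path_mem ps) ?(path_mem ps') //.
    by rewrite -tb; apply: Rclosed; apply: path_mem ps.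
  by rewrite bb' in ps *; rewrite (IH _ _ ps ps').
Qed.

Hypothesis card_arr : (#|vert Q| <= #|arr Q|.+1)%N.

(** A path in the tree [R i] has fewer arrows than there are vertices, and [card_arr] turns this
    into the bound built into [qpath]. *)
Lemma path_bound i j (s : seq (arr Q)) : is_path i j s -> (size s <= #|arr Q|)%N.
Proof.
move=> ps; have [s' [ps' ss']] := rooted_path (Rroot i) (path_mem ps).
rewrite (path_uniq ps ps') -ltnS; apply: leq_trans ss' _.
exact: leq_trans (max_card _) card_arr.
Qed.

Lemma qpath_of i j (s : seq (arr Q)) : is_path i j s ->
  exists q : qpath i j, val q = s :> seq _.
Proof.
by move=> ps; exists (exist _ (Bseq (path_bound ps)) ps).
Qed.

Lemma qpath_exists i j : j \in R i -> exists q : qpath i j, True.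
Proof.
by move=> /(rooted_path (Rroot i))[s [/qpath_of[q _] _]]; exists q.
Qed.

Lemma qpath_uniq (i j : vert Q) (p q : qpath i j) : p = q.
Proof. by apply/val_inj/val_inj; apply: path_uniq (valP p) (valP q). Qed.

(** Between two vertices there is at most one path, so a path space has dimension 0 or 1 and this
    sum is its coordinate. Multiplication by an arrow on either side preserves it. *)
Definition path_sum (i j : vert Q) (f : path_space K i j) : K := \sum_q f q.

Lemma path_sum_inj (i j : vert Q) : injective (@path_sum i j).
Proof.
have E (f : path_space K i j) q : path_sum f = f q.
  by rewrite /path_sum (big_pred1 q) // => q'; rewrite (qpath_uniq q' q) /= eqxx.
by move=> f g fg; apply/ffunP=> q; rewrite -!E.
Qed.

Lemma path_sum0 (i j : vert Q) : path_sum (0 : path_space K i j) = 0.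
Proof. by rewrite /path_sum big1 // => q _; rewrite ffunE. Qed.

Lemma path_sum_lin (i j : vert Q) c (f g : path_space K i j) :
  path_sum (c *: f + g) = c * path_sum f + path_sum g.
Proof.
rewrite /path_sum mulr_sumr -big_split; apply: eq_bigr => q _.
by rewrite !ffunE.
Qed.

Lemma path_sum_surj i j c : j \in R i -> exists f : path_space K i j, path_sum f = c.
Proof.
move=> /qpath_exists[q _]; exists [ffun=> c].
by rewrite /path_sum (big_pred1 q) ?ffunE // => q'; rewrite (qpath_uniq q' q) /= eqxx.
Qed.

Lemma path_sum_out (i j : vert Q) (f : path_space K i j) : j \notin R i -> path_sum f = 0.
Proof.
move=> jR; rewrite /path_sum big1 // => q _.
by case/negP: jR; apply: path_mem (valP q).
Qed.

Lemma path_sum_post i (a : arr Q) (f : path_space K i (src a)) :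
  path_sum (post_arrow f) = path_sum f.
Proof.
rewrite /path_sum; under eq_bigr do rewrite ffunE.
rewrite (exchange_big_dep xpredT) //=; apply: eq_bigr => p _.
have [q qE] := qpath_of (is_path_rcons (valP p)).
by rewrite (big_pred1 q) // => q'; rewrite (qpath_uniq q' q) qE /= !eqxx.
Qed.

Lemma path_sum_pre (a : arr Q) j (f : path_space K (tgt a) j) :
  path_sum (pre_arrow f) = path_sum f.
Proof.
rewrite /path_sum; under eq_bigr do rewrite ffunE.
rewrite (exchange_big_dep xpredT) //=; apply: eq_bigr => p _.
have [|q qE] := @qpath_of (src a) j (a :: val p).
  by rewrite /= eqxx; apply: (valP p).
by rewrite (big_pred1 q) // => q'; rewrite (qpath_uniq q' q) qE /= !eqxx.
Qed.

End Paths.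

Section Corooted.
Variables (K : fieldType) (Q : quiver) (c : vert Q) (I : {set vert Q}).
Hypothesis cI : @rooted (opq Q) c I.
Hypothesis clI : @closed_set (opq Q) I.

(** Dual to [rooted_transport]: functionals are pulled back along arrows instead of vectors being
    pushed forward. *)
Lemma corooted_transport (M : qrep K Q) (phi : 'Hom(M c, K^o)) :
  exists psi : forall i, 'Hom(M i, K^o), psi c = phi /\
  forall a : arr Q, src a \in I -> tgt a \in I ->
    forall x, psi (tgt a) (qmap M a x) = psi (src a) x.
Proof.
elim: cI => [H|J a cJ [v [vc vE]] sa ta u l nb].
  exists (dfwith (fun i => 0 : 'Hom(M i, K^o)) phi); split; first by rewrite dfwith_in.
  by move=> a; rewrite !inE => /eqP sa /eqP ta; case: (H a ta).
rewrite /= in sa ta u l nb *.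
pose w : 'Hom(M (@src Q a), K^o) := (v (@tgt Q a) \o @qmap K Q M a)%VF.
exists (dfwith v w).
have vJ i : i \in J -> dfwith v w i = v i.
  by move=> iJ; rewrite dfwith_out //; apply: contraNneq ta => ->.
split=> [|b]; first by rewrite vJ // (rooted_root cJ).
rewrite !inE => /orP[/eqP tb|tb] /orP[/eqP sb|sb] x.
- by case: (l _ sb).
- by have e := u _ sb tb; subst b; rewrite dfwith_in vJ // comp_lfunE.
- by rewrite (negPf (nb _ sb)) in tb.
- by rewrite !vJ // vE.
Qed.

Lemma corooted_hom (M : qrep K Q) (phi : 'Hom(M c, K^o)) :
  exists h : qhom M (thin K I), forall x, h c x = (phi x : K) *: te K I c.
Proof.
have [psi [psic psiE]] := corooted_transport phi.
have H (a : arr Q) : tgt a \in I -> forall x,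
    psi (tgt a) (qmap M a x) = if src a \in I then psi (src a) x else 0.
  by move=> ta x; rewrite (clI ta) psiE // (clI ta).
by exists (hom_thin H) => x; rewrite hom_thinE psic.
Qed.
End Corooted.

(** * The irreducible maps attached to an arrow, and the inverse translate of [T(X a)] *)

Section Tree.
Variables (K : fieldType) (Q : quiver) (R R' : vert Q -> {set vert Q}).
Hypothesis Rroot : forall c, rooted c (R c).
Hypothesis Rclosed : forall c, closed_set (R c).
Hypothesis R'root : forall c, @rooted (opq Q) c (R' c).
Hypothesis R'closed : forall c, @closed_set (opq Q) (R' c).
Hypothesis RR' : forall i c, (i \in R' c) = (c \in R i).
Hypothesis card_arr : (#|vert Q| <= #|arr Q|.+1)%N.

(* The supports of P(src a) / P(tgt a) and of the kernel of I(tgt a) -> I(src a):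
   [R c] is the set of vertices reachable from [c], the support of P(c), and [R' c]
   that of the vertices from which [c] is reachable, the support of I(c). *)
Definition top_set (a : arr Q) := R (src a) :\: R (tgt a).
Definition ker_set (a : arr Q) := R' (tgt a) :\: R' (src a).

(** A split morphism between indecomposables is an isomorphism, and isomorphic thin representations
    have equal supports. *)
Lemma thin_no_split (I J : {set vert Q}) i j (f : qhom (thin K I) (thin K J)) :
  connected I -> connected J -> i \in I -> j \in J -> I <> J ->
  ~ split_mono f /\ ~ split_epi f.
Proof.
move=> cI cJ iI jJ IJ.
have dI := thin_indecomposable K cI iI; have dJ := thin_indecomposable K cJ jJ.
split=> -[g e]; apply: IJ; apply: (@thin_iso_inj K).
  by apply: isomorphic_sym; apply: (indecomposable_split dJ (thin_zeroE iI) e).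
exact: (indecomposable_split dI (thin_zeroE jJ) e).
Qed.

Lemma R_connected c : connected (R c).
Proof. exact: rooted_connected (Rroot c). Qed.

Lemma op_connected (I : {set vert Q}) : @connected (opq Q) I -> @connected Q I.
Proof.
by move=> cI A H; apply: cI => a sa ta; apply/esym/H.
Qed.

Lemma R'_connected c : @connected Q (R' c).
Proof. exact/op_connected/(rooted_connected (R'root c)). Qed.

Lemma compat_R (a : arr Q) : compat (R (tgt a)) (R (src a)).
Proof.
move=> b sb tb; rewrite (subsetP (R_arrow Rroot Rclosed a) _ sb).
by rewrite (Rclosed sb).
Qed.

Lemma compat_R' (a : arr Q) : compat (R' (tgt a)) (R' (src a)).
Proof.
move=> b sb tb; rewrite (subsetP (R_arrow R'root R'closed a) _ tb).
by rewrite (R'closed tb).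
Qed.

(** Let the inclusion P(y) -> P(x) factor as [g h]. If [g] is nonzero at [x], it hits a generator of
    the projective P(x) and has a section; otherwise the coordinates of [g] on [R y] form a
    retraction of [h]. *)
Lemma irreducible_proj (a : arr Q) : irreducible (canon K (@compat_R a)).
Proof.
set x := src a; set y := tgt a; set f := canon K _.
have xRx : x \in R x := mem_R Rroot x; have yRy : y \in R y := mem_R Rroot y.
have xRy : x \notin R y := R_antisym Rroot a.
have sub : R y \subset R x := R_arrow Rroot Rclosed a.
have [nm ne] : ~ split_mono f /\ ~ split_epi f.
  apply: (@thin_no_split _ _ y x f (@R_connected _) (@R_connected _) yRy xRx) => e.
  by rewrite e xRx in xRy.
split=> // M h g /heqP fE.
have fE' i : i \in R y -> g i (h i (te K (R y) i)) = te K (R x) i.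
  by move=> iR; have := fE i (te K (R y) i); rewrite canonE // hcompE.
have [g0|] := eqVneq (lker (g x)) fullv; [left | move=> gx; right]; last first.
  have [m gm] : exists m, g x m = te K (R x) x.
    have : ~~ (fullv <= lker (g x))%VS.
      by apply: contra gx => s; rewrite eqEsubv subvf.
    case/subvPn=> m _; rewrite memv_ker => gm.
    pose d : K := tv K (R x) x (g x m).
    have gE : g x m = d *: te K (R x) x by apply: thin_eta.
    have d0 : d != 0 by apply: contra gm => /eqP e; rewrite gE e scale0r.
    by exists (d^-1 *: m); rewrite linearZ /= gE scalerA mulVf // scale1r.
  have [s sE] := rooted_hom (Rroot x) (@Rclosed x) m.
  exists s; apply: (rooted_heq (Rroot x)).
  by rewrite hcompE sE gm hidE.
have gx0 (i : vert Q) : i = x -> forall m, g i m = 0.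
  by move=> -> m; apply/eqP; rewrite -memv_ker g0 memvf.
(* In the tree [R x] every vertex has at most one incoming arrow, so an arrow of [R x] that enters
   [R y] from outside is [a]; it starts at [x], where [g] vanishes. *)
have H (b : arr Q) : tgt b \in R y -> forall m,
    (tv K (R x) (tgt b) \o g (tgt b))%VF (qmap M b m) =
    if src b \in R y then (tv K (R x) (src b) \o g (src b))%VF m else 0.
  move=> tb m; rewrite !comp_lfunE -(qhom_nat g) thin_mapE linearZ /= tv_te.
  rewrite (subsetP sub _ tb) [_ *: _]mulr1; case: ifP => // sb.
  have [sbx|sbx] := orP (orbN (src b \in R x)); last first.
    by rewrite (thin_out (g (src b) m)) // linear0.
  rewrite gx0 ?linear0 //.
  have [tba|tba] := eqVneq (tgt b) y.
    suff -> : b = a by [].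
    by apply: (rooted_uniq (Rroot x)) => //; apply: (subsetP sub).
  have [d sd td] := rooted_pred (Rroot y) tb tba.
  suff bd : b = d by rewrite bd sd in sb.
  by apply: (rooted_uniq (Rroot x)) => //; apply: (subsetP sub).
exists (hom_thin (phi := fun i => (tv K (R x) i \o g i)%VF) H); apply: thin_heq => i iR.
by rewrite hcompE hom_thinE comp_lfunE fE' // tv_te (subsetP sub) // scale1r hidE.
Qed.

(** Dual argument: if [h] is nonzero at [y], a functional there extends to a retraction onto the
    injective I(y); otherwise the values of [h] on [R' x] form a section of [g]. *)
Lemma irreducible_inj (a : arr Q) : irreducible (canon K (@compat_R' a)).
Proof.
set x := src a; set y := tgt a; set f := canon K _.
have xRx : x \in R' x := mem_R R'root x; have yRy : y \in R' y := mem_R R'root y.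
have yRx : y \notin R' x := R_antisym R'root a.
have sub : R' x \subset R' y := R_arrow R'root R'closed a.
have [nm ne] : ~ split_mono f /\ ~ split_epi f.
  apply: (@thin_no_split _ _ y x f (@R'_connected _) (@R'_connected _) yRy xRx) => e.
  by rewrite -e yRy in yRx.
split=> // M h g /heqP fE.
have fE' i : i \in R' y -> g i (h i (te K (R' y) i)) = te K (R' x) i.
  by move=> iR; have := fE i (te K (R' y) i); rewrite canonE // hcompE.
have [h0|h0] := eqVneq (h y (te K (R' y) y)) 0; [right | left]; last first.
  have [phi [phi1 _]] : exists phi : 'Hom(M y, K^o), phi (h y (te K (R' y) y)) = 1 /\
      (forall u, u \in 0%VS -> phi u = 0) by apply: separation; rewrite memv0.
  have [r rE] := corooted_hom (R'root y) (@R'closed y) phi.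
  have [c cE] := thin_end_scalar (hcomp r h) (@R'_connected y).
  have c1 : c = 1.
    have := cE y (te K (R' y) y); rewrite hcompE rE phi1 scale1r => /eqP.
    rewrite -subr_eq0 -{1}[te _ _ _]scale1r -scalerBl scaler_eq0 te_eq0 yRy orbF.
    by rewrite subr_eq0 => /eqP.
  by exists r; apply/heqP=> i m; rewrite cE c1 scale1r hidE.
have hy0 (i : vert Q) : i = y -> h i (te K (R' y) i) = 0 by move=> ->.
have H (b : arr Q) : src b \in R' x -> qmap M b (h (src b) (te K (R' y) (src b))) =
    if tgt b \in R' x then h (tgt b) (te K (R' y) (tgt b)) else 0.
  move=> sb; rewrite (qhom_nat h) thin_map_te ?(subsetP sub) //; case: ifP => // tb.
  have [tby|tby] := orP (orbN (tgt b \in R' y)); last by rewrite [te _ _ _]thin_out // linear0.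
  apply: hy0; have [sba|sba] := eqVneq (src b) x.
    suff -> : b = a by [].
    by apply: (rooted_uniq (R'root y)) => //=; apply: (subsetP sub).
  have [d td sd] := rooted_pred (R'root x) sb sba.
  suff bd : b = d by move: tb; rewrite bd [_ \in _]td.
  by apply: (rooted_uniq (R'root y)) => //=; apply: (subsetP sub).
exists (thin_hom (v := fun i => h i (te K (R' y) i)) H); apply: thin_heq => i iR.
by rewrite hcompE thin_homE // fE' ?(subsetP sub) // hidE.
Qed.

Lemma dual_mapE (X : qrep K Q) (b : arr Q) (phi : dual_rep X (tgt b)) x :
  qmap (dual_rep X) b phi x = phi (qmap X b x).
Proof. by rewrite lfunE /= /dual_map comp_lfunE. Qed.

(** Evaluation at the generator identifies [Hom(P1, P(i))] with a path space that is one-dimensional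
    when [x] lies in [R' i] and zero otherwise, and likewise [Hom(P0, P(i))] with [y] for [x]. The
    cokernel is nonzero exactly when [x] but not [y] lies in [R' i], that is, when [i] lies in
    [top_set a]. *)
Lemma tau_inv_thin (a : arr Q) : is_tau_inv (thin K (ker_set a)) (thin K (top_set a)).
Proof.
set x := src a; set y := tgt a; set X := ker_set a; set Z := top_set a.
have xRx : x \in R' x := mem_R R'root x; have yRy : y \in R' y := mem_R R'root y.
have yRx : y \notin R' x := R_antisym R'root a.
have sub : R' x \subset R' y := R_arrow R'root R'closed a.
pose P1 := @thin K (opq Q) (R' x); pose P0 := @thin K (opq Q) (R' y).
have C1 : @compat (opq Q) (R' x) (R' y).
  by move=> b sb _; rewrite (subsetP sub _ sb) (R'closed sb).
pose d1 : qhom P1 P0 := canon K C1.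
pose N := dual_rep (thin K X).
(* The coordinate functional at [y] generates the dual of [T(X)], and [v] lists its images under the
   arrows. *)
pose v (i : vert (opq Q)) : N i := tv K X i.
have vM (b : arr (opq Q)) : src b \in R' y ->
    qmap N b (v (src b)) = if tgt b \in R' y then v (tgt b) else 0.
  move=> sb; rewrite (R'closed sb); apply/lfunP=> z.
  rewrite dual_mapE thin_mapE linearZ /= tv_te.
  have [tX|tX] := orP (orbN ((src b : vert Q) \in X)); first by rewrite tX [_ *: _]mulr1.
  rewrite (thin_out z) ?linear0 ?scale0r //.
  apply: contra tX; rewrite !inE => /andP[tx _]; rewrite [_ \in R' (tgt a)]sb andbT.
  by apply: contra tx => /R'closed.
pose d0 : qhom P0 N := thin_hom vM.
have d0E i z : d0 i z = (tv K (R' y) i z : K) *: tv K X i by rewrite [LHS]outerE.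
have tvX0 i (z : K) : i \in X -> z *: tv K X i = 0 -> z = 0.
  move=> iX /lfunP/(_ (te K X i)); rewrite scale_lfunE tv_te iX [_ *: _]mulr1 => ->.
  by rewrite lfunE.
have tvXout i : i \notin X -> tv K X i = 0.
  by move=> iX; apply/lfunP=> z; rewrite (thin_out z iX) !linear0.
exists P1, P0, d1, d0; split; [split|].
- split; [exact: rooted_projective (R'root x) _ | exact: rooted_projective (R'root y) _].
- move=> i; apply: limg_fullI => phi.
  have [iX|iX] := orP (orbN (i \in X)); last first.
    by exists 0; rewrite linear0; apply/lfunP=> z; rewrite (thin_out z iX) !linear0.
  exists ((phi (te K X i) : K) *: te K (R' y) i).
  rewrite d0E linearZ /= tv_te; have -> : i \in R' y by move: iX; rewrite inE => /andP[].
  by apply/lfunP=> z; rewrite [in RHS](thin_eta z) linearZ !lfun_simp [_ *: 1]mulr1 [LHS]mulrC.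
- move=> i; apply/vspaceP=> z; apply/memv_imgP/idP=> [[w _ ->]|].
    rewrite memv_ker d0E; have [iX|iX] := orP (orbN (i \in X)); last by rewrite tvXout // scaler0.
    by move: iX; rewrite !inE => /andP[ix _]; rewrite (thin_out w ix) !linear0 scale0r.
  rewrite memv_ker d0E => /eqP z0.
  have [ix|ix] := orP (orbN (i \in R' x)).
    exists ((tv K (R' y) i z : K) *: te K (R' x) i); rewrite ?memvf // linearZ /= canonE //.
    exact: thin_eta.
  exists 0; rewrite ?memvf // linear0.
  have [iy|iy] := orP (orbN (i \in R' y)); last exact: thin_out.
  by rewrite (thin_eta z) (tvX0 _ _ _ z0) ?scale0r // !inE ix.
- move=> L LS Lf; apply: (rooted_full (R'root y) LS).
  have : te K (R' y) y \in (L y + lker (d0 y))%VS by rewrite Lf memvf.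
  case/memv_addP=> l lL [k]; rewrite memv_ker d0E => /eqP k0 e.
  suff k00 : k = 0 by move: e; rewrite k00 addr0 => e; move: lL; rewrite -e.
  by rewrite (thin_eta k) (tvX0 _ _ _ k0) ?scale0r // !inE yRx.
- move=> L LS Lf i; have := Lf i; suff -> : lker (d1 i) = 0%VS by rewrite addv0.
  exact: (canon_inj K C1 sub).
pose w (i : vert Q) (g : qhom P1 (proj_at K (Q := opq Q) i)) : path_space K (Q := opq Q) i x :=
  g x (te K (R' x) x).
pose pr (i : vert Q) (g : qhom P1 (proj_at K (Q := opq Q) i)) : thin K Z i :=
  path_sum (w i g) *: te K Z i.
(* The inclusion [d1] sends the generator of P(x) to the arrow [a] applied to the generator of P(y);
   this is why composition with [d1] preserves coordinates. *)
have tex : d1 x (te K (R' x) x) = qmap P0 a (te K (R' y) y).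
  exact: (etrans (canonE K C1 xRx) (esym (@thin_map_te K (opq Q) (R' y) a yRy))).
have wcomp (i : vert Q) g (g0 : qhom P0 (proj_at K (Q := opq Q) i)) :
    path_sum (w i (hcomp g0 d1)) = path_sum (g0 y (te K (R' y) y) : path_space K (Q := opq Q) i y)
    /\ (path_sum (w i g) = path_sum (g0 y (te K (R' y) y) : path_space K (Q := opq Q) i y) ->
        heq g (hcomp g0 d1)).
  have E : w i (hcomp g0 d1) = @post_arrow K (opq Q) i a (g0 y (te K (R' y) y)).
    by rewrite /w hcompE tex -(qhom_nat g0) lfunE.
  split; first by rewrite E (path_sum_post R'root R'closed card_arr).
  move=> e; apply: (rooted_heq (R'root x)); rewrite [RHS]E.
  apply: (path_sum_inj R'root R'closed).
  by rewrite (path_sum_post R'root R'closed card_arr).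
have Zin (i : vert Q) : i \in Z -> x \in R' i /\ y \notin R' i.
  by rewrite !inE => /andP[? ?]; rewrite !RR'.
exists pr; split.
- move=> i c g1 g2 g gE; rewrite /pr.
  have -> : w i g = c *: w i g1 + w i g2 by rewrite /w gE !lfun_simp.
  by rewrite path_sum_lin scalerDl scalerA.
- move=> i z; rewrite (thin_eta z).
  have [iZ|iZ] := orP (orbN (i \in Z)); last first.
    exists (hzero _ _); rewrite /pr.
    by rewrite [te K Z i]thin_out ?scaler0.
  have [xRi _] := Zin _ iZ.
  have [f fE] := path_sum_surj R'root R'closed card_arr (tv K Z i z) xRi.
  have [g gE] := rooted_hom (R'root x) (@R'closed x) (M := proj_at K (Q := opq Q) i) f.
  exists g; rewrite /pr; congr (_ *: _); rewrite -fE; congr path_sum; exact: gE.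
- move=> i g; split=> [prg|[g0 gE]]; last first.
    have -> : pr i g = pr i (hcomp g0 d1) by rewrite /pr /w gE.
    rewrite /pr; have [-> _] := wcomp i g g0.
    have [iZ|iZ] := orP (orbN (i \in Z)); last by rewrite [te K Z i]thin_out ?scaler0.
    have [_ yRi] := Zin _ iZ.
    by rewrite (path_sum_out R'root R'closed) // scale0r.
  have [f fE] : exists f : path_space K (Q := opq Q) i y, path_sum f = path_sum (w i g).
    have [yRi|yRi] := orP (orbN (y \in R' i)).
      exact: (path_sum_surj R'root R'closed card_arr).
    exists 0; rewrite path_sum0; apply: esym.
    have [xRi|xRi] := orP (orbN (x \in R' i)); last exact: (path_sum_out R'root R'closed).
    have iZ : i \in Z by rewrite !inE -!RR' xRi yRi.
    by move/eqP: prg; rewrite /pr scaler_eq0 te_eq0 iZ orbF => /eqP.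
  have [g0 g0E] := rooted_hom (R'root y) (@R'closed y) (M := proj_at K (Q := opq Q) i) f.
  exists g0; apply: (wcomp i g g0).2; rewrite -fE; congr path_sum; exact: esym g0E.
- move=> b g; rewrite thin_mapE linearZ /= tv_te /pr.
  have -> : w (tgt b) (hcomp (proj_map K (Q := opq Q) b) g) =
      @pre_arrow K (opq Q) b x (w (src b) g) by rewrite /w hcompE lfunE.
  rewrite (path_sum_pre R'root R'closed card_arr).
  have [sZ|sZ] := orP (orbN (src b \in Z)); first by rewrite sZ [_ *: 1]mulr1.
  rewrite (negPf sZ) scaler0 scale0r.
  have [tZ|tZ] := orP (orbN (tgt b \in Z)); last by rewrite [te K Z (tgt b)]thin_out ?scaler0.
  rewrite (path_sum_out R'root R'closed) ?scale0r // RR'.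
  move: sZ tZ; rewrite !inE negb_and negbK => /orP[sy|//] /andP[ty _].
  by case/negP: ty; apply: Rclosed.
Qed.
End Tree.

(** * Uniqueness of the inverse translate *)

(** Only finitely many choices are made, one for each vector of a basis; closure of the relation
    under linear combinations does the rest. *)
Lemma linear_relation (K : fieldType) (V W : vectType K) (r : V -> W -> Prop) :
  (forall v, exists w, r v w) ->
  (forall c v1 v2 w1 w2, r v1 w1 -> r v2 w2 -> r (c *: v1 + v2) (c *: w1 + w2)) ->
  exists f : 'Hom(V, W), forall v, r v (f v).
Proof.
move=> rT rL; pose n := \dim (fullv : {vspace V}).
have [w wE] := fin_all_exists (fun k : 'I_n => rT (vbasis fullv)`_k).
have fL : linear (fun v => \sum_k coord (vbasis fullv) k v *: w k).
  move=> c x y; rewrite scaler_sumr -big_split; apply: eq_bigr => k _.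
  by rewrite linearP scalerDl scalerA.
have [f fE] := linear_lfun fL; exists f => v; rewrite fE.
rewrite {1}(coord_vbasis (memvf v)).
have r00 : r 0 0.
  have [w0 r0] := rT 0; have := rL (-1) _ _ _ _ r0 r0.
  by rewrite scaler0 addr0 scaleN1r addNr.
by elim/big_rec2: _ => // k x y _; apply: rL.
Qed.

Section Presentations.
Variables (K : fieldType) (Q : quiver).
Implicit Types (M N P : qrep K Q).

Lemma surj_surj_iso M N (f : qhom M N) (g : qhom N M) : qsurj f -> qsurj g -> is_iso f.
Proof.
move=> fS gS; apply: bij_is_iso => // i.
by apply: surj_eqdim_inj; [apply: fS | apply: surj_dim (gS i)].
Qed.

Lemma superfluous_surj M N X (f : qhom M N) (g : qhom N X) :
  superfluous (fun i => lker (g i)) ->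
  (forall i y, exists x, g i (f i x) = g i y) -> qsurj f.
Proof.
move=> gs gf; apply: gs; first exact: limg_subrep.
move=> i; apply/eqP; rewrite eqEsubv subvf /=; apply/subvP=> y _.
have [x e] := gf i y; rewrite -[y](subrKC (f i x)).
apply: memv_add (limg_mem _ _) _.
by rewrite memv_ker linearB /= e subrr.
Qed.

Lemma presentation_lift P1 P0 N (d1 : qhom P1 P0) (d0 : qhom P0 N)
    P1' P0' N' (d1' : qhom P1' P0') (d0' : qhom P0' N') (phi : qhom N N') :
  minimal_projective_presentation d1 d0 ->
  minimal_projective_presentation d1' d0' -> is_iso phi ->
  exists (a1 : qhom P1 P1') (a0 : qhom P0 P0'),
    [/\ qsurj a1, qsurj a0 & heq (hcomp d1' a1) (hcomp a0 d1)].
Proof.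
move=> [[PP1 PP0] d0S d10 _ _] [_ d0S' d10' s0' s1'] /is_iso_bij[phiI phiS].
have [a0 /heqP a0E] := PP0 _ _ d0' (hcomp phi d0) d0S'.
have a0E' i x : d0' i (a0 i x) = phi i (d0 i x) by rewrite -!hcompE a0E.
have a0S : qsurj a0.
  apply: (superfluous_surj s0') => i y.
  have [z ze] := qsurjP phiS (d0' i y); have [x xe] := qsurjP d0S z.
  by exists x; rewrite a0E' xe ze.
have d0d1 i x : d0 i (d1 i x) = 0 by apply/eqP; rewrite -memv_ker -d10 limg_mem.
have d0d1' i x : d0' i (d1' i x) = 0 by apply/eqP; rewrite -memv_ker -d10' limg_mem.
have [a1 /heqP a1E] : exists a1, heq (hcomp d1' a1) (hcomp a0 d1).
  apply: projective_lift => // i; apply/subvP=> _ /memv_imgP[x _ ->].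
  by rewrite d10' memv_ker hcompE a0E' d0d1 linear0.
exists a1, a0; split=> //; last exact/heqP.
apply: (superfluous_surj s1') => i y.
have [z ze] := qsurjP a0S (d1' i y).
have : z \in limg (d1 i).
  rewrite d10 memv_ker; apply/eqP/(qinjP phiI).
  by rewrite -a0E' ze d0d1' linear0.
case/memv_imgP=> x _ zx; exists x.
by have := a1E i x; rewrite !hcompE => ->; rewrite -ze zx.
Qed.

End Presentations.

Section TauInverse.
Variables (K : fieldType) (Q : quiver).
Implicit Types (M N : qrep K Q).

Lemma dual_rep_iso M N : isomorphic M N -> isomorphic (dual_rep M) (dual_rep N).
Proof.
case=> f [g [/heqP gf /heqP fg]].
pose D (X Y : qrep K Q) (h : qhom Y X) i : 'Hom(dual_rep X i, dual_rep Y i) :=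
  linfun (dual_map (h i)).
have DE X Y (h : qhom Y X) i phi x : D X Y h i phi x = phi (h i x).
  by rewrite lfunE /= /dual_map comp_lfunE.
have DN X Y (h : qhom Y X) (a : arr (opq Q)) phi :
    qmap (dual_rep Y) a (D X Y h (src a) phi) = D X Y h (tgt a) (qmap (dual_rep X) a phi).
  by apply/lfunP=> x; rewrite DE !dual_mapE DE (qhom_nat h).
exists (mkhom (DN M N g)), (mkhom (DN N M f)).
split; apply/heqP=> i phi; rewrite hcompE hidE; apply/lfunP=> x; rewrite !DE.
  by have := gf i x; rewrite hcompE hidE => ->.
by have := fg i x; rewrite hcompE hidE => ->.
Qed.

Lemma tau_inv_iso (X Y Y' : qrep K Q) : isomorphic Y Y' -> is_tau_inv X Y -> is_tau_inv X Y'.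
Proof.
case=> f /is_iso_bij[fI fS] [P1 [P0 [d1 [d0 [mpp [pr [prL prS prK prN]]]]]]].
exists P1, P0, d1, d0; split=> //; exists (fun i g => f i (pr i g)); split.
- by move=> i c g1 g2 g gE; rewrite (prL i c g1 g2 g gE) linearP.
- move=> i y; have [z <-] := qsurjP fS y; have [g <-] := prS i z; by exists g.
- move=> i g; split=> [e|/prK ->]; last exact: linear0.
  by apply/prK/(qinjP fI); rewrite e linear0.
- by move=> a g; rewrite (qhom_nat f) prN.
Qed.

(** This carries the one computed instance of the inverse translate over to every presentation that
    [is_tau_inv] allows. *)
Lemma tau_inv_unique (X X' Y Y' : qrep K Q) : isomorphic X X' ->
  is_tau_inv X Y -> is_tau_inv X' Y' -> isomorphic Y' Y.
Proof.
move=> /dual_rep_iso[phi phi_iso].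
move=> [P1 [P0 [d1 [d0 [mpp [pr [prL prS prK prN]]]]]]].
move=> [P1' [P0' [d1' [d0' [mpp' [pr' [prL' prS' prK' prN']]]]]]].
have [psi [phi1 phi2]] := phi_iso.
have psi_iso : is_iso psi by exists phi.
have [a1 [a0 [a1S a0S /heqP aE]]] := presentation_lift mpp mpp' phi_iso.
have [b1 [b0 [b1S b0S _]]] := presentation_lift mpp' mpp psi_iso.
have [c1 [/heqP ca1 /heqP ac1]] := surj_surj_iso a1S b1S.
have [c0 [/heqP ca0 /heqP ac0]] := surj_surj_iso a0S b0S.
have pr_eq i g g' : heq g g' -> pr i g = pr i g'.
  move=> gg'; rewrite (prL i 0 g g' g) ?scale0r ?add0r // => j.
  by rewrite scale0r add0r gg'.
have pr_lin i c g1 g2 : pr i (hlin c g1 g2) = c *: pr i g1 + pr i g2 by apply: prL.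
have pr_lin' i c g1 g2 : pr' i (hlin c g1 g2) = c *: pr' i g1 + pr' i g2 by apply: prL'.
(* The graph of the map that composition with [a1] induces between the cokernels; [r0] below says
   that it is single-valued. *)
pose r i (y' : Y' i) (y : Y i) := exists g, pr' i g = y' /\ pr i (hcomp g a1) = y.
have rT i y' : exists y, r i y' y.
  by have [g gy] := prS' i y'; exists (pr i (hcomp g a1)), g.
have rL i c v1 v2 w1 w2 : r i v1 w1 -> r i v2 w2 -> r i (c *: v1 + v2) (c *: w1 + w2).
  move=> [g1 [<- <-]] [g2 [<- <-]]; exists (hlin c g1 g2); rewrite pr_lin' -pr_lin.
  by split=> //; apply: pr_eq; apply/heqP=> j x; rewrite hcompE !hlinE !hcompE.
have [f fr] := fin_all_exists (fun i : vert Q => linear_relation (rT i) (rL i)).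
have r0 i y : r i 0 y -> y = 0.
  move=> [g [/prK'[g0 /heqP gE] <-]]; apply/prK; exists (hcomp g0 a0).
  apply/heqP=> j x; have := aE j x; rewrite !hcompE => <-.
  by have := gE j (a1 j x); rewrite hcompE.
have fE i g : f i (pr' i g) = pr i (hcomp g a1).
  have [g1 [e1 e2]] := fr i (pr' i g).
  have /r0 : r i 0 (-1 *: pr i (hcomp g a1) + f i (pr' i g)).
    rewrite -(subrr (pr' i g)) addrC -scaleN1r; apply: rL; last exact: fr.
    by exists g.
  by rewrite scaleN1r addrC => /eqP; rewrite subr_eq0 => /eqP.
have fN a y : qmap Y a (f (src a) y) = f (tgt a) (qmap Y' a y).
  have [g <-] := prS' _ y; rewrite fE prN prN' fE; apply: pr_eq.
  by apply/heqP=> j x; rewrite !hcompE.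
exists (mkhom fN); apply: bij_is_iso => i.
  apply: inj_lker0 => y; have [g <-] := prS' i y; rewrite /= fE.
  (* From [g a1 = g0 d1] follows [g = (g0 c0) d1'], where [c0] is inverse to [a0]. *)
  move/prK => [g0 /heqP gE]; apply/prK'; exists (hcomp g0 c0); apply/heqP=> j x.
  have xE : x = a1 j (c1 j x) by have := ac1 j x; rewrite hcompE hidE.
  have := gE j (c1 j x); rewrite !hcompE -xE => ->; congr (g0 j _).
  have := aE j (c1 j x); rewrite !hcompE -xE => ->.
  by have := ca0 j (d1 j (c1 j x)); rewrite hcompE hidE.
apply: limg_fullI => y; have [g <-] := prS i y.
exists (pr' i (hcomp g c1)); rewrite /= fE; apply: pr_eq; apply/heqP=> j x.
by rewrite !hcompE; have := ca1 j x; rewrite hcompE hidE => ->.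
Qed.

End TauInverse.

(** * Determiners *)

(** A path from the root to a vertex outside the closed set [J] never enters [J], so every vertex of
    the difference is joined to the root within it. *)
Lemma rooted_diff_connected (Q : quiver) c (I J : {set vert Q}) :
  rooted c I -> closed_set J -> connected (I :\: J).
Proof.
move=> cI cJ A HA.
have E i : i \in I :\: J -> (i \in A) = (c \in A).
  rewrite inE => /andP[iJ iI].
  have cNJ : c \notin J.
    apply: contra iJ => cJ'; apply: (subsetP (rooted_ind_set cI cJ' _)) iI => b _ _.
    exact: cJ.
  have /subsetP/(_ i iI) : I \subset J :|: [set i | (i \in A) == (c \in A)].
    apply: (rooted_ind_set cI) => [|b sb tb]; first by rewrite !inE eqxx orbT.
    rewrite !inE => /orP[/cJ -> //|/eqP sA].
    have [//|tJ] := boolP (tgt b \in J); rewrite -HA ?sA ?eqxx // inE ?tJ ?tb // sb andbT.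
    by apply: contra tJ => /cJ.
  by rewrite !inE (negPf iJ) => /eqP.
by move=> i j iI jI; rewrite !E.
Qed.

Section Kernels.
Variables (K : fieldType) (Q : quiver).
Implicit Types (B C L N Z : qrep K Q).

(** A zero morphism factors through the zero representation, and irreducibility would make [B] or
    [C] zero. *)
Lemma irreducible_neq0 B C (f : qhom B C) : ~ is_zero B -> ~ is_zero C -> irreducible f ->
  exists i x, f i x <> 0.
Proof.
move=> B0 C0 [_ _ /(_ (zero_rep K Q) (hzero _ _) (hzero _ _)) H].
suff : ~ forall i x, f i x = 0.
  (* The witness is found by deciding, at each of the finitely many vertices, whether the kernel is
     everything. *)
  move=> nf; have : ~~ [forall i, lker (f i) == fullv].
    apply/negP=> /forallP f0; apply: nf => i x; apply/eqP.
    by rewrite -memv_ker (eqP (f0 i)) memvf.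
  rewrite negb_forall => /existsP[i fi].
  have : ~~ (fullv <= lker (f i))%VS by apply: contra fi => s; rewrite eqEsubv subvf.
  by case/subvPn=> x _; rewrite memv_ker => /eqP fx; exists i, x.
move=> f0; case: H => [|/split_mono_inj h|/split_epi_surj h].
- by apply/heqP=> i x; rewrite hcompE f0 lfunE.
- by apply/B0/(is_zero_inj h)/zero_rep_is_zero.
- apply/C0/is_zeroP => i y; have [x <-] := qsurjP h y.
  by rewrite lfunE.
Qed.

(** As [B] is indecomposable, [B1] or [B2] is zero; [B2] cannot be, since [f] is nonzero, so the
    intrinsic kernel is the whole kernel. *)
Lemma intrinsic_kernel_unique B C (f : qhom B C) L N (k : qhom N B) :
  indecomposable B -> (exists i x, f i x <> 0) -> is_kernel k f ->
  intrinsic_kernel f L -> isomorphic L N.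
Proof.
move=> [_ BI] [i0 [x0 fx0]] [kI kE] [B1 [B2 [phi [f2 [k2 [phi_iso fphi _ [k2I k2E]]]]]]].
have [phiI phiS] := is_iso_bij phi_iso.
case: (BI B1 B2) => [|/is_zeroP B10|/is_zeroP B20].
- by apply: isomorphic_sym; exists phi.
- pose j : qhom B2 B := hcomp phi (dsum_pair (hzero B2 B1) (hid B2)).
  have jE i w : j i w = phi i (0, w) by rewrite hcompE dsum_pairE hidE lfunE.
  apply: (@kernel_unique K Q _ _ _ (hcomp j k2) k) => // i.
    apply: inj_lker0 => x; rewrite hcompE jE => e; apply: (qinjP k2I).
    have e2 : (0, k2 i x) = 0 :> dsum B1 B2 i.
      by apply: (qinjP phiI); rewrite e linear0.
    by case: e2 => ->; rewrite linear0.
  apply/vspaceP=> y; rewrite kE memv_ker; apply/memv_imgP/eqP=> [[x _ ->]|fy].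
    rewrite hcompE jE fphi; apply/eqP; rewrite -memv_ker -k2E; exact: limg_mem.
  have [[v w] vw] := qsurjP phiS y; have : w \in limg (k2 i).
    by rewrite k2E memv_ker -(fphi i v w) vw fy.
  case/memv_imgP=> x _ wx; exists x; rewrite ?memvf // hcompE jE -vw -wx.
  by rewrite (B10 _ v).
- case: fx0; have [[v w] <-] := qsurjP phiS x0.
  by rewrite fphi (B20 _ w) linear0.
Qed.

Lemma intrinsic_kernel_of B C (f : qhom B C) L (k : qhom L B) :
  right_minimal f -> is_kernel k f -> intrinsic_kernel f L.
Proof.
move=> fm kf; exists (zero_rep K Q), B, (dsum_snd _ _), f, k; split=> // [|i v w].
  apply: bij_is_iso => i; last by apply: limg_fullI => y; exists (0, y); rewrite dsum_sndE.
  apply: inj_lker0 => -[v w]; rewrite dsum_sndE /= => ->.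
  by have /is_zeroP/(_ i v) -> := @zero_rep_is_zero K Q.
by rewrite dsum_sndE.
Qed.

(** Endomorphisms of [B] are scalars, and [f h = f] with [f] nonzero forces the scalar 1. *)
Lemma thin_right_minimal B C (f : qhom B C) (I : {set vert Q}) : connected I ->
  isomorphic B (thin K I) -> (exists i x, f i x <> 0) -> right_minimal f.
Proof.
move=> cI [u [u' [/heqP uu' /heqP u'u]]] [i0 [x0 fx0]] h /heqP fh.
have uK i x : u' i (u i x) = x by have := uu' i x; rewrite hcompE hidE.
have [c cE] := thin_end_scalar (hcomp u (hcomp h u')) cI.
have hE i x : h i x = c *: x.
  have := congr1 (u' i) (cE i (u i x)).
  by rewrite !hcompE !uK linearZ /= uK.
have c1 : c = 1.
  have /eqP := fh i0 x0; rewrite hcompE hE linearZ /= -{2}[f i0 x0]scale1r.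
  rewrite -subr_eq0 -scalerBl scaler_eq0 subr_eq0 => /orP[/eqP //|/eqP f0].
  by case: fx0.
by exists (hid B); split; apply/heqP=> i x; rewrite hcompE !hidE hE c1 scale1r.
Qed.

End Kernels.

Section Determiners.
Variables (K : fieldType) (Q : quiver) (R R' : vert Q -> {set vert Q}).
Hypothesis Rroot : forall c, rooted c (R c).
Hypothesis Rclosed : forall c, closed_set (R c).
Hypothesis R'root : forall c, @rooted (opq Q) c (R' c).
Hypothesis R'closed : forall c, @closed_set (opq Q) (R' c).
Hypothesis RR' : forall i c, (i \in R' c) = (c \in R i).
Hypothesis card_arr : (#|vert Q| <= #|arr Q|.+1)%N.
Implicit Types (B C L N Z : qrep K Q).

Lemma top_set_indecomposable (a : arr Q) : indecomposable (thin K (top_set R a)).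
Proof.
apply: (@thin_indecomposable K Q _ (src a)).
  exact: rooted_diff_connected (Rroot _) (@Rclosed _).
by rewrite inE (R_antisym Rroot) mem_R.
Qed.

Lemma ker_set_indecomposable (a : arr Q) : indecomposable (thin K (ker_set R' a)).
Proof.
apply: (@thin_indecomposable K Q _ (tgt a)).
  exact/op_connected/(rooted_diff_connected (R'root _) (@R'closed _)).
by rewrite inE [_ \notin _](R_antisym R'root a) (mem_R R'root).
Qed.

Lemma R_indecomposable c : indecomposable (thin K (R c)).
Proof.
apply: (@thin_indecomposable K Q _ c); last exact: mem_R.
exact: rooted_connected (Rroot c).
Qed.

(** Nothing almost factors through an epimorphism, whose image contains every other, so only the
    kernel contributes. *)
Lemma determiner_epi (a : arr Q) B C (f : qhom B C) (I : {set vert Q})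
    (k : qhom (thin K (ker_set R' a)) B) Z :
  connected I -> isomorphic B (thin K I) -> indecomposable B -> ~ is_zero C ->
  irreducible f -> qsurj f -> is_kernel k f ->
  (determiner_summand f Z <-> isomorphic Z (thin K (top_set R a))).
Proof.
move=> cI BI dB C0 firr fS kf.
have f0 := irreducible_neq0 dB.1 C0 firr.
have tauX := tau_inv_thin K Rclosed R'root R'closed RR' card_arr a.
have dX := ker_set_indecomposable a.
split=> [[dZ []]|ZE].
- move=> [L [X [fL dX' XL XZ]]].
  have LE := intrinsic_kernel_unique dB f0 kf fL.
  have XE := indecomposable_summand dX LE dX' XL.
  exact: tau_inv_unique (isomorphic_sym XE) tauX XZ.
- move=> [_ [A [iota [u [h [_ _ hf]]]]]]; case: hf => i.
  by rewrite fS subvf.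
split; first exact: indecomposable_iso (isomorphic_sym ZE) (top_set_indecomposable a).
left; exists (thin K (ker_set R' a)), (thin K (ker_set R' a)); split=> //.
- by apply: intrinsic_kernel_of kf; apply: thin_right_minimal BI f0.
- exists (zero_rep K Q); apply: isomorphic_dsum0; exact: zero_rep_is_zero.
- exact: tau_inv_iso (isomorphic_sym ZE) tauX.
Qed.

(* A maximal subrepresentation not containing the image of the arrow [a] could be
   enlarged by everything reachable from the target of [a]. *)
Lemma arrow_in_radical Z N (iota : qhom N Z) (a : arr Q) p :
  is_radical iota -> qmap Z a p \in limg (iota (tgt a)).
Proof.
move=> [_ rad]; apply/rad => U [US Unf Umax]; apply/negPn/negP=> qU.
pose W i : {vspace Z i} := if i \in R (tgt a) then fullv else U i.
have WS : subrep W.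
  move=> b; rewrite /W; have [sb|sb] := boolP (src b \in R (tgt a)).
    by rewrite (Rclosed sb) subvf.
  by case: ifP => _; rewrite ?subvf //; apply: US.
have [i|WU|Wf] := Umax W WS; first by rewrite /W; case: ifP => _; rewrite ?subvf.
  have := WU (tgt a); rewrite /W (mem_R Rroot) => e.
  by rewrite -e memvf in qU.
have := Wf (src a); rewrite /W (negPf (R_antisym Rroot a)) => e.
case/negP: qU; apply: (subvP (US a)); apply: memv_img.
by rewrite e memvf.
Qed.

Fact compat_radical c : compat (R c :\ c) (R c).
Proof.
move=> b; rewrite !inE => /andP[_ sb] tb; rewrite sb tb andbT.
by apply/esym/eqP/(rooted_into_root (Rroot c) sb).
Qed.

(** A subrepresentation that misses the generator at [c] vanishes there, so it lies in the part
    supported off [c]; this part is the unique maximal subrepresentation. *)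
Lemma radical_thin c Z (psi : qhom (thin K (R c)) Z) : is_iso psi ->
  is_radical (hcomp psi (canon K (@compat_radical c))).
Proof.
move=> /is_iso_bij[psiI psiS]; set iota := hcomp _ _.
have cRc := mem_R Rroot c.
have gen (W : forall i, {vspace Z i}) : subrep W -> psi c (te K (R c) c) \in W c ->
    forall i, W i = fullv.
  move=> WS Wc i; apply/eqP; rewrite eqEsubv subvf /=; apply/subvP=> y _.
  have [x <-] := qsurjP psiS y; rewrite memv_preim.
  rewrite (@rooted_full K Q c (R c) (Rroot c) (fun i => psi i @^-1: W i)%VS) ?memvf //.
    move=> b; apply/subvP=> _ /memv_imgP[z zW ->]; rewrite -memv_preim -qhom_nat.
    by apply: (subvP (WS b)); rewrite memv_img // memv_preim.
  by rewrite -memv_preim.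
have iI : qinj iota.
  move=> i; apply: inj_lker0 => x; rewrite hcompE => e.
  have cI := canon_inj K (@compat_radical c) (subsetDl _ _).
  by apply: (qinjP cI); apply: (qinjP psiI); rewrite e !linear0.
have iS := limg_subrep iota.
have ic : psi c (te K (R c) c) \notin limg (iota c).
  apply/negP=> /memv_imgP[x _]; rewrite (thin_out x) ?inE ?eqxx // linear0.
  rewrite -(linear0 (psi c)) => /(qinjP psiI)/eqP; by rewrite te_eq0 cRc.
have sub (W : forall i, {vspace Z i}) : psi c (te K (R c) c) \notin W c ->
    forall i, (W i <= limg (iota i))%VS.
  move=> Wc i; apply/subvP=> z zW; have [x xz] := qsurjP psiS z.
  have [ix|ix] := eqVneq i c.
    subst i; move: xz; rewrite (thin_eta x) linearZ /= => xz.
    have [t0|t0] := eqVneq (tv K (R c) c x) 0.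
      by rewrite -xz t0 scale0r mem0v.
    case/negP: Wc; rewrite -(@scale1r K _ (psi c _)) -(mulVf t0) -scalerA xz.
    exact: memvZ.
  have iRc : x = (tv K (R c) i x : K) *: te K (R c) i by apply: thin_eta.
  have [iR|iR] := orP (orbN (i \in R c)); last first.
    by rewrite -xz (thin_out x iR) linear0 mem0v.
  apply/memv_imgP; exists ((tv K (R c) i x : K) *: te K (R c :\ c) i); first exact: memvf.
  rewrite -xz [RHS]hcompE; congr (psi i _).
  rewrite linearZ /= canonE ?inE ?ix //; exact: compat_radical.
have nf : ~ forall i, limg (iota i) = fullv.
  by move=> /(_ c) e; rewrite e memvf in ic.
split=> // i v; split=> [vi U [US Unf Umax]|]; last first.
  move=> H; apply: (H (fun i => limg (iota i))); split=> // W WS Wi.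
  have [Wc|Wc] := boolP (psi c (te K (R c) c) \in W c); [right | left] => j.
    exact: gen.
  by apply/eqP; rewrite eqEsubv sub ?Wi.
have Uc : psi c (te K (R c) c) \notin U c by apply/negP=> /(gen _ US).
by have [<-|/nf] := Umax _ iS (sub _ Uc).
Qed.

(** If [Z] almost factors through [f] by [h], then [g h] is a nonzero map to the cokernel [T(W)]
    that kills the radical of [Z], so its image sits in the socle, at [c]. The resulting map from
    [Z] onto the simple at [c] lifts to an epimorphism onto P(c), which splits. The kernel of [f] is
    zero and contributes nothing. *)
Lemma determiner_mono c (W : {set vert Q}) B C (f : qhom B C) (g : qhom C (thin K W)) Z :
  c \in W -> (forall i, i \in R c -> i \in W -> i = c) ->
  (forall i, i \in W -> i != c -> exists2 b : arr Q, src b = i & tgt b \in W) ->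
  qinj f -> qsurj g -> (forall i, limg (f i) = lker (g i)) ->
  (determiner_summand f Z <-> isomorphic Z (thin K (R c))).
Proof.
move=> cW Wc Wb fI gS fg; have cRc := mem_R Rroot c.
split=> [[dZ []]|ZE].
- move=> [L [X [[B1 [B2 [phi [f2 [k2 [phi_iso fphi _ [k2I k2E]]]]]]] dX [Y LXY] _]]].
  case: dX.1; have [phiI _] := is_iso_bij phi_iso.
  have L0 : is_zero L.
    apply/is_zeroP=> i x; apply: (qinjP k2I); rewrite linear0.
    have : k2 i x \in lker (f2 i) by rewrite -k2E limg_mem.
    rewrite memv_ker -(fphi i 0) -{1}(linear0 (f i)) => /eqP/(qinjP fI).
    rewrite -(linear0 (phi i)) => /(qinjP phiI); by case.
  have := is_zero_iso (isomorphic_sym LXY) L0; apply: is_zero_inj.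
  instantiate (1 := dsum_pair (hid X) (hzero X Y)) => i.
  by apply: inj_lker0 => x; rewrite dsum_pairE hidE => -[].
- move=> [PZ [N [iota [u [h [rad /heqP hu hf]]]]]].
  have gh0 i x : x \in limg (iota i) -> g i (h i x) = 0.
    case/memv_imgP=> z _ ->; rewrite -[h i _]hcompE hu hcompE; apply/eqP.
    by rewrite -memv_ker -fg limg_mem.
  have [i [x ghx]] : exists i x, g i (h i x) <> 0.
    have : ~~ [forall i, limg (h i) <= limg (f i)]%VS by apply/negP=> /forallP.
    rewrite negb_forall => /existsP[i /subvPn[_ /memv_imgP[x _ ->]]].
    by rewrite fg memv_ker => /eqP; exists i, x.
  (* At another vertex of [W] an arrow inside [W] would carry [g h x] to a nonzero vector, although
     it carries [x] into the radical. *)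
  have ic : i = c.
    apply/eqP/negPn/negP=> ic.
    have iW : i \in W by apply/negPn/negP=> iW; apply: ghx; apply: thin_out.
    have [b sb tb] := Wb i iW ic; subst i; apply: ghx.
    have := gh0 _ _ (@arrow_in_radical _ _ _ b x rad).
    rewrite -!qhom_nat thin_mapE => /eqP; rewrite scaler_eq0 te_eq0 tb orbF => /eqP e.
    by rewrite (thin_eta (g _ _)) e scale0r.
  (* The functional [rho c] makes [g h] a morphism to the simple [thin K [set c]]. *)
  subst i; pose rho (i : vert Q) := (tv K W i \o (g i \o h i))%VF.
  have rhoH (b : arr Q) : tgt b \in [set c] -> forall x,
      rho (tgt b) (qmap Z b x) = if src b \in [set c] then rho (src b) x else 0.
    move=> tb y; rewrite /rho !comp_lfunE gh0 ?(@arrow_in_radical _ _ _ b y rad) // linear0.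
    rewrite inE; case: eqP => // sb; move: tb; rewrite inE => /eqP tb.
    have sR : src b \in R c by rewrite sb.
    case: (rooted_into_root (Rroot c) sR tb).
  have C1 : compat (R c) [set c].
    move=> b sb; rewrite inE => /eqP tb.
    by have := rooted_into_root (Rroot c) sb.
  have s1 : [set c] \subset R c by rewrite sub1set.
  have [h' /heqP hE] := PZ _ _ (canon K C1) (hom_thin rhoH) (canon_surj K C1 s1).
  have [m mE] : exists m, h' c m = te K (R c) c.
    pose d : K := tv K (R c) c (h' c x).
    have dE : h' c x = d *: te K (R c) c by apply: thin_eta.
    have d0 : d != 0.
      apply/eqP=> d0; apply: ghx; rewrite (thin_eta (g c (h c x))).
      have := hE c x; rewrite hcompE dE d0 scale0r linear0 hom_thinE /rho !comp_lfunE.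
      move=> /esym/eqP; rewrite scaler_eq0 te_eq0 inE eqxx orbF => /eqP ->.
      by rewrite scale0r.
    by exists (d^-1 *: x); rewrite linearZ /= dE scalerA mulVf // scale1r.
  have h'S : qsurj h'.
    apply: (rooted_full (Rroot c) (limg_subrep h')).
    by rewrite -mE limg_mem.
  have PR := rooted_projective (K := K) (Rroot c) (@Rclosed c).
  have [s sE] := PR _ _ h' (hid _) h'S.
  exact: indecomposable_split dZ (thin_zeroE cRc) sE.
split; first exact: indecomposable_iso (isomorphic_sym ZE) (R_indecomposable c).
right; have PR := rooted_projective (K := K) (Rroot c) (@Rclosed c).
split; first exact: projective_iso (isomorphic_sym ZE) PR.
have [psi psi_iso] := isomorphic_sym ZE.
have [psi' [/heqP psiK _]] := psi_iso.
(* P(c) is mapped to [C] by sending its generator to a preimage of the socle vector. Its radical is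
   supported on [R c] without [c], which is disjoint from [W], and therefore lands in the image of
   [f]. *)
have [y yE] := qsurjP gS (te K W c).
have [h0 h0E] := rooted_hom (Rroot c) (@Rclosed c) y.
pose h := hcomp h0 psi'; pose iota := hcomp psi (canon K (@compat_radical c)).
have [u uE] : exists u, heq (hcomp f u) (hcomp h iota).
  apply: lift_mono fI _ => i; rewrite fg; apply/subvP=> _ /memv_imgP[x _ ->].
  rewrite memv_ker hcompE [h i _]hcompE [iota i _]hcompE.
  have [iR|iR] := orP (orbN (i \in R c :\ c)); last by rewrite (thin_out x iR) !linear0.
  apply/eqP/thin_out; move: iR; rewrite !inE => /andP[ic iR].
  by apply: contra ic => iW; apply/eqP/Wc.
exists (thin K (R c :\ c)), iota, u, h; split; first exact: radical_thin.
  by move=> i; rewrite uE.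
move=> /(_ c)/subvP/(_ y); have -> : y \in limg (h c).
  have E := psiK c (te K (R c) c); rewrite hcompE hidE in E.
  by rewrite -h0E -E -[h0 c _]hcompE limg_mem.
move=> /(_ isT); rewrite fg memv_ker yE te_eq0; by rewrite cW.
Qed.

End Determiners.

(** * Line quivers *)

Section Line.
Variable n : nat.
Implicit Types (s t : 'I_n.-1 -> 'I_n).

Definition line s t := forall a : 'I_n.-1,
  (s a = a :> nat /\ t a = a.+1 :> nat) \/ (s a = a.+1 :> nat /\ t a = a :> nat).

Lemma line_op s t : line s t -> line t s.
Proof. by move=> H a; have := H a; lia. Qed.

(* [false] when there is no arrow number [k]. *)
Definition right s (k : nat) : bool :=
  [exists a : 'I_n.-1, (a == k :> nat) && (s a == k :> nat)].

(** Every arrow between [c] and [j] points from [c] towards [j]; one of the two ranges of [k] is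
    always empty. *)
Definition reach s (c : 'I_n) : {set 'I_n} := [set j : 'I_n |
  [forall k : 'I_n, ((c <= k < j) ==> right s k) && ((j <= k < c) ==> ~~ right s k)]]%N.

Definition itv (l r : nat) : {set 'I_n} := [set j : 'I_n | l <= j <= r]%N.

Lemma reachP s (c j : 'I_n) :
  reflect ((forall k, c <= k < j -> right s k) /\ (forall k, j <= k < c -> ~~ right s k))%N
          (j \in reach s c).
Proof.
rewrite inE; apply: (iffP forallP) => [H|[H1 H2] k]; last first.
  by apply/andP; split; apply/implyP; [apply: H1 | apply: H2].
split=> k kP.
  have kn : (k < n)%N by have := ltn_ord j; lia.
  by have /andP[/implyP /= h _] := H (Ordinal kn); apply: h.
have kn : (k < n)%N by have := ltn_ord c; lia.
by have /andP[_ /implyP /= h] := H (Ordinal kn); apply: h.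
Qed.

Lemma in_sep (T : finType) (A : {set T}) (p : pred T) j :
  (j \in [set k in A | p k]) = (j \in A) && p j.
Proof. by rewrite inE. Qed.

Section Oriented.
Variables s t : 'I_n.-1 -> 'I_n.
Hypothesis st : line s t.
Let Q := Quiver s t.

Lemma rightE (a : 'I_n.-1) : right s a = (s a == a :> nat).
Proof.
apply/existsP/eqP=> [[b /andP[/eqP ba /eqP sb]]|sa]; last by exists a; rewrite eqxx sa eqxx.
have e : b = a by apply: val_inj.
by rewrite e in sb.
Qed.

Lemma right_arrow (a : 'I_n.-1) : right s a -> s a = a :> nat /\ t a = a.+1 :> nat.
Proof. by rewrite rightE; have := st a; lia. Qed.

Lemma left_arrow (a : 'I_n.-1) : ~~ right s a -> s a = a.+1 :> nat /\ t a = a :> nat.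
Proof. by rewrite rightE; have := st a; lia. Qed.

Lemma right_op (k : nat) : (k < n.-1)%N -> right t k = ~~ right s k.
Proof.
move=> kn; pose a := Ordinal kn; rewrite -[k]/(val a) rightE.
have -> : right t a = (t a == a :> nat).
  apply/existsP/eqP=> [[b /andP[/eqP ba /eqP tb]]|ta]; last by exists a; rewrite eqxx ta eqxx.
  have e : b = a by apply: val_inj.
  by rewrite e in tb.
by have := st a; lia.
Qed.

Lemma reach_closed c : @closed_set Q (reach s c).
Proof.
move=> a /= /reachP[H1 H2]; apply/reachP.
have [ra|ra] := boolP (right s a).
  have [sa ta] := right_arrow ra; split=> k kP; last by apply: H2; lia.
  have [->//|ka] := eqVneq k a; by apply: H1; lia.
have [sa ta] := left_arrow ra; split=> k kP; first by apply: H1; lia.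
have [->//|ka] := eqVneq k a; by apply: H2; lia.
Qed.

Lemma reach_refl c : c \in reach s c.
Proof. by apply/reachP; split=> k; lia. Qed.

Lemma line_noloop (b : 'I_n.-1) j : s b = j -> t b <> j.
Proof. by move=> sb tb; have := st b; rewrite sb tb; lia. Qed.

(** The tree grows from its root [c] one vertex at a time, here to the right and in
    [reach_rooted_left] to the left. *)
Lemma reach_rooted_right c d :
  @rooted Q c [set j in reach s c | (c <= j <= c + d)%N].
Proof.
elim: d => [|d IH].
  have -> : [set j in reach s c | (c <= j <= c + 0)%N] = [set c].
    apply/setP=> j; rewrite in_sep in_set1 addn0 -eqn_leq eq_sym.
    by apply/andP/eqP=> [[_ /eqP/val_inj //]|->]; rewrite reach_refl.
  by apply: Rooted1 => a; apply: line_noloop.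
have [[j [jR jE]]|nj] : (exists j : 'I_n, j \in reach s c /\ j = (c + d.+1)%N :> nat) \/
    forall j : 'I_n, j \in reach s c -> j <> (c + d.+1)%N :> nat.
  have [/existsP[j /andP[? /eqP ?]]|/existsPn H] :=
    boolP [exists j : 'I_n, (j \in reach s c) && (j == c + d.+1 :> nat)%N].
    by left; exists j.
  by right=> j jR je; have := H j; rewrite jR je eqxx.
- have [H1 H2] := reachP _ _ _ jR.
  have an : (c + d < n.-1)%N by have := ltn_ord j; lia.
  pose a : 'I_n.-1 := Ordinal an.
  have ra : right s a by apply: H1; rewrite /=; lia.
  have [sa ta] := right_arrow ra; rewrite /= in sa ta.
  have taj : t a = j by apply: val_inj; rewrite /= ta jE; lia.
  have -> : [set k in reach s c | (c <= k <= c + d.+1)%N] =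
      (tgt (a : arr Q)) |: [set k in reach s c | (c <= k <= c + d)%N].
    apply/setP=> k; rewrite in_setU1 !in_sep /= taj.
    have [->|kj] := eqVneq k j; first by rewrite jR /= jE; lia.
    by rewrite /=; case: (k \in reach s c) => //=; move: kj; rewrite -val_eqE /= jE; lia.
  apply: RootedU IH _ _ _ _ _ => /= [|||b|b].
  - rewrite in_sep; apply/andP; split; last by rewrite sa; lia.
    by apply/reachP; split=> k kP; [apply: H1 | ]; lia.
  - by rewrite in_sep taj jE; apply/nandP; right; lia.
  - move=> b; rewrite in_sep => /andP[_ sb] tb; apply: val_inj => /=.
    have := st b; rewrite tb taj jE; lia.
  - exact: line_noloop.
  - move=> sb; rewrite in_sep; apply/nandP; right.
    have := st b; rewrite sb taj jE => -[]; first lia.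
    move=> [e1 e2]; have ba : b = a by apply: val_inj => /=; lia.
    by rewrite -jE -taj -sb ba sa in e1 *; lia.
have -> // : [set k in reach s c | (c <= k <= c + d.+1)%N] = [set k in reach s c | (c <= k <= c + d)%N].
apply/setP=> k; rewrite !in_sep; case kR: (k \in reach s c) => //=.
by have := nj k kR; lia.
Qed.

Lemma reach_rooted_left c d :
  @rooted Q c [set j in reach s c | (c <= j + d)%N].
Proof.
elim: d => [|d IH].
  (* The bound [c + n] exceeds every vertex, so the base case is the finished right branch. *)
  have -> : [set j in reach s c | (c <= j + 0)%N] = [set j in reach s c | (c <= j <= c + n)%N].
    apply/setP=> j; rewrite !in_sep; congr (_ && _).
    by have := ltn_ord j; lia.
  exact: reach_rooted_right.
have [[j [jR jE]]|nj] : (exists j : 'I_n, j \in reach s c /\ (j + d.+1)%N = c :> nat) \/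
    forall j : 'I_n, j \in reach s c -> (j + d.+1)%N <> c :> nat.
  have [/existsP[j /andP[? /eqP ?]]|/existsPn H] :=
    boolP [exists j : 'I_n, (j \in reach s c) && (j + d.+1 == c :> nat)%N].
    by left; exists j.
  by right=> j jR je; have := H j; rewrite jR je eqxx.
- have [H1 H2] := reachP _ _ _ jR.
  have an : (j < n.-1)%N by have := ltn_ord c; lia.
  pose a : 'I_n.-1 := Ordinal an.
  have ra : ~~ right s a by apply: H2; rewrite /=; lia.
  have [sa ta] := left_arrow ra; rewrite /= in sa ta.
  have taj : t a = j by apply: val_inj; rewrite /= ta.
  have -> : [set k in reach s c | (c <= k + d.+1)%N] =
      (tgt (a : arr Q)) |: [set k in reach s c | (c <= k + d)%N].
    apply/setP=> k; rewrite in_setU1 !in_sep /= taj.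
    have [->|kj] := eqVneq k j; first by rewrite jR /= -jE; lia.
    by rewrite /=; case: (k \in reach s c) => //=; move: kj; rewrite -val_eqE /= -jE; lia.
  apply: RootedU IH _ _ _ _ _ => /= [|||b|b].
  - rewrite in_sep; apply/andP; split; last by rewrite sa; lia.
    by apply/reachP; split=> k kP; [ | apply: H2]; lia.
  - by rewrite in_sep taj -jE; apply/nandP; right; lia.
  - move=> b; rewrite in_sep => /andP[_ sb] tb; apply: val_inj => /=.
    have := st b; rewrite tb taj; lia.
  - exact: line_noloop.
  - move=> sb; rewrite in_sep; apply/nandP; right.
    have := st b; rewrite sb taj => -[]; last lia.
    move=> [e1 e2]; have ba : b = a by apply: val_inj => /=; lia.
    by have := sa; rewrite -ba sb taj; lia.
have -> // : [set k in reach s c | (c <= k + d.+1)%N] = [set k in reach s c | (c <= k + d)%N].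
apply/setP=> k; rewrite !in_sep; case kR: (k \in reach s c) => //=.
by have := nj k kR; lia.
Qed.

Lemma reach_rooted c : @rooted Q c (reach s c).
Proof.
have -> : reach s c = [set j in reach s c | (c <= j + n)%N]; last exact: reach_rooted_left.
apply/setP=> k; rewrite in_sep; case: (k \in reach s c) => //=.
by have := ltn_ord c; lia.
Qed.

Lemma reach_op i c : (i \in reach t c) = (c \in reach s i).
Proof.
apply/reachP/reachP=> -[H1 H2]; split=> k kP; have := ltn_ord i; have := ltn_ord c => cn in_.
- by rewrite -[right s k]negbK -right_op; [apply: H2 | ]; lia.
- by rewrite -right_op; [apply: H1 | ]; lia.
- by rewrite right_op; [apply: H2 | ]; lia.
- by rewrite right_op ?negbK; [apply: H1 | ]; lia.
Qed.

Lemma itv_connected l r : @connected Q (itv l r).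
Proof.
move=> A HA i j; rewrite !inE => iI jI.
have H : forall d (i j : 'I_n), (l <= i <= r)%N -> (l <= j <= r)%N -> j = (i + d)%N :> nat ->
    (i \in A) = (j \in A).
  elim=> [|d IH] i' j' i'I j'I ij.
    by congr (_ \in A); apply: val_inj => /=; lia.
  have an : (i' < n.-1)%N by have := ltn_ord j'; lia.
  pose a : 'I_n.-1 := Ordinal an.
  have kn : (i'.+1 < n)%N by lia.
  rewrite -(IH (Ordinal kn) j') /=; try lia.
  have := HA a; rewrite /= !inE.
  have [[sa ta]|[sa ta]] := st a.
    have -> : s a = i' by apply: val_inj.
    have -> : t a = Ordinal kn by apply: val_inj.
    by apply=> /=; lia.
  have -> : t a = i' by apply: val_inj.
  have -> : s a = Ordinal kn by apply: val_inj.
  by move=> -> //=; lia.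
have [ij|ij] := leqP i j; first by apply: (H (j - i)%N); lia.
by apply/esym/(H (i - j)%N); lia.
Qed.

End Oriented.
End Line.

(** * Indecomposable representations *)

Section Classification.
Variables (K : fieldType) (n : nat) (s t : 'I_n.-1 -> 'I_n).
Hypothesis st : line s t.
Let Q := Quiver s t.
Variable M : qrep K Q.

(* The data [v] and [phi] define, as far as the arrows on the right of [j] are
   concerned, morphisms from and to the thin representation on [j, r]. *)
Definition splits_right (j : 'I_n) (r : nat) (v : forall i, M i) (phi : forall i, 'Hom(M i, K^o)) :=
  forall a : 'I_n.-1, (j <= a)%N ->
  ((s a <= r)%N -> @qmap K Q M a (v (s a)) = if (t a <= r)%N then v (t a) else 0) /\
  ((t a <= r)%N -> forall x, phi (t a) (@qmap K Q M a x) = if (s a <= r)%N then phi (s a) x else 0).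

(** A nonzero subquotient [A / B] at [j] is followed to the right, by images along an arrow leaving
    [j] and by preimages along one entering it, until it cannot be continued. On the way back the
    vector and the functional of the summand are carried from each vertex to the one on its left.
    Keeping two subspaces lets the induction remember what was met on the left. *)
Lemma summand_right d (j : 'I_n) (A B : {vspace M j}) : (n <= j + d.+1)%N ->
  (B <= A)%VS -> ~~ (A <= B)%VS ->
  exists (r : nat) (v : forall i, M i) (phi : forall i, 'Hom(M i, K^o)),
    [/\ (j <= r < n)%N, v j \in A, phi j (v j) = 1, (forall b, b \in B -> phi j b = 0) &
        splits_right j r v phi].
Proof.
elim: d j A B => [|d IH] j A B jd BA AB.
  have [w wA wB] := subvPn AB; have [f [fw fB]] := separation wB.
  exists j, (dfwith (fun i => 0 : M i) w), (dfwith (fun i => 0 : 'Hom(M i, K^o)) f).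
  rewrite !dfwith_in; split=> //; first by rewrite leqnn ltn_ord.
  by move=> a ja; have := ltn_ord a; have := ltn_ord j; lia.
have [jn|jn] := ltnP j n.-1; last first.
  by apply: IH => //; have := ltn_ord j; lia.
pose a : 'I_n.-1 := Ordinal jn; have aj : a = j :> nat by [].
have other (b : 'I_n.-1) : (j <= b)%N -> b <> a -> (j < b)%N.
  move=> jb ba; rewrite ltn_neqAle jb andbT; apply/eqP=> e; apply: ba.
  by apply: val_inj.
have [[sa ta]|[sa ta]] := st a.
- have ej : j = s a by apply: val_inj.
  have far (b : 'I_n.-1) : (j < b)%N -> s a != s b /\ s a != t b.
    by move=> jb; rewrite -!val_eqE /=; have := st b; lia.
  clearbody a; move: aj; subst j => aj; pose q := @qmap K Q M a.
  (* The interval can stop at [j] if some vector of [A] killed by the arrow is not in [B]; otherwise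
     the image of [A] is still strictly larger than that of [B]. *)
  have [kB|/subvPn[w]] := boolP (A :&: lker q <= B)%VS; last first.
    rewrite memv_cap memv_ker => /andP[wA /eqP qw] wB.
    have [f [fw fB]] := separation wB.
    exists (s a), (dfwith (fun i => 0 : M i) w), (dfwith (fun i => 0 : 'Hom(M i, K^o)) f).
    rewrite !dfwith_in; split=> //; first by rewrite leqnn ltn_ord.
    move=> b jb; have [ba|ba] := eqVneq b a; last first.
      by have := other b jb (elimN eqP ba); have := st b; split=> ?; lia.
    rewrite ba; split=> [_|]; last by rewrite ta sa; lia.
    by rewrite dfwith_in [LHS]qw ta sa ltnn.
  have sub : (q @: B <= q @: A)%VS by apply: limgS.
  have nsub : ~~ (q @: A <= q @: B)%VS.
    apply/negP=> /subvP AB'; have [w wA wB] := subvPn AB.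
    have /memv_imgP[b bB e] : q w \in (q @: B)%VS by apply: AB'; apply: memv_img.
    have : w - b \in B.
      apply: (subvP kB); rewrite memv_cap memv_ker linearB /= e subrr eqxx andbT.
      by rewrite memvB // (subvP BA).
    by move=> h; case/negP: wB; rewrite -(subrK b w) memvD.
  have [|r [v [phi [jr /memv_imgP[w wA vw] phi1 phiB vphi]]]] := IH (t a) _ _ _ sub nsub.
    by rewrite ta; lia.
  pose f : 'Hom(M (s a), K^o) := (phi (t a) \o q)%VF.
  exists r, (dfwith v w), (dfwith phi f); rewrite !dfwith_in; split=> //.
  - by move: jr; rewrite ta sa; lia.
  - by rewrite comp_lfunE -vw.
  - by move=> b bB; rewrite comp_lfunE phiB // memv_img.
  move=> b jb; have [ba|ba] := eqVneq b a.
    have sta : s a != t a by rewrite -val_eqE /= sa ta; lia.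
    rewrite ba !dfwith_in !(dfwith_out _ _ sta).
    have -> : (t a <= r)%N by lia.
  have -> : (s a <= r)%N by lia.
    by split=> // _ x; rewrite comp_lfunE.
  have bb := other b jb (elimN eqP ba); have [sb tb] := far _ bb.
  rewrite !(dfwith_out _ _ sb) !(dfwith_out _ _ tb).
  by apply: vphi; rewrite ta; move: bb; rewrite sa; lia.
have ej : j = t a by apply: val_inj.
have far (b : 'I_n.-1) : (j < b)%N -> t a != s b /\ t a != t b.
  by move=> jb; rewrite -!val_eqE /=; have := st b; lia.
clearbody a; move: aj; subst j => aj; pose q := @qmap K Q M a.
(* For an arrow entering [j] the interval stops if [A] meets the image of the arrow only inside [B]:
   then the functional can be made to vanish on that image as well. *)
have [iB|/subvPn[z0]] := boolP (A :&: limg q <= B)%VS.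
  have [w wA wB] := subvPn AB.
  have wN : w \notin (B + limg q)%VS.
    apply/negP=> /memv_addP[b bB [z zq e]]; case/negP: wB.
    rewrite e memvD // (subvP iB) // memv_cap zq andbT.
    by rewrite -(addKr b z) -e memvD ?memvN // (subvP BA).
  have [f [fw fB]] := separation wN.
  exists (t a), (dfwith (fun i => 0 : M i) w), (dfwith (fun i => 0 : 'Hom(M i, K^o)) f).
  rewrite !dfwith_in; split=> //; first by rewrite leqnn ltn_ord.
    by move=> b bB; apply: fB; apply: (subvP (addvSl _ _)).
  move=> b jb; have [ba|ba] := eqVneq b a; last first.
    by have := other b jb (elimN eqP ba); have := st b; split=> ?; lia.
  rewrite ba; split=> [|_ x]; first by rewrite ta sa; lia.
  rewrite dfwith_in ta sa ltnn; apply: fB; apply: (subvP (addvSr _ _)).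
  exact: limg_mem.
rewrite memv_cap => /andP[z0A /memv_imgP[z _ z0z]] z0B.
have sub : (q @^-1: B <= q @^-1: A)%VS.
  by apply/subvP=> x; rewrite -!memv_preim; apply: (subvP BA).
have nsub : ~~ (q @^-1: A <= q @^-1: B)%VS.
  by apply/subvPn; exists z; rewrite -memv_preim -z0z.
have [|r [v [phi [jr vA phi1 phiB vphi]]]] := IH (s a) _ _ _ sub nsub.
  by rewrite sa; move: jd; rewrite ta; lia.
have [|f [fE fB]] := @extend_functional K _ _ q B (phi (s a)) (v (s a)) phi1.
  by move=> x xB; apply: phiB; rewrite -memv_preim.
exists r, (dfwith v (q (v (s a)))), (dfwith phi f); rewrite !dfwith_in; split=> //.
- by move: jr; rewrite ta sa; lia.
- by rewrite memv_preim.
- by rewrite fE.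
move=> b jb; have [ba|ba] := eqVneq b a.
  have sta : t a != s a by rewrite -val_eqE /= sa ta; lia.
  rewrite ba !dfwith_in !(dfwith_out _ _ sta).
  have -> : (t a <= r)%N by lia.
  have -> : (s a <= r)%N by lia.
  by split.
have bb := other b jb (elimN eqP ba); have [sb tb] := far _ bb.
rewrite !(dfwith_out _ _ sb) !(dfwith_out _ _ tb).
by apply: vphi; rewrite sa; move: bb; rewrite ta; lia.
Qed.

(** At the leftmost vertex with a nonzero space no condition comes from the left, so splitting off
    to the right already gives a direct summand. *)
Lemma indecomposable_interval : indecomposable M ->
  exists l r : nat, (l <= r < n)%N /\ isomorphic M (thin K (itv n l r : {set vert Q})).
Proof.
move=> dM; pose P (i : 'I_n) := (fullv : {vspace M i}) != 0%VS.
have [i0 Pi0] : exists i, P i.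
  have [/existsP //|/existsPn M0] := boolP [exists i, P i]; case: dM.1 => i.
  by have := M0 i; rewrite negbK => /eqP.
case: (arg_minnP (fun i : 'I_n => i : nat) Pi0) => l Pl lmin.
have M0 (i : 'I_n) : (i < l)%N -> forall x : M i, x = 0.
  move=> il x; apply/eqP; rewrite -memv0; suff <- : (fullv : {vspace M i}) = 0%VS by rewrite memvf.
  by apply/eqP/negPn/negP=> /lmin; lia.
have ns : ~~ ((fullv : {vspace M l}) <= 0)%VS by rewrite subv0.
have [|r [v [phi [lr _ phi1 _ vphi]]]] := @summand_right n l fullv 0%VS _ (sub0v _) ns; first by lia.
pose I : {set vert Q} := itv n l r.
have inI (i : 'I_n) : (i \in I) = (l <= i <= r)%N by rewrite inE.
have H1 (a : arr Q) : src a \in I -> qmap M a (v (src a)) = if tgt a \in I then v (tgt a) else 0.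
  rewrite !inI /= => /andP[ls sr]; have [la|la] := leqP l a.
    have -> : (l <= t a)%N by have := st a; lia.
    by rewrite (vphi a la).1.
  have ta : (t a < l)%N by have := st a; lia.
  by rewrite [LHS](M0 _ ta) leqNgt ta.
have H2 (a : arr Q) : tgt a \in I -> forall x,
    phi (tgt a) (qmap M a x) = if src a \in I then phi (src a) x else 0.
  rewrite !inI /= => /andP[ls sr] x; have [la|la] := leqP l a.
    have -> : (l <= s a)%N by have := st a; lia.
    by rewrite (vphi a la).2.
  have sa : (s a < l)%N by have := st a; lia.
  by rewrite (M0 _ sa x) !linear0 if_same.
have lI : l \in I by rewrite inI; lia.
exists l, r; split; first by lia.
have [c cE] := thin_end_scalar (hcomp (hom_thin H2) (thin_hom H1)) (itv_connected st (l := l) (r := r)).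
have c1 : c = 1.
  have := cE l (te K I l); rewrite hcompE thin_homE // hom_thinE phi1 scale1r => /eqP.
  rewrite -subr_eq0 -{1}[te _ _ _]scale1r -scalerBl scaler_eq0 te_eq0 lI orbF.
  by rewrite subr_eq0 => /eqP.
apply: (@indecomposable_split K Q _ _ (hom_thin H2) (thin_hom H1) dM); first exact: thin_zeroE lI.
by apply/heqP=> i x; rewrite cE c1 scale1r hidE.
Qed.

End Classification.

(** * Irreducible morphisms *)

Section IrreducibleThin.
Variables (K : fieldType) (Q : quiver) (B C : qrep K Q) (I J : {set vert Q}).
Variables (phi : qhom B (thin K I)) (phi' : qhom (thin K I) B).
Variables (psi : qhom C (thin K J)) (psi' : qhom (thin K J) C) (f : qhom B C).
Hypothesis phiK : forall i x, phi' i (phi i x) = x.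
Hypothesis phi'K : forall i x, phi i (phi' i x) = x.
Hypothesis psiK : forall i x, psi' i (psi i x) = x.
Hypothesis psi'K : forall i x, psi i (psi' i x) = x.

Lemma irreducible_compat : connected (I :&: J) -> ~ is_zero B -> ~ is_zero C ->
  irreducible f ->
  exists (IJ : compat I J) (c : K), c != 0 /\
    forall i x, f i x = psi' i (c *: canon K IJ i (phi i x)).
Proof.
move=> cIJ B0 C0 firr; have [i0 [x0 fx0]] := irreducible_neq0 B0 C0 firr.
have [|IJ [c c0 hE]] := @thin_hom_compat K Q I J (hcomp psi (hcomp f phi')) cIJ.
  exists i0; have [i0I|i0I] := orP (orbN (i0 \in I)); last first.
    by case: fx0; rewrite -(phiK x0) (thin_out (phi i0 x0) i0I) !linear0.
  split=> // e; case: fx0; rewrite -(phiK x0) -[f _ _]psiK.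
  have -> : psi i0 (f i0 (phi' i0 (phi i0 x0))) = hcomp psi (hcomp f phi') i0 (phi i0 x0).
    by rewrite !hcompE.
  by rewrite [hcomp psi _ _ _]thin_homP e scaler0 linear0.
exists IJ, c; split=> // i x; rewrite -[f i x]psiK -{1}(phiK x); congr (psi' i _).
have -> : psi i (f i (phi' i (phi i x))) = hcomp psi (hcomp f phi') i (phi i x).
  by rewrite !hcompE.
have [iI|iI] := orP (orbN (i \in I)); last by rewrite (thin_out (phi i x) iI) !linear0.
rewrite [LHS]thin_homP hE // [in RHS](thin_eta (phi i x)) [in RHS]linearZ /= canonE //.
by rewrite !scalerA mulrC.
Qed.

Variables (IJ : compat I J) (c : K).
Hypothesis c0 : c != 0.
Hypothesis fE : forall i x, f i x = psi' i (c *: canon K IJ i (phi i x)).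

(** The canonical morphism from [I] to [J] factors through [L], because [L] contains the
    intersection on which it is nonzero; irreducibility makes one factor split. *)
Lemma irreducible_between (L : {set vert Q}) i j l : connected I -> connected J ->
  connected L -> i \in I -> j \in J -> l \in L -> irreducible f ->
  compat I L -> compat L J -> I :&: J \subset L -> L = I \/ L = J.
Proof.
move=> cI cJ cL iI jJ lL [_ _ firr] IL LJ /subsetP sL.
have [|IL'] := eqVneq L I; [by left | right].
have [//|LJ'] := eqVneq L J.
case: (firr (thin K L) (hcomp (canon K IL) phi)
            (hcomp psi' (hlin c (canon K LJ) (hzero _ _)))).
- apply/heqP=> k x; rewrite fE !hcompE hlinE hzeroE addr0; congr (psi' k (c *: _)).
  rewrite (thin_eta (phi k x)).
  have [kI|kI] := orP (orbN (k \in I)); last by rewrite [te K I k]thin_out // !scaler0 !linear0.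
  rewrite 3!linearZ /= (canonE K IJ kI) (canonE K IL kI).
  have [kL|kL] := orP (orbN (k \in L)); first by rewrite canonE.
  rewrite [te K L k]thin_out // linear0 [te K J k]thin_out //.
  by apply: contra kL => kJ; apply: sL; rewrite inE kI.
- case=> r /heqP rE; case: (thin_no_split (canon K IL) cI cL iI lL).
    by move/esym/eqP; rewrite (negPf IL').
  case; exists (hcomp phi r); apply/heqP=> k x; have := rE k (phi' k x).
  by rewrite !hcompE !hidE phi'K => ->; rewrite phi'K.
- case=> r /heqP rE; case: (thin_no_split (canon K LJ) cL cJ lL jJ).
    by move/eqP; rewrite (negPf LJ').
  move=> _; case; exists (hlin c (hcomp r psi') (hzero _ _)); apply/heqP=> k x.
  have := rE k (psi' k x).
  rewrite !hcompE !hlinE !hcompE !hidE !hzeroE !addr0 [canon K LJ k (c *: _)]linearZ.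
  by move/(congr1 (psi k)); rewrite !psi'K.
Qed.

Lemma compat_inj : I \subset J -> qinj f.
Proof.
move=> sIJ i; apply: inj_lker0 => x; rewrite fE => e.
have cI := qinjP (canon_inj K IJ sIJ).
rewrite -(phiK x); suff -> : phi i x = 0 by rewrite linear0.
apply: (cI i); rewrite linear0; apply/eqP; have /eqP := congr1 (psi i) e.
by rewrite psi'K linear0 scaler_eq0 (negPf c0).
Qed.

Lemma compat_surj : J \subset I -> qsurj f.
Proof.
move=> sJI i; apply: limg_fullI => y.
have [x xE] := qsurjP (canon_surj K IJ sJI) (psi i y).
exists (phi' i (c^-1 *: x)); rewrite fE phi'K [canon K IJ i _]linearZ /= scalerA divff // scale1r.
by rewrite xE psiK.
Qed.

Lemma irreducible_neq : irreducible f -> I <> J.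
Proof.
move=> [nm _ _] e; apply: nm.
have sIJ : I \subset J by rewrite e.
have sJI : J \subset I by rewrite e.
by have [g [e1 _]] := bij_is_iso (compat_inj sIJ) (compat_surj sJI); exists g.
Qed.

Lemma irreducible_coker : I \subset J -> exists g : qhom C (thin K (J :\: I)),
  qsurj g /\ forall i, limg (f i) = lker (g i).
Proof.
move=> sIJ; have sIJ' := subsetP sIJ.
have JD : compat J (J :\: I).
  move=> a; rewrite !inE => sJ /andP[tI tJ]; rewrite sJ tJ andbT.
  by apply: contra tI => sI; rewrite -(IJ sI tJ).
exists (hcomp (canon K JD) psi); split.
  move=> i; apply: limg_fullI => y.
  have [x xE] := qsurjP (canon_surj K JD (subsetDl _ _)) y.
  by exists (psi' i x); rewrite hcompE psi'K.
move=> i; apply/vspaceP=> y; rewrite memv_ker hcompE; apply/memv_imgP/eqP=> [[x _ ->]|gy].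
  rewrite fE psi'K [canon K JD i _]linearZ /=; apply/eqP; rewrite scaler_eq0 (negPf c0) /=.
  rewrite (thin_eta (phi i x)).
  have [iI|iI] := orP (orbN (i \in I)); last by rewrite [te K I i]thin_out // !scaler0 !linear0.
  rewrite 2!linearZ /= !canonE ?sIJ' // scaler_eq0 te_eq0 inE iI /=.
  by rewrite orbT.
have [iI|iI] := orP (orbN (i \in I)).
  exists (phi' i (c^-1 *: ((tv K J i (psi i y) : K) *: te K I i))); rewrite ?memvf //.
  have E : canon K IJ i (c^-1 *: ((tv K J i (psi i y) : K) *: te K I i)) = c^-1 *: psi i y.
    by rewrite 2!linearZ /= canonE // -thin_eta.
  by rewrite fE phi'K E scalerA divff // scale1r psiK.
exists 0; rewrite ?memvf // linear0 -[y]psiK; suff -> : psi i y = 0 by rewrite linear0.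
have [iJ|iJ] := orP (orbN (i \in J)); last exact: thin_out.
have iD : i \in J :\: I by rewrite inE iI.
move/eqP: gy; rewrite (thin_eta (psi i y)) linearZ /= canonE // scaler_eq0 te_eq0 iD orbF.
by move/eqP => ->; rewrite scale0r.
Qed.

Lemma irreducible_ker : J \subset I -> exists k : qhom (thin K (I :\: J)) B, is_kernel k f.
Proof.
move=> sJI; have sJI' := subsetP sJI.
have DI : compat (I :\: J) I.
  move=> a; rewrite !inE => /andP[sJ sI] tI; rewrite sI tI andbT.
  by apply/esym; apply: contra sJ => tJ; rewrite (IJ sI tJ).
exists (hcomp phi' (canon K DI)); split.
  move=> i; apply: inj_lker0 => x; rewrite hcompE => e.
  apply: (qinjP (canon_inj K DI (subsetDl _ _))); rewrite linear0.
  by rewrite -[LHS]phi'K e linear0.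
move=> i; apply/vspaceP=> y; rewrite memv_ker fE; apply/memv_imgP/eqP=> [[x _ ->]|fy].
  rewrite hcompE phi'K (thin_eta x).
  have [iD|iD] := orP (orbN (i \in I :\: J)); last by rewrite [te K _ i]thin_out // !scaler0 !linear0.
  move: (iD); rewrite inE => /andP[iJ iI].
  have -> : canon K IJ i (canon K DI i ((tv K (I :\: J) i x : K) *: te K (I :\: J) i)) = 0.
    by rewrite 2!linearZ /= canonE // canonE // [te K J i]thin_out // scaler0.
  by rewrite scaler0 linear0.
have cy : canon K IJ i (phi i y) = 0.
  apply/eqP; have /eqP := congr1 (psi i) fy.
  by rewrite psi'K linear0 scaler_eq0 (negPf c0).
exists ((tv K I i (phi i y) : K) *: te K (I :\: J) i); rewrite ?memvf //.
rewrite hcompE linearZ /=.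
have [iI|iI] := orP (orbN (i \in I)); last first.
  by rewrite -[LHS]phiK (thin_out (phi i y) iI) !linear0 scale0r linear0.
have [iJ|iJ] := orP (orbN (i \in J)); last by rewrite canonE ?inE ?iI ?iJ // -thin_eta phiK.
have p0 : phi i y = 0.
  have /eqP := cy; rewrite (thin_eta (phi i y)) linearZ /= canonE // scaler_eq0 te_eq0 iJ orbF.
  by move=> /eqP ->; rewrite scale0r.
by rewrite -[LHS]phiK p0 [tv K I i 0]linear0 scale0r.
Qed.

End IrreducibleThin.

(** * Which moves of the ends of an interval are irreducible *)

Section Combinatorics.
Variables (n : nat) (rt : nat -> bool).
Local Open Scope nat_scope.

(* The condition for the identity on [l1, r1] :&: [l2, r2] to be a morphism. *)
Definition interval_compat (l1 r1 l2 r2 : nat) : Prop :=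
  [/\ r1 < r2 -> ~~ rt r1, r2 < r1 -> rt r2, l2 < l1 -> rt l1.-1 & l1 < l2 -> ~~ rt l2.-1].

Ltac solve_compat := by split=> lt; first [lia | auto].

(* The conditions on the two ends are independent total preorders; so an
   irreducible morphism moves one end only, and to an adjacent position. *)
Lemma irreducible_intervals (l1 r1 l2 r2 : nat) :
  l1 <= r1 < n -> l2 <= r2 < n -> l1 <= r2 -> l2 <= r1 -> interval_compat l1 r1 l2 r2 ->
  ~ (l1 = l2 /\ r1 = r2) ->
  (forall l r, l <= r < n -> interval_compat l1 r1 l r -> interval_compat l r l2 r2 ->
     l <= maxn l1 l2 -> minn r1 r2 <= r -> (l = l1 /\ r = r1) \/ (l = l2 /\ r = r2)) ->
  [\/ [/\ l1 = l2, r1 < r2, ~~ rt r1, (forall k, r1 < k < r2 -> rt k) & (r2.+1 < n -> ~~ rt r2)],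
      [/\ l1 = l2, r2 < r1, rt r2, (forall k, r2 < k < r1 -> ~~ rt k) & (r1.+1 < n -> rt r1)],
      [/\ r1 = r2, l2 < l1, rt l1.-1, (forall k, l2 <= k < l1.-1 -> ~~ rt k) & (0 < l2 -> rt l2.-1)] |
      [/\ r1 = r2, l1 < l2, ~~ rt l2.-1, (forall k, l1 <= k < l2.-1 -> rt k) & (0 < l1 -> ~~ rt l1.-1)]].
Proof.
move=> b1 b2 l1r2 l2r1 [h1 h2 h3 h4] ne H.
have hl : l1 = l2 \/ r1 = r2.
  (* The intermediate interval has one end moved and the other not, so one of the two moves is
     trivial. *)
  by have := H l1 r2 ltac:(lia) ltac:(solve_compat) ltac:(solve_compat) ltac:(lia) ltac:(lia); lia.
case: hl => e.
  subst l2; have [r12|r21|] := ltngtP r1 r2; last lia.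
    constructor 1; split=> //; first exact: h1.
      move=> k kr; apply/negPn/negP=> nk.
      by have := H l1 k ltac:(lia) ltac:(solve_compat) ltac:(solve_compat) ltac:(lia) ltac:(lia); lia.
    (* An intermediate interval may overshoot: if arrow number [r2] points right, the inclusion
       factors through the larger interval ending at [r2.+1]. *)
    move=> r2n; apply/negP=> rr.
    by have := H l1 r2.+1 ltac:(lia) ltac:(solve_compat) ltac:(solve_compat) ltac:(lia) ltac:(lia); lia.
  constructor 2; split=> //; first exact: h2.
    move=> k kr; apply/negP=> nk.
    by have := H l1 k ltac:(lia) ltac:(solve_compat) ltac:(solve_compat) ltac:(lia) ltac:(lia); lia.
  move=> r2n; apply/negPn/negP=> rr.
  by have := H l1 r1.+1 ltac:(lia) ltac:(solve_compat) ltac:(solve_compat) ltac:(lia) ltac:(lia); lia.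
subst r2; have [l12|l21|] := ltngtP l1 l2; last lia.
  constructor 4; split=> //; first exact: h4.
    move=> k kr; apply/negPn/negP=> nk.
    by have := H k.+1 r1 ltac:(lia) ltac:(solve_compat) ltac:(solve_compat) ltac:(lia) ltac:(lia); lia.
  move=> l10; apply/negP=> rr.
  by have := H l1.-1 r1 ltac:(lia) ltac:(solve_compat) ltac:(solve_compat) ltac:(lia) ltac:(lia); lia.
constructor 3; split=> //; first exact: h3.
  move=> k kr; apply/negP=> nk.
  by have := H k.+1 r1 ltac:(lia) ltac:(solve_compat) ltac:(solve_compat) ltac:(lia) ltac:(lia); lia.
move=> l10; apply/negPn/negP=> rr.
by have := H l2.-1 r1 ltac:(lia) ltac:(solve_compat) ltac:(solve_compat) ltac:(lia) ltac:(lia); lia.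
Qed.
End Combinatorics.

(** * Supports of the modules [T(Z a)] and their socles on a line *)

Section LineSets.
Variables (n : nat) (s t : 'I_n.-1 -> 'I_n).
Hypothesis st : line s t.
Let Q := Quiver s t.

(** The quotient P(x)/P(y) keeps the branch at [x] that avoids [a]: it runs from [x] away from [y]
    for as long as the arrows point outwards. *)
Lemma top_setP (a : 'I_n.-1) (i : 'I_n) :
  reflect (if right s a then (i <= a)%N /\ (forall k, i <= k < a -> ~~ right s k)%N
           else (a < i)%N /\ (forall k, a < k < i -> right s k)%N)
          (i \in @top_set Q (reach s) a).
Proof.
rewrite /top_set in_setD /=; have [ra|ra] := boolP (right s a).
  have [sa ta] := right_arrow st ra.
  apply: (iffP andP) => [[/reachP H /reachP[H1 H2]]|[ia H]].
    have ia : (i <= a)%N.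
      rewrite leqNgt; apply/negP=> ai; apply: H; split=> k; last lia.
      by move=> kP; apply: H1; lia.
    by split=> // k kP; apply: H2; lia.
  split; last by apply/reachP; split=> k kP; [lia | apply: H; lia].
  by apply/negP=> /reachP[_ /(_ a)]; rewrite ra; lia.
have [sa ta] := left_arrow st ra.
apply: (iffP andP) => [[/reachP H /reachP[H1 H2]]|[ia H]].
  have ia : (a < i)%N.
    rewrite ltnNge; apply/negP=> ai; apply: H; split=> k; first lia.
    by move=> kP; apply: H2; lia.
  by split=> // k kP; apply: H1; lia.
split; last by apply/reachP; split=> k kP; [apply: H; lia | lia].
by apply/negP=> /reachP[/(_ a)]; rewrite (negPf ra); lia.
Qed.

Lemma itv_compat (l1 r1 l2 r2 : nat) : (l1 <= r1 < n)%N -> (l2 <= r2 < n)%N ->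
  (l1 <= r2)%N -> (l2 <= r1)%N ->
  interval_compat (right s) l1 r1 l2 r2 <-> @compat Q (itv n l1 r1) (itv n l2 r2).
Proof.
move=> b1 b2 b3 b4; split=> [[h1 h2 h3 h4] a|H].
  rewrite !inE /= => sI tJ; have [ra|ra] := boolP (right s a).
    have [sa ta] := right_arrow st ra.
    have e1 : a = r1 :> nat -> ~ (r1 < r2)%N by move=> e /h1; rewrite -e ra.
    have e4 : a = l2.-1 :> nat -> ~ (l1 < l2)%N by move=> e /h4; rewrite -e ra.
    by lia.
  have [sa ta] := left_arrow st ra.
  have e2 : a = r2 :> nat -> ~ (r2 < r1)%N by move=> e /h2; rewrite -e (negPf ra).
  have e3 : a = l1.-1 :> nat -> ~ (l2 < l1)%N by move=> e /h3; rewrite -e (negPf ra).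
  by lia.
have arrow k : (k.+1 < n)%N -> exists a : 'I_n.-1, a = k :> nat.
  by move=> kn; have kn' : (k < n.-1)%N by [lia]; exists (Ordinal kn').
split=> h.
- have [|a ak] := arrow r1; first lia.
  rewrite -ak; apply/negP=> /(right_arrow st)[sa ta].
  have := H a; rewrite !inE /=; lia.
- have [|a ak] := arrow r2; first lia.
  rewrite -ak; apply: contraT => /(left_arrow st)[sa ta].
  have := H a; rewrite !inE /=; lia.
- have [|a ak] := arrow l1.-1; first lia.
  rewrite -ak; apply: contraT => /(left_arrow st)[sa ta].
  have := H a; rewrite !inE /=; lia.
- have [|a ak] := arrow l2.-1; first lia.
  rewrite -ak; apply/negP=> /(right_arrow st)[sa ta].
  have := H a; rewrite !inE /=; lia.
Qed.

Lemma itv_inj (l1 r1 l2 r2 : nat) : (l1 <= r1 < n)%N -> (l2 <= r2 < n)%N ->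
  itv n l1 r1 = itv n l2 r2 -> l1 = l2 /\ r1 = r2.
Proof.
move=> b1 b2 /setP E; have H (k : nat) : (k < n)%N -> (l1 <= k <= r1)%N = (l2 <= k <= r2)%N.
  by move=> kn; have := E (Ordinal kn); rewrite !inE.
have := H l1; have := H r1; have := H l2; have := H r2; lia.
Qed.

Lemma itv_I (l1 r1 l2 r2 : nat) :
  itv n l1 r1 :&: itv n l2 r2 = itv n (maxn l1 l2) (minn r1 r2).
Proof. by apply/setP=> k; rewrite !inE; lia. Qed.

(** The support is a directed string starting at [src a], so the socle is simple and sits at the
    vertex where the string ends. *)
Definition is_socle (a : 'I_n.-1) (c : 'I_n) : bool :=
  (c \in @top_set Q (reach s) a) &&
  [forall b : 'I_n.-1, (s b == c) ==> (t b \notin @top_set Q (reach s) a)].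

Lemma is_socleP (a : 'I_n.-1) (c : 'I_n) : is_socle a c =
  (c \in @top_set Q (reach s) a) &&
  (if right s a then (c == 0 :> nat) || right s c.-1 else (c == n.-1 :> nat) || ~~ right s c).
Proof.
rewrite /is_socle; have [cT|//] := boolP (c \in _); rewrite /=; move: (cT) => /top_setP.
have cn := ltn_ord c.
have [ra|ra] := boolP (right s a) => -[ca H].
  apply/forallP/orP=> [Hb|Hb b].
    have [c0|c0] := eqVneq (c : nat) 0%N; [by left | right].
    have bn : (c.-1 < n.-1)%N by lia.
    apply: contraT => /(left_arrow st (a := Ordinal bn))[/= sb tb].
    have sbc : s (Ordinal bn) == c by rewrite -val_eqE /= sb; apply/eqP; lia.
    case/negP: (implyP (Hb (Ordinal bn)) sbc).
    apply/top_setP; rewrite ra; split; first lia.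
    move=> k kP; have [->|kc] := eqVneq k c.-1; last by apply: H; lia.
    apply/negP=> /(right_arrow st (a := Ordinal bn))[/= sb' tb']; lia.
  apply/implyP=> /eqP sb; apply/negP=> /top_setP; rewrite ra => -[tba H'].
  have [rb|rb] := boolP (right s b).
    have [e1 e2] := right_arrow st rb; rewrite sb in e1.
    have [ce|ce] := eqVneq (b : nat) a; first lia.
    by have := H b; rewrite rb; lia.
  have [e1 e2] := left_arrow st rb; rewrite sb in e1.
  case: Hb => [/eqP|]; first lia.
  by rewrite e1 /= (negPf rb).
apply/forallP/orP=> [Hb|Hb b].
  have [c0|c0] := eqVneq (c : nat) n.-1%N; [by left | right].
  have bn : (c < n.-1)%N by lia.
  apply/negP=> /(right_arrow st (a := Ordinal bn))[/= sb tb].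
  have sbc : s (Ordinal bn) == c by rewrite -val_eqE /= sb.
  case/negP: (implyP (Hb (Ordinal bn)) sbc).
  apply/top_setP; rewrite (negPf ra); split; first lia.
  move=> k kP; have [->|kc] := eqVneq k c; last by apply: H; lia.
  apply: contraT => /(left_arrow st (a := Ordinal bn))[/= sb' tb']; lia.
apply/implyP=> /eqP sb; apply/negP=> /top_setP; rewrite (negPf ra) => -[tba H'].
have [rb|rb] := boolP (right s b).
  have [e1 e2] := right_arrow st rb; rewrite sb in e1.
  case: Hb => [/eqP|]; first by have := ltn_ord b; lia.
  by rewrite e1 rb.
have [e1 e2] := left_arrow st rb; rewrite sb in e1.
have [ce|ce] := eqVneq (b : nat) a; first lia.
by case/negP: rb; apply: H; lia.
Qed.

Lemma socle_exists (a : 'I_n.-1) : exists c, is_socle a c.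
Proof.
have sT : s a \in @top_set Q (reach s) a.
  by rewrite /top_set in_setD reach_refl andbT (R_antisym (Q := Q) (reach_rooted st) a).
have [ra|ra] := boolP (right s a).
  case: (arg_minnP (fun i : 'I_n => i : nat) sT) => c cT cmin.
  have {}cT : c \in @top_set Q (reach s) a by [].
  exists c; rewrite is_socleP cT ra /=.
  move/top_setP: cT; rewrite ra => -[ca H].
  have [c0|c0] //= := eqVneq (c : nat) 0%N.
  have bn : (c.-1 < n)%N by have := ltn_ord c; lia.
  apply: contraT => rc; have := cmin (Ordinal bn) => /=.
  suff cT : Ordinal bn \in @top_set Q (reach s) a by move/(_ cT); lia.
  apply/top_setP; rewrite ra /=; split; first lia.
  by move=> k kP; have [->//|kc] := eqVneq k c.-1; apply: H; lia.
case: (arg_maxnP (fun i : 'I_n => i : nat) sT) => c cT cmax.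
have {}cT : c \in @top_set Q (reach s) a by [].
exists c; rewrite is_socleP cT (negPf ra) /=.
move/top_setP: cT; rewrite (negPf ra) => -[ca H].
have [c0|c0] //= := eqVneq (c : nat) n.-1%N.
have bn : (c.+1 < n)%N by have := ltn_ord c; lia.
apply/negP=> rc; have := cmax (Ordinal bn) => /=.
suff cT : Ordinal bn \in @top_set Q (reach s) a by move/(_ cT); lia.
apply/top_setP; rewrite (negPf ra) /=; split; first lia.
by move=> k kP; have [->//|kc] := eqVneq k c; apply: H; lia.
Qed.

(** Walking on from [c] leaves the support at once, into [R (tgt a)], and this set is closed under
    arrows; so the walk never returns. *)
Lemma socle_reach (a : 'I_n.-1) c i : is_socle a c ->
  i \in reach s c -> i \in @top_set Q (reach s) a -> i = c.
Proof.
case/andP=> cT /forallP cb iR iT; apply/eqP; move: iT; apply: contraTT => ic.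
move: (cT); rewrite in_setD => /andP[_ cR].
pose U : {set vert Q} := [set j | (j == c) || (j \notin @top_set Q (reach s) a)].
have /subsetP/(_ i iR) : (reach s c : {set vert Q}) \subset U.
  apply: (rooted_ind_set (reach_rooted st c)); first by rewrite inE eqxx.
  move=> b sb tb; rewrite ![_ \in U]inE => /orP[sc|sT]; first by rewrite (implyP (cb b)) ?orbT.
  apply/orP; right; move: sT; rewrite !in_setD !negb_and !negbK => /orP[sy|].
    by rewrite (reach_closed st (a := b) sy).
  case/negP; move: sb; apply/subsetP.
  exact: (R_trans (reach_rooted st) (reach_closed st)).
by rewrite inE (negPf ic).
Qed.

Lemma socle_arrow (a : 'I_n.-1) c i : is_socle a c -> i \in @top_set Q (reach s) a -> i != c ->
  exists2 b : arr Q, src b = i & tgt b \in @top_set Q (reach s) a.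
Proof.
rewrite is_socleP => /andP[/top_setP cT cE] /top_setP iT ic.
have {}ic : (i : nat) <> c by move/val_inj/eqP; apply/negP.
have cn := ltn_ord c; have in_ := ltn_ord i.
move: cT cE iT; have [ra|ra] := boolP (right s a) => -[ca Hc] cE [ia Hi].
  have ci : (c < i)%N.
    rewrite ltnNge leq_eqVlt negb_or; apply/andP; split; first by apply/eqP.
    rewrite -leqNgt leqNgt; apply/negP=> lt; case/orP: cE => [/eqP|]; first lia.
    by apply/negP/Hi; lia.
  have bn : (i.-1 < n.-1)%N by lia.
  have [|sb tb] := left_arrow st (a := Ordinal bn); first by apply: Hc => /=; lia.
  exists (Ordinal bn); first by apply: val_inj; rewrite /= sb /=; lia.
  apply/top_setP; rewrite ra /= tb /=; split; first lia.
  by move=> k kP; apply: Hc; lia.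
have ci : (i < c)%N.
  rewrite ltnNge leq_eqVlt negb_or; apply/andP; split; first by apply/eqP => e; apply: ic.
  rewrite -leqNgt leqNgt; apply/negP=> lt; case/orP: cE => [/eqP|]; first lia.
  by apply/negP; rewrite negbK; apply: Hi; lia.
have bn : (i < n.-1)%N by lia.
have [|sb tb] := right_arrow st (a := Ordinal bn); first by apply: Hc => /=; lia.
exists (Ordinal bn); first by apply: val_inj; rewrite /= sb.
apply/top_setP; rewrite (negPf ra) /= tb /=; split; first lia.
by move=> k kP; apply: Hc; lia.
Qed.

End LineSets.

(** The conditions on the moved end that [irreducible_intervals] provides say that the difference of
    the two intervals is the whole string of [top_setP], neither shorter nor longer. *)
Lemma top_set_itv (n : nat) (s t : 'I_n.-1 -> 'I_n) (st : line s t) (a : 'I_n.-1) (I : {set 'I_n}) l r :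
  (forall i : 'I_n, (i \in I) = (l <= i <= r)%N) ->
  (if right s a then [/\ r = a :> nat, (forall k, l <= k < a -> ~~ right s k)%N &
                        (0 < l -> right s l.-1)%N]
   else [/\ l = a.+1 :> nat, (forall k, a < k < r -> right s k)%N & (r.+1 < n -> ~~ right s r)%N]) ->
  (l <= r < n)%N -> I = @top_set (Quiver s t) (reach s) a.
Proof.
move=> IE H lr; apply/setP=> i; rewrite IE; apply/idP/(top_setP st); have in_ := ltn_ord i.
  by case: ifP H => ra -[e H1 H2] iI; (split; first lia) => k kP; apply: H1; lia.
case: ifP H => ra -[e H1 H2] [ia Hi]; rewrite e ia ?andbT /=.
  rewrite leqNgt; apply/negP=> il.
  have : right s l.-1 by apply: H2; lia.
  by apply/negP/Hi; lia.
rewrite leqNgt; apply/negP=> il.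
have : ~~ right s r by apply: H2; lia.
by apply/negP; rewrite negbK; apply: Hi; lia.
Qed.

(** * The determiners of irreducible morphisms on a line *)

Section DetLine.
Variables (K : fieldType) (n : nat) (s t : 'I_n.-1 -> 'I_n).
Hypothesis st : line s t.
Let Q := Quiver s t.
Let ts := line_op st.
Let R : vert Q -> {set vert Q} := reach s.
Let R' : vert Q -> {set vert Q} := reach t.
Let Rroot : forall c, rooted c (R c) := reach_rooted st.
Let Rclosed : forall c, closed_set (R c) := reach_closed st.
Let R'root : forall c, @rooted (opq Q) c (R' c) := reach_rooted ts.
Let R'closed : forall c, @closed_set (opq Q) (R' c) := reach_closed ts.
Let RR' : forall i c, (i \in R' c) = (c \in R i) := reach_op st.

Let card_arr : (#|vert Q| <= #|arr Q|.+1)%N.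
Proof. by rewrite /= !card_ord; lia. Qed.

Lemma irreducible_line_determiner B C (f : @qhom K Q B C) :
  indecomposable B -> indecomposable C -> irreducible f ->
  exists2 W : {set vert Q}, (exists a : arr Q, W = top_set R a) \/
      (exists (a : arr Q) (c : vert Q), is_socle s t a c /\ W = R c) &
    forall Z, determiner_summand f Z <-> isomorphic Z (thin K W).
Proof.
move=> dB dC firr.
have [l1 [r1 [b1 BI]]] := indecomposable_interval st dB.
have [l2 [r2 [b2 CJ]]] := indecomposable_interval st dC.
set I : {set vert Q} := itv n l1 r1 in BI; set J : {set vert Q} := itv n l2 r2 in CJ.
have [phi [phi' [/heqP e1 /heqP e2]]] := BI; have [psi [psi' [/heqP e3 /heqP e4]]] := CJ.
have phiK i x : phi' i (phi i x) = x by have := e1 i x; rewrite hcompE hidE.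
have phi'K i x : phi i (phi' i x) = x by have := e2 i x; rewrite hcompE hidE.
have psiK i x : psi' i (psi i x) = x by have := e3 i x; rewrite hcompE hidE.
have psi'K i x : psi i (psi' i x) = x by have := e4 i x; rewrite hcompE hidE.
have cI : connected I := itv_connected st (l := l1) (r := r1).
have cJ : connected J := itv_connected st (l := l2) (r := r2).
have cIJ : connected (I :&: J) by rewrite itv_I; apply: (itv_connected st).
have [IJ [c [c0 fE]]] := irreducible_compat phiK psiK cIJ dB.1 dC.1 firr.
have nIJ := irreducible_neq phiK phi'K psiK psi'K c0 fE firr.
have [i0 [x0 fx0]] := irreducible_neq0 dB.1 dC.1 firr.
have [i0I i0J] : i0 \in I /\ i0 \in J.
  split; apply/negPn/negP=> h; apply: fx0; rewrite fE.
    by rewrite (thin_out (phi i0 x0) h) !(linear0, scaler0).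
  by rewrite (thin_out (canon K IJ i0 (phi i0 x0)) h) !(linear0, scaler0).
have [h1 h2] : (l1 <= r2)%N /\ (l2 <= r1)%N by move: i0I i0J; rewrite !inE; lia.
have cmpIJ := (itv_compat st b1 b2 h1 h2).2 IJ.
have ne : ~ (l1 = l2 /\ r1 = r2) by move=> [el er]; apply: nIJ; rewrite /I el er.
have between l r : (l <= r < n)%N -> interval_compat (right s) l1 r1 l r ->
    interval_compat (right s) l r l2 r2 -> (l <= maxn l1 l2)%N -> (minn r1 r2 <= r)%N ->
    (l = l1 /\ r = r1) \/ (l = l2 /\ r = r2).
  move=> lr c1 c2 m1 m2; set L : {set vert Q} := itv n l r.
  have ln : (l < n)%N by lia.
  have lL : (Ordinal ln : vert Q) \in L by rewrite inE /=; lia.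
  have [||||] := irreducible_between phi'K psi'K fE cI cJ (itv_connected st (l := l) (r := r)) i0I i0J lL firr.
  - by apply/(itv_compat st b1 lr) => //; lia.
  - by apply/(itv_compat st lr b2) => //; lia.
  - by rewrite itv_I; apply/subsetP=> k; rewrite !inE; lia.
  - by move/(itv_inj lr b1); left.
  - by move/(itv_inj lr b2); right.
have arrow k : (k.+1 < n)%N -> exists a : 'I_n.-1, a = k :> nat.
  by move=> kn; have kn' : (k < n.-1)%N by [lia]; exists (Ordinal kn').
have mono a : I \subset J -> J :\: I = top_set R a ->
  exists2 W : {set vert Q}, (exists a : arr Q, W = top_set R a) \/
      (exists (a : arr Q) (c : vert Q), is_socle s t a c /\ W = R c) &
    forall Z, determiner_summand f Z <-> isomorphic Z (thin K W).
  move=> sIJ top; have [d da] := socle_exists st a.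
  have [g [gS gE]] := irreducible_coker phi'K psiK psi'K c0 fE sIJ.
  have fI := compat_inj phiK psi'K c0 fE sIJ.
  exists (R d); first by right; exists a, d.
  rewrite top in g gS gE => Z.
  apply: (determiner_mono Rroot Rclosed) fI gS gE.
  - by case/andP: da.
  - by move=> i; apply: (socle_reach st).
  - by move=> i; apply: (socle_arrow st).
have epi a : J \subset I -> I :\: J = ker_set R' a ->
  exists2 W : {set vert Q}, (exists a : arr Q, W = top_set R a) \/
      (exists (a : arr Q) (c : vert Q), is_socle s t a c /\ W = R c) &
    forall Z, determiner_summand f Z <-> isomorphic Z (thin K W).
  move=> sJI ker.
  have [k kf] := irreducible_ker phiK phi'K psi'K c0 fE sJI.
  have fS := compat_surj phi'K psiK c0 fE sJI.
  exists (top_set R a); first by left; exists a.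
  rewrite ker in k kf => Z.
  exact: (determiner_epi Rroot Rclosed R'root R'closed RR' card_arr) cI BI dB dC.1 firr fS kf.
have op k : (k.+1 < n)%N -> right t k = ~~ right s k by move=> kn; apply: (right_op st); lia.
(* In the first and third cases the support grows and [f] is a monomorphism; in the other two it
   shrinks and [f] is an epimorphism. *)
have [] := irreducible_intervals b1 b2 h1 h2 cmpIJ ne between.
- case=> le r12 ra H1 H2; have [|a ar] := arrow r1; first lia.
  apply: (mono a); first by apply/subsetP=> k; rewrite !inE; lia.
  apply: (@top_set_itv n s t st a _ r1.+1 r2) => [k||]; [by rewrite !inE; lia | | lia].
  by rewrite ar (negPf ra); split=> //; rewrite ?ar //; lia.
- case=> le r12 ra H1 H2; have [|a ar] := arrow r2; first lia.
  apply: (epi a); first by apply/subsetP=> k; rewrite !inE; lia.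
  (* [ker_set] for the given orientation is [top_set] for the opposite one, whence the exchange of
     [s] and [t]. *)
  apply: (@top_set_itv n t s ts a _ r2.+1 r1) => [k||]; [by rewrite !inE; lia | | lia].
  rewrite ar op ?ra /=; last lia.
  split=> [//|k kr|rn].
    by rewrite op ?H1 //; lia.
  by rewrite op ?H2.
- case=> re l12 ra H1 H2; have [|a ar] := arrow l1.-1; first lia.
  apply: (mono a); first by apply/subsetP=> k; rewrite !inE; lia.
  apply: (@top_set_itv n s t st a _ l2 l1.-1) => [k||]; [by rewrite !inE; lia | | lia].
  by rewrite ar ra; split=> //; rewrite ?ar //; lia.
case=> re l12 ra H1 H2; have [|a ar] := arrow l2.-1; first lia.
apply: (epi a); first by apply/subsetP=> k; rewrite !inE; lia.
apply: (@top_set_itv n t s ts a _ l1 l2.-1) => [k||]; [by rewrite !inE; lia | | lia].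
rewrite ar op ?ra /=; last lia.
split=> [//|k kr|l0].
  by rewrite op ?negbK ?H1 //; lia.
by rewrite op ?H2 //; lia.
Qed.

Definition det_sets : {set {set vert Q}} :=
  [set top_set R a | a in [set: arr Q]] :|:
  [set R c | c in [set c : 'I_n | [exists a : 'I_n.-1, is_socle s t a c]]].

Lemma det_setsP W : W \in det_sets <-> (exists a : arr Q, W = top_set R a) \/
  (exists (a : arr Q) (c : vert Q), is_socle s t a c /\ W = R c).
Proof.
rewrite in_setU; split=> [/orP[/imsetP[a _ ->]|/imsetP[c]]|[[a ->]|[a [c [ac ->]]]]].
- by left; exists a.
- by rewrite inE => /existsP[a ac] ->; right; exists a, c.
- by apply/orP; left; apply: imset_f; rewrite inE.
- by apply/orP; right; apply: imset_f; rewrite inE; apply/existsP; exists a.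
Qed.

(** The summands form one isomorphism class, so a list of representatives has one entry, and the
    [zero_rep] that ends [big_dsum] is absorbed. *)
Lemma determiner_thin B C (f : @qhom K Q B C) (W : {set vert Q}) D :
  (forall Z, determiner_summand f Z <-> isomorphic Z (thin K W)) ->
  is_minimal_right_determiner f D <-> isomorphic D (thin K W).
Proof.
move=> fW; split=> [[Zs [Z1 Z2 Z3] DZ]|DW]; last first.
  exists [:: thin K W].
    split=> [[] // _|[] // [] //|M /fW]; [exact/fW/isomorphic_refl | by exists 0%N].
  apply: (isomorphic_trans DW); apply: isomorphic_dsum0; exact: zero_rep_is_zero.
have [k kZ _] := Z3 _ ((fW _).2 (isomorphic_refl (thin K W))).
have ZW j : (j < size Zs)%N -> isomorphic (nth (zero_rep K Q) Zs j) (thin K W).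
  by move=> /Z1 /fW.
have Z0 j : (j < size Zs)%N -> j = k.
  move=> jZ; apply: Z2 => //.
  exact: isomorphic_trans (ZW _ jZ) (isomorphic_sym (ZW _ kZ)).
case: Zs {Z1 Z2 Z3} DZ kZ ZW Z0 => [|Z [|Z' Zs]] //= DZ kZ ZW Z0; last first.
  by have := Z0 0%N isT; rewrite -(Z0 1%N isT).
apply: (isomorphic_trans DZ); apply: isomorphic_trans (ZW 0%N isT).
apply: isomorphic_sym; apply: isomorphic_dsum0; exact: zero_rep_is_zero.
Qed.

Lemma Det_line D : @Det K Q D <-> exists2 W, W \in det_sets & isomorphic D (thin K W).
Proof.
split=> [[B [C [f [dB dC firr fD]]]]|[W /det_setsP WE DW]].
  have [W WE fW] := irreducible_line_determiner dB dC firr.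
  by exists W; [apply/det_setsP | apply/(determiner_thin _ fW)].
have idK (I : {set vert Q}) i (x : thin K I i) : hid (thin K I) i (hid (thin K I) i x) = x by rewrite !hidE.
have one : (1 : K) != 0 by apply: oner_neq0.
case: WE DW => [[a ->]|[a [c [ac ->]]]] DW.
  have firr := @irreducible_inj K Q R' R'root R'closed a.
  set f := canon _ _ in firr.
  (* Conjugation by identities brings the canonical morphism into the form that the lemmas on
     transported morphisms expect. *)
  have fE i x : f i x = hid _ i (1 *: f i (hid _ i x)) by rewrite !hidE scale1r.
  have sub : R' (src a) \subset R' (tgt a) := R_arrow R'root R'closed a.
  have [k kf] := irreducible_ker (idK _) (idK _) (idK _) one fE sub.
  have dX c : indecomposable (@thin K Q (R' c)).
    by apply: (@thin_indecomposable K Q _ c); [exact: (R'_connected R'root) | exact: (mem_R R'root)].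
  exists (thin K (R' (tgt a))), (thin K (R' (src a))), f; split=> //.
  apply: (determiner_thin _ _).2 DW => Z.
  apply: (determiner_epi Rroot Rclosed R'root R'closed RR' card_arr (I := R' (tgt a))) kf => //.
  - exact: (R'_connected R'root).
  - exact: isomorphic_refl.
  - exact: (dX _).1.
  - exact: canon_surj.
have firr := @irreducible_proj K Q R Rroot Rclosed a.
set f := canon _ _ in firr.
have fE i x : f i x = hid _ i (1 *: f i (hid _ i x)) by rewrite !hidE scale1r.
have sub := R_arrow Rroot Rclosed a.
have [g [gS gE]] := irreducible_coker (idK _) (idK _) (idK _) one fE sub.
exists (thin K (R (tgt a))), (thin K (R (src a))), f; split=> //; try exact: R_indecomposable.
apply: (determiner_thin _ _).2 DW => Z.
apply: (determiner_mono Rroot Rclosed) gS gE.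
- by case/andP: ac.
- by move=> i; apply: (socle_reach st).
- by move=> i; apply: (socle_arrow st).
- exact: canon_inj.
Qed.

End DetLine.

(** * Counting *)

Section Counting.
Variables (n : nat) (s t : 'I_n.-1 -> 'I_n).
Hypothesis st : line s t.
Let Q := Quiver s t.

Let src_top (a : 'I_n.-1) : s a \in @top_set Q (reach s) a.
Proof. by rewrite in_setD reach_refl andbT (R_antisym (Q := Q) (reach_rooted st) a). Qed.

Let tgt_top (a : 'I_n.-1) : t a \notin @top_set Q (reach s) a.
Proof. by rewrite in_setD reach_refl. Qed.

(** Arrows strictly between [b] and [a] would have to point both ways, so [a = b.+1]; but then [t b]
    lies in the support for [a] and not in that for [b]. *)
Let top_set_right_left (a b : 'I_n.-1) : right s a -> ~~ right s b ->
  @top_set Q (reach s) a <> @top_set Q (reach s) b.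
Proof.
move=> ra rb ab; have [sa _] := right_arrow st ra; have [sb tb] := left_arrow st rb.
have := src_top a; rewrite ab => /(top_setP st); rewrite (negPf rb) => -[H1 H2].
have := src_top b; rewrite -ab => /(top_setP st); rewrite ra => -[H3 H4].
have e : a = b.+1 :> nat.
  apply/eqP/negPn/negP=> ne; have : right s b.+1 by apply: H2; lia.
  by apply/negP/H4; lia.
have /negP := tgt_top b; rewrite -ab; apply; apply/(top_setP st); rewrite ra.
split; first lia.
by move=> k kP; have -> : k = b by lia.
Qed.

(** For arrows of the same direction, the source is the greatest vertex of the support (pointing
    right) or the least (pointing left), so it can be recovered. *)
Lemma top_set_inj : injective (@top_set Q (reach s)).
Proof.
move=> a b ab; apply: val_inj => /=.
have := src_top a; rewrite ab => /(top_setP st).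
have := src_top b; rewrite -ab => /(top_setP st).
have [ra|ra] := boolP (right s a); have [rb|rb] := boolP (right s b).
- by have [sa _] := right_arrow st ra; have [sb _] := right_arrow st rb; lia.
- by case: (top_set_right_left ra rb).
- by case: (top_set_right_left rb ra).
- by have [sa _] := left_arrow st ra; have [sb _] := left_arrow st rb; lia.
Qed.

Lemma reach_inj : injective (reach s).
Proof.
have H (c d : 'I_n) : reach s c = reach s d -> ~ (c < d)%N.
  move=> cd lt; have /reachP[H1 _] : d \in reach s c by rewrite cd reach_refl.
  have /reachP[_ H2] : c \in reach s d by rewrite -cd reach_refl.
  have : right s c by apply: H1; lia.
  by apply/negP/H2; lia.
move=> c d cd; apply: val_inj => /=.
by have := H c d cd; have := H d c (esym cd); lia.
Qed.

(** [reach s c] is closed under arrows, while the other set contains the source of [a] but not its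
    target. *)
Lemma top_set_reach a c : @top_set Q (reach s) a <> reach s c.
Proof.
move=> e; have := tgt_top a; rewrite e; apply/negP; rewrite negbK.
by apply: (reach_closed st (a := a)); rewrite -e.
Qed.

Definition inner_source (c : 'I_n) : bool :=
  [&& 0 < c, c < n.-1, ~~ right s c.-1 & right s c]%N.

Definition all_towards (c : 'I_n) : bool :=
  [forall k : 'I_n.-1, right s k == (k < c)%N].

Lemma all_towardsP (c : 'I_n) : all_towards c -> forall k, (k < n.-1)%N -> right s k = (k < c)%N.
Proof. by move=> /forallP H k kn; have /eqP := H (Ordinal kn). Qed.

(** No arrow enters a source, so it can only be the start of the string for [a]; its second arrow
    then continues the string, which does not end there. *)
Lemma socle_inner a c : is_socle s t a c -> ~~ inner_source c.
Proof.
rewrite (is_socleP st) => /andP[/(top_setP st)]; have := ltn_ord a.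
case: ifP => ra an [ca H] cE; apply/negP=> /and4P[c0 cn r1 r2].
  have [ac|ac] := eqVneq (a : nat) c.
    by case/orP: cE => [|h]; [lia | rewrite h in r1].
  by have := H c; rewrite r2; lia.
by case/orP: cE; [lia | rewrite r2].
Qed.

(** Such a vertex is reachable from every vertex, in particular from the target of [a], so it is
    never in the support. *)
Lemma socle_towards a c : is_socle s t a c -> ~~ all_towards c.
Proof.
move=> /andP[/(top_setP st) cT _]; apply/negP=> /all_towardsP/(_ a (ltn_ord a)).
by case: ifP cT => ra [ca _]; lia.
Qed.

(* The socle of a quotient starting at an arrow [a] is found by walking from [a]
   until the next change of orientation. *)
Lemma socle_of (c : 'I_n) : ~~ inner_source c -> ~~ all_towards c ->
  exists a, is_socle s t a c.
Proof.
move=> ns; rewrite negb_forall => /existsP[a aE]; have an := ltn_ord a; have cn := ltn_ord c.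
have mk k : (k < n.-1)%N -> exists b : 'I_n.-1, b = k :> nat by move=> kn; exists (Ordinal kn).
have [rc|rc] := boolP ((c < n.-1)%N && right s c).
  case/andP: rc => cn1 rc; have [b bc] := mk c cn1; exists b.
  rewrite (is_socleP st) bc rc; apply/andP; split.
    by apply/(top_setP st); rewrite bc rc; split=> // k; lia.
  have [->//|c0] := eqVneq (c : nat) 0%N; apply: contraT; rewrite /= => rc1.
  by case/negP: ns; rewrite /inner_source rc rc1 cn1 lt0n c0.
have [lc|lc] := boolP ((0 < c)%N && ~~ right s c.-1).
  case/andP: lc => c0 lc; have [|b bc] := mk c.-1; first lia.
  exists b; rewrite (is_socleP st) bc (negPf lc); apply/andP; split.
    by apply/(top_setP st); rewrite bc (negPf lc); split; [lia | move=> k; lia].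
  have [->//|c1] := eqVneq (c : nat) n.-1%N; apply/orP; right.
  by move: rc; rewrite negb_and => /orP[|//]; lia.
have [ra|ra] := boolP (right s a).
  have ca : (c <= a)%N by rewrite leqNgt; apply: contra aE => ac; rewrite ra ac.
  pose P k := (c <= k)%N && ((k < n.-1)%N && right s k).
  have exP : exists k, P k by exists a; rewrite /P ca an ra.
  case: (ex_minnP exP) => k /and3P[ck kn rk] kmin; have [b bk] := mk k kn; exists b.
  rewrite (is_socleP st) bk rk; apply/andP; split.
    apply/(top_setP st); rewrite bk rk; split=> // j jk; apply/negP=> rj.
    by have := kmin j; rewrite /P rj andbT; lia.
  by move: lc; rewrite negb_and negbK; case: (c : nat) => //= ?; rewrite ltn0Sn /=.
have ca : (a < c)%N by apply: contraT => ac; move: aE; rewrite (negPf ra) (negPf ac).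
pose P k := (k < c)%N && ~~ right s k.
have exP : exists k, P k by exists a; rewrite /P ca ra.
have ubP k : P k -> (k <= c)%N by case/andP=> /ltnW.
case: (ex_maxnP exP ubP) => k /andP[ck rk] kmax; have [|b bk] := mk k; first lia.
exists b; rewrite (is_socleP st) bk (negPf rk); apply/andP; split.
  apply/(top_setP st); rewrite bk (negPf rk); split=> // j jk; apply: contraT=> rj.
  by have := kmax j; rewrite /P rj andbT; lia.
move: rc; rewrite negb_and => /orP[c1|->]; last by rewrite orbT.
by apply/orP; left; apply/eqP; lia.
Qed.

Lemma card_socles : (0 < n)%N ->
  let p := #|[set c | inner_source c]| in
  #|[set c : 'I_n | [exists a, is_socle s t a c]]| = (if p == 0 then n.-1 else n - p)%N.
Proof.
move=> n0 p.
have socE c : [exists a, is_socle s t a c] = ~~ inner_source c && ~~ all_towards c.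
  apply/existsP/andP=> [[a ac]|[h1 h2]]; last exact: socle_of.
  by rewrite (socle_inner ac) (socle_towards ac).
have [p0|p0] := eqVneq p 0%N.
  have ns (c : 'I_n) : ~~ inner_source c.
    apply/negP=> sc; have := in_set0 c; rewrite -(cards0_eq p0) inE sc; lia.
  have [c ct] : exists c, all_towards c.
    (* The candidate is the tail of the first arrow number that does not point right, or the last
       vertex if all arrows do. *)
    pose P k := (k == n.-1) || ~~ right s k.
    have exP : exists k, P k by exists n.-1; rewrite /P eqxx.
    case: (ex_minnP exP) => k kP kmin.
    have kn : (k < n)%N by have := kmin n.-1; rewrite /P eqxx; lia.
    exists (Ordinal kn); apply/forallP=> j; apply/eqP => /=; have jn := ltn_ord j.
    have [jk|kj] := ltnP j k.
      by have [//|rj] := boolP (right s j); have := kmin j; rewrite /P rj orbT; lia.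
    have [rj|//] := boolP (right s j).
    (* The first right arrow after a left one would start at an inner source. *)
    have exP' : exists i, (k <= i)%N && right s i by exists j; rewrite kj rj.
    case: (ex_minnP exP') => i /andP[ki ri] imin.
    have ij : (i <= j)%N by apply: imin; rewrite kj.
    have kr : ~~ right s k by case/orP: kP => [/eqP|//]; lia.
    have ik : i != k by apply: contra kr => /eqP <-.
    have in_ : (i < n)%N by lia.
    case/negP: (ns (Ordinal in_)); rewrite /inner_source /= ri andbT.
    apply/and3P; split; [lia | lia |].
    by apply/negP=> ri1; have := imin i.-1; rewrite ri1 andbT; lia.
  have -> : [set c : 'I_n | [exists a, is_socle s t a c]] = ~: [set c].
    apply/setP=> d; rewrite !inE socE ns /=; congr (~~ _); apply/idP/eqP=> [dt|-> //].
    have H1 := all_towardsP ct; have H2 := all_towardsP dt.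
    apply: val_inj => /=; have := ltn_ord c; have := ltn_ord d.
    have [cd|cd|//] := ltngtP d c.
      by have := H1 d; have := H2 d; lia.
    by have := H1 c; have := H2 c; lia.
  by rewrite cardsC1 card_ord.
have -> : [set c : 'I_n | [exists a, is_socle s t a c]] = ~: [set c | inner_source c].
  apply/setP=> d; rewrite !inE socE andbC; case dt: (all_towards d) => //=.
  apply: esym; apply/negbTE; rewrite negbK.
  (* Arrows before [d] point right and those after it left, which leaves no room for an inner
     source. *)
  have /set0Pn[c] : [set c | inner_source c] != set0 by rewrite -card_gt0 lt0n.
  rewrite inE => /and4P[c0 cn r1 r2].
  have H := all_towardsP dt; have := H c.-1; have := H c; lia.
by rewrite cardsCs setCK card_ord.
Qed.

Lemma card_det_sets : (0 < n)%N ->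
  let p := #|[set c | inner_source c]| in
  #|det_sets s t| = (if p == 0 then 2 * n - 2 else 2 * n - p - 1)%N.
Proof.
move=> n0 p; rewrite /det_sets cardsU disjoint_setI0; last first.
  apply/pred0P=> W; apply/negP=> /andP[/imsetP[a _ ->] /imsetP[c _]].
  exact: top_set_reach.
rewrite cards0 subn0 !card_imset; [|exact: reach_inj|exact: top_set_inj].
rewrite cardsT /= card_ord card_socles // -/p.
(* Needed because the subtractions are truncated. *)
have pn : (p <= n)%N by rewrite -[X in (_ <= X)%N](card_ord n); apply: max_card.
by case: eqP; lia.
Qed.
End Counting.

(** * From sets of supports to lists of isomorphism classes *)

Lemma lists_thin (K : fieldType) (Q : quiver) (S : qrep K Q -> Prop) (A : {set {set vert Q}}) :
  (forall D, S D <-> exists2 W, W \in A & isomorphic D (thin K W)) ->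
  exists2 Ds, lists_iso_classes S Ds & size Ds = #|A|.
Proof.
move=> SE; exists [seq thin K W | W <- enum A]; last by rewrite size_map -cardE.
have nE k : (k < size [seq thin K W | W <- enum A])%N ->
    nth (zero_rep K Q) [seq thin K W | W <- enum A] k = thin K (nth set0 (enum A) k).
  by rewrite size_map => kn; rewrite (nth_map set0).
split.
- move=> k kn; rewrite nE //; apply/SE; exists (nth set0 (enum A) k).
    by rewrite -mem_enum mem_nth //; move: kn; rewrite size_map.
  exact: isomorphic_refl.
- move=> k l kn ln; rewrite !nE // => /thin_iso_inj /eqP.
  rewrite !size_map in kn ln; rewrite nth_uniq ?enum_uniq //.
  by move/eqP.
- move=> M /SE[W WA MW]; exists (index W (enum A)).
    by rewrite size_map index_mem mem_enum.
  by rewrite nE ?nth_index ?mem_enum // size_map index_mem mem_enum.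
Qed.

Close Scope ring_scope.

Theorem theorem1p1 (K : fieldType) (n : nat) (hn : (1 <= n)%N)
    (o : 'I_n.-1 -> bool) :
  let Q := quiverA o in
  let p := #|[set i : 'I_n | @is_source Q i & (0 < i < n.-1)%N]| in
  exists2 Ds : seq (qrep K Q),
    lists_iso_classes (@Det K Q) Ds &
    size Ds = (if p == 0 then 2 * n - 2 else 2 * n - p - 1)%N.
Proof.
move=> Q p; pose s : 'I_n.-1 -> 'I_n := @src Q; pose t : 'I_n.-1 -> 'I_n := @tgt Q.
have st : line s t by move=> a; rewrite /s /t /=; case: (o a); [left | right].
have [Ds DsL DsS] := lists_thin (@Det_line K n s t st).
exists Ds => //; rewrite DsS (card_det_sets st hn).
(* A vertex strictly inside the line meets exactly the arrows number [i.-1] and [i]; it is a source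
   when the former points left and the latter right. *)
suff -> : [set c | inner_source s c] = [set i : 'I_n | @is_source Q i & (0 < i < n.-1)%N] by [].
apply/setP=> i; rewrite !inE /inner_source.
have [i0|] := boolP (0 < i); last by rewrite andbF.
have [i1|] := boolP (i < n.-1); last by rewrite !andbF.
rewrite /= /is_source !andbT; have i2 : (i.-1 < n.-1)%N by lia.
apply/andP/forallP=> [[r1 r2] a|H].
  apply/eqP=> ta; have [ra|ra] := boolP (right s a).
    have [_] := right_arrow st ra; rewrite [t a]ta => ea.
    by case/negP: r1; rewrite ea.
  have [_] := left_arrow st ra; rewrite [t a]ta => ea.
  by case/negP: ra; rewrite -ea.
split.
  apply/negP=> /(right_arrow st (a := Ordinal i2))[_ ta]; case/negP: (H (Ordinal i2)).
  by rewrite -val_eqE; apply/eqP; rewrite [LHS]ta /=; lia.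
apply: contraT => /(left_arrow st (a := Ordinal i1))[_ ta]; case/negP: (H (Ordinal i1)).
by rewrite -val_eqE; apply/eqP; rewrite [LHS]ta.
Qed.
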